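(* Let $d \geq 2$ be an integer and let $\xi_1, \xi_2, \dots$ be independent random vectors, each uniform on the unit Euclidean sphere $S^{d-1}$ in $\mathbb{R}^d$. Let $p \geq 2$ be a real number. Then for every integer $n \geq 2$ and all real scalars $a_1, \dots, a_n$ with $\sum_{j=1}^n a_j^2 = 1$, we have \[ \mathbb{E}\left|\sum_{j=1}^n a_j\xi_j\right|^p \leq \mathbb{E}\left|\sum_{j=1}^n \frac{1}{\sqrt{n}}\xi_j\right|^p - \tilde{c}_{p,d}\sum_{j=1}^n \left(\frac{1}{n}-a_j^2\right)^2, \] where \[ \tilde{c}_{p,d} = \frac{p(p-2)}{4d}\cdot\begin{cases} \frac{(p+d-2)(p+d-4)}{d(d+2)}, & 2 \leq p \leq 4, \\ 0.385, & p > 4. \end{cases} \]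
   Context: $|\cdot|$ denotes the standard Euclidean norm on $\mathbb{R}^d$, and $S^{d-1} = \{x \in \mathbb{R}^d : |x| = 1\}$. ''Uniform on $S^{d-1}$'' means distributed according to the normalised (rotation-invariant) surface probability measure on $S^{d-1}$. *)

(* Defs.v *)
From HB Require Import structures.
From mathcomp Require Import all_boot all_order all_algebra finmap.
From mathcomp Require Import all_classical all_reals all_analysis.
Import Order.TTheory GRing.Theory Num.Theory.
Import numFieldNormedType.Exports.

Set Implicit Arguments.
Unset Strict Implicit.
Unset Printing Implicit Defensive.

Local Open Scope classical_set_scope.
Local Open Scope ring_scope.

(* The library norm `|x| on row vectors is the sup norm; the Euclidean norm
   induces the same topology, hence the same Borel sets. *)
Definition enorm (R : realType) (d : nat) (x : 'rV[R]_d) : R :=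
  Num.sqrt (\sum_(i < d) x ord0 i ^+ 2).

Definition usphere (R : realType) (d : nat) : set 'rV[R]_d :=
  [set x | enorm x = 1].

Definition borel_rV (R : realType) (d : nat) : measurableType _ :=
  g_sigma_algebraType (@open 'rV[R]_d).

(* The value 0 is added so that the empty set has diameter 0, not -oo. *)
Definition ediam (R : realType) (d : nat) (A : set 'rV[R]_d) : \bar R :=
  ereal_sup (0%:E |` [set (enorm (z.1 - z.2))%:E | z in A `*` A]).

Definition hausdorff_premeasure (R : realType) (d s : nat) (delta : R)
    (A : set 'rV[R]_d) : \bar R :=
  ereal_inf [set (\sum_(0 <= i <oo) (ediam (U i)) ^+ s)%E |
    U in [set U : nat -> set 'rV[R]_d |
      A `<=` \bigcup_i U i /\ forall i, (ediam (U i) <= delta%:E)%E]].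

(* The s-dimensional Hausdorff measure, for s > 0, up to the customary
   constant factor, which is immaterial after normalisation. *)
Definition hausdorff (R : realType) (d s : nat) (A : set 'rV[R]_d) : \bar R :=
  ereal_sup [set hausdorff_premeasure s delta A | delta in [set e : R | 0 < e]].

(* Surface measure on the sphere is (d-1)-dimensional Hausdorff measure; for
   d >= 2 its total mass is finite and positive. *)
Definition uniform_sphere_measure (R : realType) (d : nat)
    (A : set 'rV[R]_d) : \bar R :=
  (hausdorff d.-1 (A `&` @usphere R d) / hausdorff d.-1 (@usphere R d))%E.

Definition uniform_on_sphere (R : realType) (d : nat) (disp : measure_display)
    (Omega : measurableType disp) (P : probability Omega R)
    (X : {RV P >-> borel_rV R d}) : Prop :=
  forall A : set (borel_rV R d), measurable A ->
    distribution P X A = uniform_sphere_measure A.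

Definition independent_RVs (R : realType) (disp disp' : measure_display)
    (Omega : measurableType disp) (T : measurableType disp')
    (P : probability Omega R) (X : nat -> {RV P >-> T}) : Prop :=
  forall (J : {fset nat}) (B : nat -> set T),
    (forall j, measurable (B j)) ->
    P (\bigcap_(j in [set` J]) (X j @^-1` B j)) =
      (\prod_(j <- J) P (X j @^-1` B j))%E.

Definition ctilde (R : realType) (p : R) (d : nat) : R :=
  p * (p - 2) / (4 * d%:R) *
  (if p <= 4 then (p + d%:R - 2) * (p + d%:R - 4) / (d%:R * (d%:R + 2))
   else 385 / 1000).

(* Main.v *)
(** Fix two summands with coefficients a_i, a_j and let Y be the sum of the
    others. Conditionally on A = |Y|^2, rotation invariance turns
    E |a_i xi_i + a_j xi_j + Y|^p into E h(s + w U), where s = a_i^2 + a_j^2,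
    w = 2 |a_i a_j|, U is a coordinate of a uniform vector, and
    h(r) = E f(r + A + 2 sqrt(r A) U) with f(x) = x^(p/2).
    If h'' >= q'' for a polynomial q, then E (h - q)(s + w U) is nondecreasing
    in w, because U is symmetric; so making |a_i a_j| larger at fixed s
    increases the moment by at least the gain of the explicit q.  Replacing
    the pair (a_i, a_j) by (1/sqrt n, sqrt(a_i^2 + a_j^2 - 1/n)) with
    a_i^2 > 1/n > a_j^2 decreases the sum of (1/n - a_l^2)^2 by exactly twice
    the increase of (a_i a_j)^2, and n such steps reach equal coefficients.

    The bounds on h'' rest on E U g(U) = E (1 - U^2) g'(U) / (d - 1), the
    infinitesimal form of rotation invariance. For p <= 4 one integrates the
    bilaplacian of |x|^p twice in the radius; for p > 4 one compares h'' with
    E f'' and bounds f'' from below by a polynomial.  To keep f smooth at 0,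
    x^k is replaced by (x + e)^k and e tends to 0 at the end. *)
Require Import Defs.
From HB Require Import structures.
From mathcomp Require Import all_boot all_order all_algebra finmap ring lra.
From mathcomp Require Import all_classical all_reals all_analysis measurable_realfun.
Import Order.TTheory GRing.Theory Num.Theory.
Import numFieldNormedType.Exports.
Set Implicit Arguments.
Unset Strict Implicit.
Unset Printing Implicit Defensive.
Local Open Scope classical_set_scope.
Local Open Scope ring_scope.

(** * Calculus of bounded integrands *)

(** The analysis is done for an abstract variable U in [-1, 1] that is symmetric and satisfies the
    integration-by-parts identity. The sphere enters only when [Rint_flip] and [Rint_parts] supply
    these two facts; even E U^2 = 1/d is read off the identity. Reflections are the only isometries
    used: each is its own inverse, which halves the invariance proof for Hausdorff measure, and they
    do the work of rotations in a coordinate plane.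

    The tangent lines that bound powers from below touch at 1 because sum a_j^2 = 1 is the mean of
    the squared norm of the whole sum: the linear term averages out and only the value at 1
    survives. For 4 < p <= 6 the function f'' is concave and no tangent lies below it; a parabola
    takes its place, at the price of a fourth moment bound for |Y|. For p > 4 the number 0.385 is a
    threshold that is cleared with room: the bounds give 1 in its place when p > 6 and 1/2 when 4 <
    p <= 6.

    Moments are extended reals, so conditional gains are integrated with their negative parts moved
    to the other side. *)

Section BoundedIntegrals.
Context {R : realType} {dT : measure_display} {T : measurableType dT}
  (mu : probability T R).

(** On a probability space boundedness gives integrability, so linearity of the integral has no side
    condition beyond this predicate. *)
Definition bmeas (f : T -> R) :=
  measurable_fun setT f /\ exists C : R, forall x, `|f x| <= C.

Lemma bmeas_integrable f : bmeas f -> mu.-integrable setT (EFin \o f).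
Proof.
move=> [mf [C fC]]; apply: measurable_bounded_integrable => //.
  by rewrite (le_lt_trans (probability_le1 mu measurableT)) ?ltry.
exists C; split; first exact: num_real.
by move=> y Cy x _; rewrite /= (le_trans (fC x))// ltW.
Qed.

Lemma bmeas_cst c : bmeas (fun=> c).
Proof. by split; [exact: measurable_cst|exists `|c|]. Qed.

Lemma bmeasD f g : bmeas f -> bmeas g -> bmeas (fun x => f x + g x).
Proof.
move=> [mf [C fC]] [mg [D gD]]; split; first exact: measurable_funD.
by exists (C + D) => x; rewrite (le_trans (ler_normD _ _))// lerD.
Qed.

Lemma bmeasM f g : bmeas f -> bmeas g -> bmeas (fun x => f x * g x).
Proof.
move=> [mf [C fC]] [mg [D gD]]; split; first exact: measurable_funM.
by exists (C * D) => x; rewrite normrM ler_pM.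
Qed.

Lemma bmeasZ c f : bmeas f -> bmeas (fun x => c * f x).
Proof. by move=> bf; apply: bmeasM => //; exact: bmeas_cst. Qed.

Lemma bmeasN f : bmeas f -> bmeas (fun x => - f x).
Proof.
move=> /(bmeasZ (-1)); congr bmeas; apply/funext => x; lra.
Qed.

Lemma bmeasB f g : bmeas f -> bmeas g -> bmeas (fun x => f x - g x).
Proof. by move=> bf bg; apply: bmeasD => //; exact: bmeasN. Qed.

Lemma bmeasX f n : bmeas f -> bmeas (fun x => f x ^+ n).
Proof.
move=> bf; elim: n => [|n IH].
  by rewrite (_ : (fun _ => _) = fun=> 1) //; exact: bmeas_cst.
rewrite (_ : (fun _ => _) = fun x => f x * f x ^+ n); first exact: bmeasM.
by apply/funext => x; rewrite exprS.
Qed.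

Lemma RintZ c f : bmeas f -> \int[mu]_x (c * f x) = c * \int[mu]_x f x.
Proof. by move=> bf; apply: RintegralZl => //; exact: bmeas_integrable. Qed.

Lemma RintD f g : bmeas f -> bmeas g ->
  \int[mu]_x (f x + g x) = \int[mu]_x f x + \int[mu]_x g x.
Proof. by move=> bf bg; apply: RintegralD => //; exact: bmeas_integrable. Qed.

Lemma RintB f g : bmeas f -> bmeas g ->
  \int[mu]_x (f x - g x) = \int[mu]_x f x - \int[mu]_x g x.
Proof. by move=> bf bg; apply: RintegralB => //; exact: bmeas_integrable. Qed.

Lemma Rint_cst c : \int[mu]_x c = c.
Proof.
have := Rintegral_cst mu (@measurableT _ T) c; rewrite /cst => ->.
have h : fine (mu setT) = 1 by rewrite probability_setT.
by rewrite h mulr1.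
Qed.

Lemma bmeas_sum (I : Type) (s : seq I) (P : pred I) (F : I -> T -> R) :
  (forall i, bmeas (F i)) -> bmeas (fun x => \sum_(i <- s | P i) F i x).
Proof.
move=> bF; elim: s => [|i s IH].
  by under eq_fun do rewrite big_nil; exact: bmeas_cst.
under eq_fun do rewrite big_cons.
by case: (P i) => //; exact: bmeasD.
Qed.

Lemma Rint_sum (I : Type) (s : seq I) (P : pred I) (F : I -> T -> R) :
  (forall i, bmeas (F i)) ->
  \int[mu]_x (\sum_(i <- s | P i) F i x) = \sum_(i <- s | P i) \int[mu]_x F i x.
Proof.
move=> bF; elim: s => [|i s IH].
  rewrite big_nil -[RHS](Rint_cst 0).
  by apply: eq_Rintegral => x _; rewrite big_nil.
rewrite big_cons -IH; case: ifPn => Pi.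
  rewrite -RintD//; last exact: bmeas_sum.
  by apply: eq_Rintegral => x _; rewrite big_cons Pi.
by apply: eq_Rintegral => x _; rewrite big_cons (negbTE Pi).
Qed.

Lemma le_Rint f g : bmeas f -> bmeas g -> (forall x, f x <= g x) ->
  \int[mu]_x f x <= \int[mu]_x g x.
Proof.
by move=> bf bg fg; apply: le_Rintegral => //; exact: bmeas_integrable.
Qed.

(** Dominated differentiation with a constant as dominating function, integrable because [mu] has
    mass 1. The radius 1 of the window around [a] is arbitrary. *)
Lemma is_derive_Rint (F F1 : R -> T -> R) (a C : R) :
  (forall t, bmeas (F t)) ->
  (forall t x, a - 1 < t < a + 1 -> is_derive t 1 (F ^~ x) (F1 t x)) ->
  (forall t x, a - 1 < t < a + 1 -> `|F1 t x| <= C) ->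
  is_derive a 1 (fun t => \int[mu]_x F t x) (\int[mu]_x F1 a x).
Proof.
move=> bF dF F1C.
have aI : [set` `]a - 1, a + 1[] a by rewrite /= in_itv/=; lra.
have C0 : 0 <= C.
  have := F1C a point; rewrite (_ : a - 1 < a < a + 1); last lra.
  by move=> /(_ isT); apply: le_trans.
have intF t : [set` `]a - 1, a + 1[] t -> mu.-integrable setT (EFin \o F t).
  by move=> _; exact: bmeas_integrable.
have derF t y : [set` `]a - 1, a + 1[] t -> [set: T] y -> derivable (F ^~ y) t 1.
  by rewrite /= in_itv/= => tI _; have [] := dF t y tI.
have intC : mu.-integrable setT (EFin \o (fun _ : T => C)).
  by apply: bmeas_integrable; exact: bmeas_cst.
have bound t y : [set` `]a - 1, a + 1[] t -> [set: T] y ->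
    `|partial1of2 F t y| <= C.
  rewrite /= in_itv/= => tI _; rewrite partial1of2E.
  by have [_ ->] := dF t y tI; exact: F1C.
split.
  exact: (derivable_under_integral measurableT aI intF derF (fun=> C0) intC bound).
rewrite -derive1E.
rewrite (differentiation_under_integral measurableT aI intF derF (fun=> C0) intC bound).
apply: eq_Rintegral => y _; rewrite partial1of2E.
have tI : a - 1 < a < a + 1 by lra.
by have [_ ->] := dF a y tI.
Qed.

End BoundedIntegrals.

(** * Derivative rules for pointwise expressions *)

Section PointwiseDerivatives.
Context {R : realType}.
Implicit Types (f g : R -> R) (x a b c : R).

Lemma is_deriveDx f g x a b : is_derive x 1 f a -> is_derive x 1 g b ->
  is_derive x 1 (fun t => f t + g t) (a + b).
Proof. exact: is_deriveD. Qed.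

Lemma is_deriveBx f g x a b : is_derive x 1 f a -> is_derive x 1 g b ->
  is_derive x 1 (fun t => f t - g t) (a - b).
Proof. exact: is_deriveB. Qed.

Lemma is_deriveMx f g x a b : is_derive x 1 f a -> is_derive x 1 g b ->
  is_derive x 1 (fun t => f t * g t) (a * g x + f x * b).
Proof.
move=> df dg; have /is_derive_eq := is_deriveM df dg; apply.
by rewrite /GRing.scale /=; ring.
Qed.

Lemma is_derive_idx x : is_derive x 1 (fun t : R => t) 1.
Proof. exact: is_derive_id. Qed.

Lemma is_deriveZx f c x a : is_derive x 1 f a ->
  is_derive x 1 (fun t => c * f t) (c * a).
Proof. exact: is_deriveZ. Qed.

Lemma is_deriveXx n x : is_derive x 1 (fun t => t ^+ n) (n%:R * x ^+ n.-1).
Proof.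
have /is_derive_eq := is_deriveX n (is_derive_idx x).
rewrite (_ : (fun t : R => t ^+ n) = (fun t : R => t) ^+ n); last first.
  by apply/funext => t; elim: n => [|n IH]; rewrite ?expr0 // !exprS IH.
by apply; rewrite /GRing.scale /= mulr1.
Qed.

Lemma is_derive_compx f g x a b : is_derive (g x) 1 f a -> is_derive x 1 g b ->
  is_derive x 1 (fun t => f (g t)) (a * b).
Proof. exact: is_derive1_comp. Qed.

Lemma is_derive_continuous f x a : is_derive x 1 f a -> {for x, continuous f}.
Proof. by move=> [d _]; exact/differentiable_continuous/derivable1_diffP. Qed.

End PointwiseDerivatives.

(** * Functions bounded on compact intervals of the half-line *)

Section Tame.
Context {R : realType}.

(* Only nonnegative arguments matter: [tame] functions are applied to squared
   norms, [tame1] functions (below) to coordinates of unit vectors. *)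
Definition tame (f : R -> R) := measurable_fun setT f /\
  forall N, exists C : R, forall x, 0 <= x <= N -> `|f x| <= C.

Lemma tameD f g : tame f -> tame g -> tame (fun x => f x + g x).
Proof.
move=> [mf Cf] [mg Cg]; split; first exact: measurable_funD.
move=> N; have [C fC] := Cf N; have [D gD] := Cg N.
by exists (C + D) => x xN; rewrite (le_trans (ler_normD _ _))// lerD ?fC ?gD.
Qed.

Lemma tameM f g : tame f -> tame g -> tame (fun x => f x * g x).
Proof.
move=> [mf Cf] [mg Cg]; split; first exact: measurable_funM.
move=> N; have [C fC] := Cf N; have [D gD] := Cg N.
by exists (C * D) => x xN; rewrite normrM ler_pM ?fC ?gD.
Qed.

Lemma tame_cst c : tame (fun=> c).
Proof. by split; [exact: measurable_cst|move=> N; exists `|c|]. Qed.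

Lemma tame_id : tame (fun x => x).
Proof.
split; first exact: measurable_id.
by move=> N; exists N => x /andP[x0 xN]; rewrite ger0_norm.
Qed.

End Tame.

(** * Spherical means of radial functions *)

Section Radial.
Context {R : realType} {dT : measure_display} {T : measurableType dT}
  (mu : probability T R) (U : T -> R).
Hypothesis mU : measurable_fun setT U.
Hypothesis U1 : forall x, -1 <= U x <= 1.

(* [|r theta + y|^2] when [|y| = |B|] and [theta] is a unit vector making an
   angle of cosine [u] with [y / B]. *)
Definition sqn (B r u : R) := B ^+ 2 + r ^+ 2 + 2 * (r * B) * u.

(** Completing the square gives [sqn B r u] = (r + B u)^2 + B^2 (1 - u^2). The second term is kept,
    beyond mere nonnegativity, because [hess_ge2] compares it with the whole. *)
Lemma sqn_ge (B r u : R) : -1 <= u <= 1 -> B ^+ 2 * (1 - u ^+ 2) <= sqn B r u.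
Proof.
move=> u1; have := sqr_ge0 (r + B * u); rewrite /sqn => h.
by rewrite -subr_ge0; apply: le_trans h _; lra.
Qed.

Lemma sqn_ge0 (B r u : R) : -1 <= u <= 1 -> 0 <= sqn B r u.
Proof.
move=> u1; apply: le_trans (sqn_ge B r u1).
by rewrite mulr_ge0 ?sqr_ge0//; nra.
Qed.

Lemma sqn_le (B r u c : R) : -1 <= u <= 1 -> `|r| <= c -> sqn B r u <= (`|B| + c) ^+ 2.
Proof.
move=> u1 rc.
have h : r * B * u <= `|r| * `|B|.
  by rewrite -normrM (le_trans (ler_norm _))// [leLHS]normrM ler_piMr// ler_norml.
have B2 := real_normK (num_real B); have r2 := real_normK (num_real r).
have := normr_ge0 B; have := normr_ge0 r => r0 B0.
rewrite /sqn -B2 -r2; nra.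
Qed.

Lemma bmeasU : bmeas U.
Proof.
by split => //; exists 1 => x; rewrite ler_norml.
Qed.

Lemma bmeas_sqn (f : R -> R) (B r : R) : tame f -> bmeas (fun x => f (sqn B r (U x))).
Proof.
move=> [mf bf]; split.
  apply: measurableT_comp => //; apply: measurable_funD; first exact: measurable_cst.
  by apply: measurable_funM => //; exact: measurable_cst.
have [C fC] := bf ((`|B| + `|r|) ^+ 2); exists C => x.
by apply: fC; rewrite sqn_ge0 ?sqn_le.
Qed.

Lemma is_derive_sqn (f f1 : R -> R) (B r u : R) : -1 <= u <= 1 ->
  (forall x : R, 0 <= x -> is_derive x 1 f (f1 x)) ->
  is_derive r 1 (fun r => f (sqn B r u)) (f1 (sqn B r u) * (2 * r + 2 * B * u)).
Proof.
move=> u1 df.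
have h : is_derive r 1 (fun t => sqn B t u) (2 * r + 2 * B * u); last first.
  have := is_derive_compx (f := f) (g := fun t => sqn B t u) (x := r)
    (df _ (sqn_ge0 B r u1)) h.
  exact.
rewrite /sqn; apply: is_derive_eq; rewrite /GRing.scale /=; ring.
Qed.

Section Chain.
Variables (B : R) (f f1 f2 : R -> R).
Hypothesis (tf : tame f) (tf1 : tame f1) (tf2 : tame f2).
Hypothesis df : forall x : R, 0 <= x -> is_derive x 1 f (f1 x).
Hypothesis df1 : forall x : R, 0 <= x -> is_derive x 1 f1 (f2 x).

Definition mean (g : R -> R) (r : R) := \int[mu]_x g (sqn B r (U x)).

Definition mean1 (r : R) := \int[mu]_x (f1 (sqn B r (U x)) * (2 * r + 2 * B * U x)).

Definition mean2 (r : R) := \int[mu]_x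
  (f2 (sqn B r (U x)) * (2 * r + 2 * B * U x) ^+ 2 + 2 * f1 (sqn B r (U x))).

Lemma bmeas_lin (r : R) : bmeas (fun x => 2 * r + 2 * B * U x).
Proof.
by apply: bmeasD; [exact: bmeas_cst|apply: bmeasZ; exact: bmeasU].
Qed.

Lemma lin_le (r t : R) (x : T) : r - 1 < t < r + 1 ->
  `|2 * t + 2 * B * U x| <= 2 * (`|r| + 1) + 2 * `|B|.
Proof.
move=> tr; have t1 : `|t| <= `|r| + 1.
  by have := ler_norm r; have := ler_norm (- r); rewrite normrN ler_norml; lra.
have uB : `|B * U x| <= `|B|.
  by rewrite [leLHS]normrM ler_piMr// ler_norml U1.
rewrite (le_trans (ler_normD _ _))//.
by rewrite lerD// -?mulrA normrM ger0_norm// ler_wpM2l.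
Qed.

Lemma tame_sqn_le (g : R -> R) (r : R) : tame g -> exists C : R, forall (t : R) x, r - 1 < t < r + 1 ->
  `|g (sqn B t (U x))| <= C.
Proof.
move=> [_ bg]; have [C gC] := bg ((`|B| + (`|r| + 1)) ^+ 2); exists C => t x tr.
apply: gC; rewrite sqn_ge0// sqn_le//.
by have := ler_norm r; have := ler_norm (- r); rewrite normrN ler_norml; lra.
Qed.

Lemma is_derive_mean (r : R) : is_derive r 1 (mean f) (mean1 r).
Proof.
have [C f1C] := tame_sqn_le r tf1.
apply: (@is_derive_Rint _ _ _ _ _
  (fun r x => f1 (sqn B r (U x)) * (2 * r + 2 * B * U x)) _
  (C * (2 * (`|r| + 1) + 2 * `|B|))).
- by move=> t; exact: bmeas_sqn.
- by move=> t x tr; exact: is_derive_sqn.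
- by move=> t x tr; rewrite normrM ler_pM// ?f1C ?lin_le.
Qed.

Lemma is_derive_mean1 (r : R) : is_derive r 1 mean1 (mean2 r).
Proof.
have [C f1C] := tame_sqn_le r tf1; have [D f2D] := tame_sqn_le r tf2.
apply: (@is_derive_Rint _ _ _ _ _
  (fun r x => f2 (sqn B r (U x)) * (2 * r + 2 * B * U x) ^+ 2 +
     2 * f1 (sqn B r (U x))) _
  (D * (2 * (`|r| + 1) + 2 * `|B|) ^+ 2 + 2 * C)).
- by move=> t; apply: bmeasM; [exact: bmeas_sqn|exact: bmeas_lin].
- move=> t x tr; have h1 := @is_derive_sqn f1 f2 B t (U x) (U1 x) df1.
  have h2 : is_derive t 1 (fun t => 2 * t + 2 * B * U x) 2.
    by apply: is_derive_eq; rewrite /GRing.scale /=; ring.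
  by apply: is_derive_eq (is_deriveMx h1 h2) _; ring.
- move=> t x tr; rewrite (le_trans (ler_normD _ _))// lerD//.
    by rewrite normrM ler_pM ?f2D// normrX lerXn2r ?nnegrE ?lin_le// addr_ge0// mulr_ge0// addr_ge0.
  by rewrite normrM ger0_norm// ler_wpM2l// f1C.
Qed.

End Chain.
End Radial.

(** * Integration by parts and the Laplacian of spherical means *)

Section ByParts.
Context {R : realType} {dT : measure_display} {T : measurableType dT}
  (mu : probability T R) (U : T -> R) (d : nat).
Hypothesis mU : measurable_fun setT U.
Hypothesis U1 : forall x, -1 <= U x <= 1.
Hypothesis d2 : (2 <= d)%N.

Definition tame1 (g : R -> R) := measurable_fun setT g /\
  exists C : R, forall u, -1 <= u <= 1 -> `|g u| <= C.

Hypothesis byparts : forall g g1 : R -> R, tame1 g -> tame1 g1 ->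
  (forall u : R, -1 <= u <= 1 -> is_derive u 1 g (g1 u)) ->
  (d%:R - 1) * \int[mu]_x (U x * g (U x)) =
  \int[mu]_x ((1 - U x ^+ 2) * g1 (U x)).

Lemma tame1M f g : tame1 f -> tame1 g -> tame1 (fun x => f x * g x).
Proof.
move=> [mf [C fC]] [mg [D gD]]; split; first exact: measurable_funM.
by exists (C * D) => x x1; rewrite normrM ler_pM ?fC ?gD.
Qed.

Lemma tame1D f g : tame1 f -> tame1 g -> tame1 (fun x => f x + g x).
Proof.
move=> [mf [C fC]] [mg [D gD]]; split; first exact: measurable_funD.
by exists (C + D) => x x1; rewrite (le_trans (ler_normD _ _))// lerD ?fC ?gD.
Qed.

Lemma tame1_cst (c : R) : tame1 (fun=> c).
Proof. by split; [exact: measurable_cst|exists `|c|]. Qed.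

Lemma tame1_id : tame1 (fun x => x).
Proof. by split; [exact: measurable_id|exists 1 => u; rewrite ler_norml]. Qed.

Lemma tame1_sqn f (B r : R) : tame f -> tame1 (fun u => f (sqn B r u)).
Proof.
move=> [mf bf]; split.
  apply: measurableT_comp => //; apply: measurable_funD; first exact: measurable_cst.
  by apply: measurable_funM; [exact: measurable_cst|exact: measurable_id].
have [C fC] := bf ((`|B| + `|r|) ^+ 2); exists C => x x1.
by apply: fC; rewrite sqn_ge0 ?sqn_le.
Qed.

Lemma is_derive_sqn_u (f f1 : R -> R) (B r u : R) : -1 <= u <= 1 ->
  (forall x : R, 0 <= x -> is_derive x 1 f (f1 x)) ->
  is_derive u 1 (fun u => f (sqn B r u)) (f1 (sqn B r u) * (2 * (r * B))).
Proof.
move=> u1 df.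
have h : is_derive u 1 (fun t => sqn B r t) (2 * (r * B)).
  by rewrite /sqn; apply: is_derive_eq; rewrite /GRing.scale /=; ring.
exact: (is_derive_compx (f := f) (g := fun t => sqn B r t) (x := u)
    (df _ (sqn_ge0 B r u1)) h).
Qed.

Lemma Rint_quad g (a b c : R) : bmeas g ->
  \int[mu]_x (g x * (a + b * U x + c * U x ^+ 2)) =
  a * \int[mu]_x g x + b * \int[mu]_x (U x * g x)
  + c * \int[mu]_x (U x ^+ 2 * g x).
Proof.
move=> bg; have bU := bmeasU mU U1.
have b1 : bmeas (fun x => U x * g x) by exact: bmeasM.
have b2 : bmeas (fun x => U x ^+ 2 * g x) by apply: bmeasM => //; exact: bmeasX.
rewrite -!RintZ// -RintD; [|exact: bmeasZ|exact: bmeasZ].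
rewrite -RintD; [|by apply: bmeasD; exact: bmeasZ|exact: bmeasZ].
by apply: eq_Rintegral => x _; ring.
Qed.

Variables (B : R) (f f1 f2 f3 f4 : R -> R).
Hypothesis (tf : tame f) (tf1 : tame f1) (tf2 : tame f2) (tf3 : tame f3)
  (tf4 : tame f4).
Hypothesis df : forall x : R, 0 <= x -> is_derive x 1 f (f1 x).
Hypothesis df1 : forall x : R, 0 <= x -> is_derive x 1 f1 (f2 x).
Hypothesis df2 : forall x : R, 0 <= x -> is_derive x 1 f2 (f3 x).
Hypothesis df3 : forall x : R, 0 <= x -> is_derive x 1 f3 (f4 x).

Let X r x := sqn B r (U x).
Let J (g : R -> R) n r := \int[mu]_x (U x ^+ n * g (X r x)).

Let bX g r : tame g -> bmeas (fun x => g (X r x)).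
Proof. exact: bmeas_sqn. Qed.

Let bJ g n r : tame g -> bmeas (fun x => U x ^+ n * g (X r x)).
Proof.
move=> tg; apply: bmeasM; last exact: bX.
by apply: bmeasX; exact: bmeasU.
Qed.

Let J0 g r : \int[mu]_x g (X r x) = J g 0 r.
Proof. by apply: eq_Rintegral => x _; rewrite expr0 mul1r. Qed.

Let J1 g r : \int[mu]_x (U x * g (X r x)) = J g 1 r.
Proof. by apply: eq_Rintegral => x _; rewrite expr1. Qed.

Let mean1E r : mean1 mu U B f1 r = 2 * r * J f1 0 r + 2 * B * J f1 1 r.
Proof.
rewrite -J0 -J1 -[RHS]addr0 -[X in _ = _ + X](mul0r (J f1 2 r)).
rewrite -(Rint_quad (g := fun x => f1 (X r x))).
  by apply: eq_Rintegral => x _; rewrite /X; ring.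
exact: bX.
Qed.

Let mean2E r : mean2 mu U B f1 f2 r = 4 * r ^+ 2 * J f2 0 r
  + 8 * r * B * J f2 1 r + 4 * B ^+ 2 * J f2 2 r + 2 * J f1 0 r.
Proof.
rewrite -!J0 -J1 -(Rint_quad (g := fun x => f2 (X r x))); last exact: bX.
rewrite -RintZ; last exact: bX.
rewrite -RintD; last 2 first.
- apply: bmeasM; first exact: bX.
  apply: bmeasD; last by apply: bmeasZ; apply: bmeasX; exact: bmeasU.
  by apply: bmeasD; [exact: bmeas_cst|apply: bmeasZ; exact: bmeasU].
- by apply: bmeasZ; exact: bX.
by apply: eq_Rintegral => x _; rewrite /X; ring.
Qed.

(** [parts1] to [parts4] apply [byparts] to f1(X), f2(X), U f2(X) and (1 - U^2) f3(X). The weight in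
    the last one makes f4 appear with the nonnegative factor (1 - U^2)^2. *)
Let parts1 r : (d%:R - 1) * J f1 1 r = 2 * (r * B) * (J f2 0 r - J f2 2 r).
Proof.
have t : tame1 (fun u => f2 (sqn B r u) * (2 * (r * B))).
  by apply: tame1M; [exact: tame1_sqn|exact: tame1_cst].
have h := byparts (tame1_sqn B r tf1) t (fun u u1 => is_derive_sqn_u B r u1 df1).
rewrite -J1 h -RintB; [|exact: bJ..]; rewrite -RintZ; last by apply: bmeasB; exact: bJ.
by apply: eq_Rintegral => x _; rewrite /X; ring.
Qed.

(** Darboux's equation for spherical means: the radial Laplacian M'' + (d - 1) M' / r of the mean is
    the mean of the Laplacian 4 (x f'' + d f' / 2). Multiplied by r, it makes sense at r = 0 as
    well. *)
Lemma mean_laplace r : r * mean2 mu U B f1 f2 r + (d%:R - 1) * mean1 mu U B f1 r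
  = 4 * r * \int[mu]_x (X r x * f2 (X r x) + d%:R / 2 * f1 (X r x)).
Proof.
have -> : \int[mu]_x (X r x * f2 (X r x) + d%:R / 2 * f1 (X r x)) =
    (B ^+ 2 + r ^+ 2) * J f2 0 r + 2 * (r * B) * J f2 1 r + d%:R / 2 * J f1 0 r.
  rewrite RintD; last 2 first.
  - by apply: bmeasM; [exact: (bmeas_sqn mU U1 B r tame_id)|exact: bX].
  - by apply: bmeasZ; exact: bX.
  rewrite RintZ; last exact: bX.
  rewrite -!J0 -J1; congr (_ + _).
  rewrite -[RHS]addr0 -[X in _ = _ + X](mul0r (J f2 2 r)).
  rewrite -(Rint_quad (g := fun x => f2 (X r x))); last exact: bX.
  by apply: eq_Rintegral => x _; rewrite /X /sqn; ring.
rewrite mean2E mean1E.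
have -> : (d%:R - 1) * (2 * r * J f1 0 r + 2 * B * J f1 1 r) =
  2 * r * (d%:R - 1) * J f1 0 r + 2 * B * ((d%:R - 1) * J f1 1 r) by ring.
by rewrite parts1; field.
Qed.

Let parts2 r : (d%:R - 1) * J f2 1 r = 2 * (r * B) * (J f3 0 r - J f3 2 r).
Proof.
have t : tame1 (fun u => f3 (sqn B r u) * (2 * (r * B))).
  by apply: tame1M; [exact: tame1_sqn|exact: tame1_cst].
have h := byparts (tame1_sqn B r tf2) t (fun u u1 => is_derive_sqn_u B r u1 df2).
rewrite -J1 h -RintB; [|exact: bJ..]; rewrite -RintZ; last by apply: bmeasB; exact: bJ.
by apply: eq_Rintegral => x _; rewrite /X; ring.
Qed.

Let parts3 r : d%:R * J f2 2 r - J f2 0 r = 2 * (r * B) * (J f3 1 r - J f3 3 r).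
Proof.
have tg : tame1 (fun u => u * f2 (sqn B r u)).
  by apply: tame1M; [exact: tame1_id|exact: tame1_sqn].
have := byparts tg (g1 := fun u => f2 (sqn B r u) + u * (f3 (sqn B r u) * (2 * (r * B)))).
have -> : \int[mu]_x (U x * (U x * f2 (sqn B r (U x)))) = J f2 2 r.
  by apply: eq_Rintegral => x _; rewrite /X; ring.
have -> : \int[mu]_x ((1 - U x ^+ 2) *
    (f2 (sqn B r (U x)) + U x * (f3 (sqn B r (U x)) * (2 * (r * B))))) =
    J f2 0 r - J f2 2 r + 2 * (r * B) * (J f3 1 r - J f3 3 r).
  rewrite -!RintB; [|exact: bJ..].
  rewrite -RintZ; last by apply: bmeasB; exact: bJ.
  rewrite -RintD; last 2 first.
  - by apply: bmeasB; exact: bJ.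
  - by apply: bmeasZ; apply: bmeasB; exact: bJ.
  by apply: eq_Rintegral => x _; rewrite /X; ring.
move=> h; suff: (d%:R - 1) * J f2 2 r = J f2 0 r - J f2 2 r + 2 * (r * B) * (J f3 1 r - J f3 3 r) by lra.
apply: h.
- apply: tame1D; first exact: tame1_sqn.
  apply: tame1M; first exact: tame1_id.
  by apply: tame1M; [exact: tame1_sqn|exact: tame1_cst].
- move=> u u1; have := is_deriveMx (is_derive_idx u) (is_derive_sqn_u B r u1 df2).
  by rewrite mul1r.
Qed.

Let parts4 r : (d%:R + 1) * (J f3 1 r - J f3 3 r) =
  2 * (r * B) * \int[mu]_x ((1 - U x ^+ 2) ^+ 2 * f4 (X r x)).
Proof.
have tu : tame1 (fun u : R => 1 - u ^+ 2).
  rewrite (_ : (fun _ => _) = fun u => 1 + (-1) * (u * u)); last first.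
    by apply/funext => u; ring.
  apply: tame1D; first exact: tame1_cst.
  by apply: tame1M; [exact: tame1_cst|apply: tame1M; exact: tame1_id].
have tg : tame1 (fun u => (1 - u ^+ 2) * f3 (sqn B r u)).
  by apply: tame1M; [exact: tu|exact: tame1_sqn].
have := byparts tg (g1 := fun u => (- 2 * u) * f3 (sqn B r u) +
  (1 - u ^+ 2) * (f4 (sqn B r u) * (2 * (r * B)))).
have -> : \int[mu]_x (U x * ((1 - U x ^+ 2) * f3 (sqn B r (U x)))) = J f3 1 r - J f3 3 r.
  rewrite -RintB; [|exact: bJ..].
  by apply: eq_Rintegral => x _; rewrite /X; ring.
have bu : bmeas (fun x => 1 - U x ^+ 2).
  by apply: bmeasB; [exact: bmeas_cst|apply: bmeasX; exact: bmeasU].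
have -> : \int[mu]_x ((1 - U x ^+ 2) *
    (- 2 * U x * f3 (sqn B r (U x)) + (1 - U x ^+ 2) * (f4 (sqn B r (U x)) * (2 * (r * B))))) =
    - 2 * (J f3 1 r - J f3 3 r) +
    2 * (r * B) * \int[mu]_x ((1 - U x ^+ 2) ^+ 2 * f4 (X r x)).
  have b4 : bmeas (fun x => (1 - U x ^+ 2) ^+ 2 * f4 (X r x)).
    by apply: bmeasM; [exact: bmeasX|exact: bX].
  rewrite -!RintB; [|exact: bJ..].
  rewrite -(RintZ mu (- 2)); last by apply: bmeasB; exact: bJ.
  rewrite -(RintZ mu (2 * (r * B)))//.
  rewrite -RintD; last 2 first.
  - by apply: bmeasZ; apply: bmeasB; exact: bJ.
  - exact: bmeasZ.
  by apply: eq_Rintegral => x _; rewrite /X; ring.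
move=> h; suff: (d%:R - 1) * (J f3 1 r - J f3 3 r) = - 2 * (J f3 1 r - J f3 3 r) +
    2 * (r * B) * \int[mu]_x ((1 - U x ^+ 2) ^+ 2 * f4 (X r x)) by lra.
apply: h.
- apply: tame1D.
    apply: tame1M; last exact: tame1_sqn.
    by apply: tame1M; [exact: tame1_cst|exact: tame1_id].
  apply: tame1M; first exact: tu.
  by apply: tame1M; [exact: tame1_sqn|exact: tame1_cst].
- move=> u u1; have h1 : is_derive u 1 (fun u : R => 1 - u ^+ 2) (- 2 * u).
    by apply: is_derive_eq; rewrite /GRing.scale /=; ring.
  exact: (is_deriveMx h1 (is_derive_sqn_u B r u1 df3)).
Qed.

(** For h(x) = M(sqrt x) one has h''(r^2) = (r M'' - M') / (4 r^3), so the conclusion reads h'' >= E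
    f''. The four integrations by parts turn (d - 1) times the difference of the two sides into 16
    r^3 B^2 E (1 - U^2) (f3 + B^2 (1 - U^2) f4 / (d + 1)), and the hypothesis makes this integrand
    nonnegative. *)
Lemma mean_hess r : 0 < r ->
  (forall u, -1 <= u <= 1 ->
     0 <= f3 (sqn B r u) + B ^+ 2 * (1 - u ^+ 2) * f4 (sqn B r u) / (d%:R + 1)) ->
  4 * r ^+ 3 * \int[mu]_x f2 (X r x) <= r * mean2 mu U B f1 f2 r - mean1 mu U B f1 r.
Proof.
move=> r0 H; have dR : (2 : R) <= d%:R by rewrite (ler_nat _ 2 d).
set L := \int[mu]_x ((1 - U x ^+ 2) ^+ 2 * f4 (X r x)).
have bu : bmeas (fun x => 1 - U x ^+ 2).
  by apply: bmeasB; [exact: bmeas_cst|apply: bmeasX; exact: bmeasU].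
have b4 : bmeas (fun x => (1 - U x ^+ 2) ^+ 2 * f4 (X r x)).
  by apply: bmeasM; [exact: bmeasX|exact: bX].
have P : 0 <= J f3 0 r - J f3 2 r + B ^+ 2 / (d%:R + 1) * L.
  rewrite -RintB; [|exact: bJ..]; rewrite -RintZ// -RintD//; last 2 first.
  - by apply: bmeasB; exact: bJ.
  - exact: bmeasZ.
  apply: Rintegral_ge0 => x _.
  have := H _ (U1 x) => h.
  have u1 : 0 <= 1 - U x ^+ 2 by have := U1 x; nra.
  have := mulr_ge0 u1 h; congr (_ <= _).
  by rewrite /X; field; lra.
have p1 := parts1 r; have p2 := parts2 r; have p3 := parts3 r; have p4 := parts4 r.
have K : J f3 1 r - J f3 3 r = 2 * (r * B) * L / (d%:R + 1).
  by rewrite -p4 mulrAC mulfV ?mul1r//; lra.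
rewrite J0 -(@ler_pM2l _ (d%:R - 1)); last lra.
rewrite mean2E mean1E -subr_ge0.
have : 0 <= 16 * r ^+ 3 * B ^+ 2 * (J f3 0 r - J f3 2 r + B ^+ 2 / (d%:R + 1) * L).
  apply: mulr_ge0 => //; apply: mulr_ge0; last exact: sqr_ge0.
  by rewrite mulr_ge0// exprn_ge0// ltW.
congr (_ <= _).
transitivity (8 * r ^+ 2 * B * (2 * (r * B) * (J f3 0 r - J f3 2 r)) +
  4 * r * B ^+ 2 * (2 * (r * B) * (J f3 1 r - J f3 3 r))).
  by rewrite K; field; lra.
rewrite -p2 -p3.
transitivity ((d%:R - 1) *
 (r * (4 * r ^+ 2 * J f2 0 r + 8 * r * B * J f2 1 r + 4 * B ^+ 2 * J f2 2 r +
   2 * J f1 0 r) - 2 * r * J f1 0 r) - 2 * B * ((d%:R - 1) * J f1 1 r) -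
  (d%:R - 1) * (4 * r ^+ 3 * J f2 0 r)); last by ring.
by rewrite p1; ring.
Qed.

End ByParts.

Section Monotone.
Context {R : realType}.
Implicit Types (f g : R -> R).

Lemma ndecr_of_derive f df (a b : R) : a <= b ->
  {within `[a, b], continuous f} ->
  (forall x : R, a < x < b -> is_derive x 1 f (df x)) ->
  (forall x : R, a < x < b -> 0 <= df x) -> f a <= f b.
Proof.
move=> ab cf hf df0; have [eab|ltab] := eqVneq a b; first by rewrite eab.
have {}ltab : a < b by rewrite lt_neqAle ltab.
have hh (x : R) : x \in `]a, b[%R -> is_derive x 1 f (df x).
  by rewrite in_itv/= => xy; exact: hf.
have [c] := MVT ltab hh cf; rewrite in_itv/= => cy e.
by rewrite -subr_ge0 e mulr_ge0 ?df0// subr_ge0 ltW.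
Qed.

Lemma ler_of_derive0 f g df dg (y : R) : 0 < y ->
  (forall x : R, is_derive x 1 f (df x)) -> (forall x : R, is_derive x 1 g (dg x)) ->
  (forall x : R, 0 < x < y -> df x <= dg x) -> f 0 <= g 0 -> f y <= g y.
Proof.
move=> y0 hf hg fg fg0.
have hh (x : R) : is_derive x 1 (fun x => g x - f x) (dg x - df x) by exact: is_deriveBx.
have : g 0 - f 0 <= g y - f y.
  apply: (ndecr_of_derive (ltW y0)) => //.
    apply: continuous_subspaceT => x; exact: is_derive_continuous (hh x).
  by move=> x xy; rewrite subr_ge0 fg.
by lra.
Qed.

End Monotone.

(** * Lower bound from the bilaplacian *)

Section Bilaplace.
Context {R : realType} {dT : measure_display} {T : measurableType dT}
  (mu : probability T R) (U : T -> R) (d : nat).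
Hypothesis mU : measurable_fun setT U.
Hypothesis U1 : forall x, -1 <= U x <= 1.
Hypothesis d2 : (2 <= d)%N.
Hypothesis byparts : forall g g1 : R -> R, tame1 g -> tame1 g1 ->
  (forall u : R, -1 <= u <= 1 -> is_derive u 1 g (g1 u)) ->
  (d%:R - 1) * \int[mu]_x (U x * g (U x)) =
  \int[mu]_x ((1 - U x ^+ 2) * g1 (U x)).

Variables (B : R) (f f1 f2 f3 f4 : R -> R).
Hypothesis (tf : tame f) (tf1 : tame f1) (tf2 : tame f2) (tf3 : tame f3)
  (tf4 : tame f4).
Hypothesis df : forall x : R, 0 <= x -> is_derive x 1 f (f1 x).
Hypothesis df1 : forall x : R, 0 <= x -> is_derive x 1 f1 (f2 x).
Hypothesis df2 : forall x : R, 0 <= x -> is_derive x 1 f2 (f3 x).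
Hypothesis df3 : forall x : R, 0 <= x -> is_derive x 1 f3 (f4 x).

(* A radial function [f (|v|^2)] on R^d has Laplacian [4 lap f' f'' (|v|^2)]. *)
Definition lap (g1 g2 : R -> R) (x : R) := x * g2 x + d%:R / 2 * g1 x.

(** [c1] and [c2] are the first two derivatives of [lap f1 f2], so that [lap c1 c2] is one sixteenth
    of the bilaplacian. *)
Let c1 (x : R) := x * f3 x + (1 + d%:R / 2) * f2 x.
Let c2 (x : R) := x * f4 x + (2 + d%:R / 2) * f3 x.

Let tc : tame (lap f1 f2).
Proof.
by apply: tameD; apply: tameM => //; [exact: tame_id|exact: tame_cst].
Qed.

Let tc1 : tame c1.
Proof.
by apply: tameD; apply: tameM => //; [exact: tame_id|exact: tame_cst].
Qed.

Let tc2 : tame c2.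
Proof.
by apply: tameD; apply: tameM => //; [exact: tame_id|exact: tame_cst].
Qed.

Let dc (x : R) : 0 <= x -> is_derive x 1 (lap f1 f2) (c1 x).
Proof.
move=> x0; have h1 := is_deriveMx (is_derive_idx x) (df2 x0).
have h2 := is_deriveZx (d%:R / 2) (df1 x0).
by apply: is_derive_eq (is_deriveDx h1 h2) _; rewrite /c1; ring.
Qed.

Let dc1 (x : R) : 0 <= x -> is_derive x 1 c1 (c2 x).
Proof.
move=> x0; have h1 := is_deriveMx (is_derive_idx x) (df3 x0).
have h2 := is_deriveZx (1 + d%:R / 2) (df2 x0).
by apply: is_derive_eq (is_deriveDx h1 h2) _; rewrite /c2; ring.
Qed.

(* The Laplace operator in radial coordinates is [r^(1-d) (r^(d-1) M')']; this
   is integrated once for [lap f] and once more for [f]. *)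
Lemma mean_bilaplace (l0 l1 r : R) : 0 < r -> 0 <= l1 ->
  (forall r : R, 0 < r ->
    l0 - l1 * r ^+ 2 <= \int[mu]_x (lap c1 c2 (sqn B r (U x)))) ->
  16 / (d%:R * (d%:R + 2)) * r ^+ 3 * (l0 - l1 * r ^+ 2) <=
  r * mean2 mu U B f1 f2 r - mean1 mu U B f1 r.
Proof.
move=> r0 l10 H; have dR : (2 : R) <= d%:R by rewrite (ler_nat _ 2 d).
(* The weight r^(d-1) becomes r^n.+1, whose derivative n.+1 r^n involves no truncated
   subtraction. *)
pose n := d.-2; have dn : d = n.+2 by rewrite /n; case: (d) d2 => [|[]].
have dnR : d%:R = n%:R + 2 :> R by rewrite dn -addn2 natrD.
have lapf x : x * mean2 mu U B f1 f2 x + (d%:R - 1) * mean1 mu U B f1 x =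
    4 * x * mean mu U B (lap f1 f2) x.
  by rewrite (mean_laplace mU U1 byparts B tf1 tf2 df1).
have lapc x : 0 < x -> 4 * x * (l0 - l1 * x ^+ 2) <=
    x * mean2 mu U B c1 c2 x + (d%:R - 1) * mean1 mu U B c1 x.
  move=> x0; rewrite (mean_laplace mU U1 byparts B tc1 tc2 dc1).
  by rewrite ler_pM2l ?mulr_gt0// H.
have dM x := is_derive_mean1 mu mU U1 B tf1 tf2 df1 x.
have dN x := is_derive_mean mu mU U1 B tc tc1 dc x.
have dN1 x := is_derive_mean1 mu mU U1 B tc1 tc2 dc1 x.
(* With N the mean of [lap f1 f2], the derivative of y^(d-1) N' is at least 4 y^(d-1) (l0 - l1 y^2).
   Exact integration yields l0/d and l1/(d + 2); weakening the latter to l1/d, by l1 >= 0, restores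
   the factor l0 - l1 y^2. *)
have N1ge y : 0 < y -> 4 / d%:R * y * (l0 - l1 * y ^+ 2) <= mean1 mu U B c1 y.
  move=> y0.
  have : 4 / d%:R * (l0 * y ^+ n.+2 - l1 * y ^+ n.+4) <= y ^+ n.+1 * mean1 mu U B c1 y.
    apply: (@ler_of_derive0 _ (fun y => 4 / d%:R * (l0 * y ^+ n.+2 - l1 * y ^+ n.+4))
      (fun y => y ^+ n.+1 * mean1 mu U B c1 y)
      (fun y => 4 / d%:R * (l0 * (n.+2%:R * y ^+ n.+1) - l1 * (n.+4%:R * y ^+ n.+3)))
      (fun y => n.+1%:R * y ^+ n * mean1 mu U B c1 y + y ^+ n.+1 * mean2 mu U B c1 c2 y)
      _ y0).
    - move=> x; exact: (is_deriveZx _ (is_deriveBx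
        (is_deriveZx _ (is_deriveXx _ x)) (is_deriveZx _ (is_deriveXx _ x)))).
    - by move=> x; exact: (is_deriveMx (is_deriveXx _ x) (dN1 x)).
    - move=> x /andP[x0 _].
      apply: (@le_trans _ _ (x ^+ n * (4 * x * (l0 - l1 * x ^+ 2)))); last first.
        have -> : n.+1%:R * x ^+ n * mean1 mu U B c1 x + x ^+ n.+1 * mean2 mu U B c1 c2 x =
           x ^+ n * (x * mean2 mu U B c1 c2 x + (d%:R - 1) * mean1 mu U B c1 x).
          by rewrite dn exprS -![in RHS]natr1 -natr1; ring.
        by rewrite ler_pM2l ?exprn_gt0// lapc.
      rewrite -subr_ge0.
      have : 0 <= 8 / d%:R * l1 * x ^+ n.+3.
        by rewrite mulr_ge0 ?exprn_ge0 ?(ltW x0)// mulr_ge0// divr_ge0//; lra.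
      congr (_ <= _); rewrite !exprS -[n.+4]addn4 natrD dnR -[n.+2]addn2 natrD; field.
      by rewrite -dnR; lra.
    - by rewrite !expr0n/= !mulr0 subrr mulr0 mul0r.
  rewrite -(@ler_pM2l _ (y ^+ n.+1)) ?exprn_gt0//; apply: le_trans.
  by rewrite !exprS; lra.
(* By Darboux's equation the right side is r^(d-1) (r M'' - M'), and its derivative collapses to 4
   r^d N'. Hence [N1ge] can be integrated directly, with l1/(d + 4) again weakened, to l1/(d +
   2). *)
have key : 16 / (d%:R * (d%:R + 2)) * (l0 * r ^+ n.+4 - l1 * r ^+ n.+4.+2) <=
    4 * r ^+ n.+2 * mean mu U B (lap f1 f2) r - d%:R * r ^+ n.+1 * mean1 mu U B f1 r.
  apply: (@ler_of_derive0 _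
    (fun r => 16 / (d%:R * (d%:R + 2)) * (l0 * r ^+ n.+4 - l1 * r ^+ n.+4.+2))
    (fun r => 4 * r ^+ n.+2 * mean mu U B (lap f1 f2) r -
       d%:R * r ^+ n.+1 * mean1 mu U B f1 r)
    (fun r => 16 / (d%:R * (d%:R + 2)) * (l0 * (n.+4%:R * r ^+ n.+3) -
       l1 * (n.+4.+2%:R * r ^+ n.+4.+1)))
    (fun r => (4 * (n.+2%:R * r ^+ n.+1) * mean mu U B (lap f1 f2) r +
        4 * r ^+ n.+2 * mean1 mu U B c1 r) -
       (d%:R * (n.+1%:R * r ^+ n) * mean1 mu U B f1 r +
         d%:R * r ^+ n.+1 * mean2 mu U B f1 f2 r)) _ r0).
  - move=> x; exact: (is_deriveZx _ (is_deriveBx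
      (is_deriveZx _ (is_deriveXx _ x)) (is_deriveZx _ (is_deriveXx _ x)))).
  - move=> x; exact: (is_deriveBx
      (is_deriveMx (is_deriveZx _ (is_deriveXx _ x)) (dN x))
      (is_deriveMx (is_deriveZx _ (is_deriveXx _ x)) (dM x))).
  - move=> x /andP[x0 _].
    apply: (@le_trans _ _ (4 * x ^+ n.+2 * (4 / d%:R * x * (l0 - l1 * x ^+ 2)))); last first.
      apply: (@le_trans _ _ (4 * x ^+ n.+2 * mean1 mu U B c1 x)).
        apply: ler_wpM2l; last exact: N1ge.
        by rewrite mulr_ge0// exprn_ge0// ltW.
      have e := lapf x.
      have -> : d%:R * (n.+1%:R * x ^+ n) * mean1 mu U B f1 x +
         d%:R * x ^+ n.+1 * mean2 mu U B f1 f2 x =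
         d%:R * x ^+ n * (x * mean2 mu U B f1 f2 x + (d%:R - 1) * mean1 mu U B f1 x).
        by rewrite exprS -natr1 dnR; ring.
      rewrite e exprS [x ^+ n.+1]exprS -[n.+2%:R](_ : d%:R = _) ?dn//.
      by lra.
    rewrite -subr_ge0.
    have : 0 <= 32 / (d%:R * (d%:R + 2)) * l1 * x ^+ n.+4.+1.
      rewrite mulr_ge0 ?exprn_ge0 ?(ltW x0)// mulr_ge0// divr_ge0// mulr_ge0//; lra.
    congr (_ <= _); rewrite !exprS -[n.+4.+2]addn4 -[n.+4]addn4 !natrD dnR -[n.+2]addn2 natrD; field.
    by rewrite -!dnR; apply/andP; split; rewrite ?natrD; lra.
  - by rewrite !expr0n/= !mulr0 subrr !(mulr0, mul0r) subrr.
rewrite -(@ler_pM2l _ (r ^+ n.+1)) ?exprn_gt0//.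
have e := lapf r.
apply: le_trans (le_trans key _).
  by rewrite !exprS; lra.
have -> : r * mean2 mu U B f1 f2 r - mean1 mu U B f1 r =
   4 * r * mean mu U B (lap f1 f2) r - d%:R * mean1 mu U B f1 r by rewrite -e; ring.
by rewrite exprS; lra.
Qed.

End Bilaplace.

Lemma continuous_tame (R : realType) (g : R -> R) : continuous g -> tame g.
Proof.
move=> cg; split; first exact: continuous_measurable_fun.
move=> N; have [N0|N0] := leP 0 N; last first.
  by exists 0 => x /andP[x0 xN]; move: (le_trans x0 xN); rewrite leNgt N0.
have c : {within `[0, N], continuous (fun x => `|g x|)}.
  by apply: continuous_subspaceT => x; apply: continuous_comp; [exact: cg|exact: norm_continuous].
have [z _ zmax] := EVT_max N0 c.
by exists `|g z| => x xN; apply: zmax; rewrite in_itv.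
Qed.

(** * Lower bounds for the gain of a swap *)

Section Swap.
Context {R : realType} {dT : measure_display} {T : measurableType dT}
  (mu : probability T R) (U : T -> R).
Hypothesis mU : measurable_fun setT U.
Hypothesis U1 : forall x, -1 <= U x <= 1.
Hypothesis symU : forall g : R -> R, tame1 g ->
  \int[mu]_x g (U x) = \int[mu]_x g (- U x).
Variables (B : R) (f f1 f2 q q1 q2 : R -> R).
Hypothesis (tf : tame f) (tf1 : tame f1) (tf2 : tame f2).
Hypothesis df : forall x : R, 0 <= x -> is_derive x 1 f (f1 x).
Hypothesis df1 : forall x : R, 0 <= x -> is_derive x 1 f1 (f2 x).
Hypothesis dq : forall x : R, is_derive x 1 q (q1 x).
Hypothesis dq1 : forall x : R, is_derive x 1 q1 (q2 x).
Hypothesis hess : forall r : R, 0 < r ->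
  4 * r ^+ 3 * q2 (r ^+ 2) <= r * mean2 mu U B f1 f2 r - mean1 mu U B f1 r.

Let g x := mean mu U B f (Num.sqrt x) - q x.
Let g1 x := mean1 mu U B f1 (Num.sqrt x) * (2 * Num.sqrt x)^-1 - q1 x.

Let dg (x : R) : 0 < x -> is_derive x 1 g (g1 x).
Proof.
move=> x0; have h := is_derive_compx (f := mean mu U B f) (g := Num.sqrt)
  (is_derive_mean mu mU U1 B tf tf1 df _) (is_derive1_sqrt x0).
exact: (is_deriveBx h (dq x)).
Qed.

(** This is convexity of g: since the second derivative of M(sqrt x) is (r M'' - M') / (4 r^3) at r
    = sqrt x, [hess] says g'' >= 0. *)
Let g1_ndecr x y : 0 < x -> x <= y -> g1 x <= g1 y.
Proof.
move=> x0 xy.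
pose g2 z := (mean2 mu U B f1 f2 (Num.sqrt z) * (2 * Num.sqrt z)^-1) *
   (2 * Num.sqrt z)^-1 + mean1 mu U B f1 (Num.sqrt z) *
   (- (2 * Num.sqrt z) ^- 2 * (2 * (2 * Num.sqrt z)^-1)) - q2 z.
have dg1 (z : R) : 0 < z -> is_derive z 1 g1 (g2 z).
  move=> z0; have s0 : 2 * Num.sqrt z != 0.
    by rewrite mulf_neq0// gt_eqF// sqrtr_gt0.
  have h1 := is_derive_compx (f := mean1 mu U B f1) (g := Num.sqrt)
    (is_derive_mean1 mu mU U1 B tf1 tf2 df1 _) (is_derive1_sqrt z0).
  have h2 := is_deriveV (f := fun t => 2 * Num.sqrt t) (x := z) s0
    (is_deriveZx 2 (is_derive1_sqrt z0)).
  exact: (is_deriveBx (is_deriveMx h1 h2) (dq1 z)).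
apply: (ndecr_of_derive (df := g2) xy).
- apply: derivable_within_continuous => z; rewrite in_itv/= => /andP[xz _].
  by have [] := dg1 z (lt_le_trans x0 xz).
- by move=> z /andP[xz _]; apply: dg1; exact: lt_trans xz.
- move=> z /andP[xz _]; have z0 : 0 < z by exact: lt_trans xz.
  have s0 : 0 < Num.sqrt z by rewrite sqrtr_gt0.
  have := hess s0; rewrite sqr_sqrtr ?(ltW z0)// => h.
  rewrite /g2 subr_ge0 -(@ler_pM2l _ (4 * Num.sqrt z ^+ 3)); last first.
    by rewrite mulr_gt0// exprn_gt0.
  apply: le_trans h _; rewrite le_eqVlt; apply/orP; left; apply/eqP.
  by field; rewrite gt_eqF.
Qed.

(** At 0 the square root is not differentiable, and continuity is what admits the endpoint s - v' =
    0 in [g_spread], reached when the two coefficients of a pair have equal absolute values. *)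
Let cg : continuous g.
Proof.
move=> x.
have h : {for x, continuous (fun x => mean mu U B f (Num.sqrt x))}.
  apply: continuous_comp; first exact: sqrt_continuous.
  exact: is_derive_continuous (is_derive_mean mu mU U1 B tf tf1 df _).
exact: (continuousB h (is_derive_continuous (dq x))).
Qed.

Let g_spread s v v' : 0 <= v -> v <= v' -> v' <= s ->
  g (s + v) + g (s - v) <= g (s + v') + g (s - v').
Proof.
move=> v0 vv' v's.
have dplus (t : R) : is_derive t 1 (fun t : R => s + t) 1.
  by apply: is_derive_eq; rewrite /GRing.scale /=; ring.
have dminus (t : R) : is_derive t 1 (fun t : R => s - t) (- 1).
  by apply: is_derive_eq; rewrite /GRing.scale /=; ring.
apply: (@ndecr_of_derive _ (fun t => g (s + t) + g (s - t))
  (fun t => g1 (s + t) - g1 (s - t)) v v') => //.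
- apply: continuous_subspaceT => t.
  have c1 : {for t, continuous (fun t => g (s + t))}.
    apply: (continuous_comp (f := fun t => s + t)); last exact: cg.
    exact: is_derive_continuous (dplus t).
  have c2 : {for t, continuous (fun t => g (s - t))}.
    apply: (continuous_comp (f := fun t => s - t)); last exact: cg.
    exact: is_derive_continuous (dminus t).
  exact: (continuousD c1 c2).
- move=> t /andP[vt tv'].
  have p1 : 0 < s + t by lra.
  have p2 : 0 < s - t by lra.
  have e1 := is_derive_compx (f := g) (g := fun t => s + t) (dg p1) (dplus t).
  have e2 := is_derive_compx (f := g) (g := fun t => s - t) (dg p2) (dminus t).
  by apply: is_derive_eq (is_deriveDx e1 e2) _; ring.
- by move=> t /andP[vt tv']; rewrite subr_ge0 g1_ndecr; lra.
Qed.

Lemma spread_le s w w' : 0 <= w -> w <= w' -> w' <= s ->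
  \int[mu]_x (mean mu U B f (Num.sqrt (s + w * U x)) - q (s + w * U x)) <=
  \int[mu]_x (mean mu U B f (Num.sqrt (s + w' * U x)) - q (s + w' * U x)).
Proof.
move=> w0 ww' w's; have [mg bg] := continuous_tame cg.
have tg t : 0 <= t <= s -> tame1 (fun u => g (s + t * u)).
  move=> ts; split.
    apply: measurableT_comp => //; apply: measurable_funD; first exact: measurable_cst.
    by apply: measurable_funM; [exact: measurable_cst|exact: measurable_id].
  by have [C gC] := bg (2 * s); exists C => u u1; apply: gC; nra.
have bmg t : 0 <= t <= s -> bmeas (fun x => g (s + t * U x)).
  move=> ts; have [m [C gC]] := tg t ts; split; last by exists C => x; exact: gC.
  exact: (measurableT_comp m mU).
have bmgN t : 0 <= t <= s -> bmeas (fun x => g (s + t * - U x)).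
  move=> ts; have [m [C gC]] := tg t ts; split.
    by apply: (measurableT_comp m); exact: measurable_funN.
  by exists C => x; apply: gC; have := U1 x; lra.
(* Symmetry of U replaces g(s + t U) by the average of g at s + t U and s - t U, to which [g_spread]
   applies pointwise with spread t |U|. *)
have E t : 0 <= t <= s ->
    \int[mu]_x g (s + t * U x) = 2^-1 * \int[mu]_x (g (s + t * U x) + g (s + t * - U x)).
  move=> ts; rewrite (RintD mu (bmg _ ts) (bmgN _ ts)).
  by rewrite -(symU (tg t ts)); lra.
have ws : 0 <= w <= s by lra.
have w's' : 0 <= w' <= s by lra.
rewrite -/g !E// ler_pM2l ?invr_gt0//; apply: le_Rint => [||x].
- exact: (bmeasD (bmg _ ws) (bmgN _ ws)).
- exact: (bmeasD (bmg _ w's') (bmgN _ w's')).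
have [u0|u0] := leP 0 (U x).
  by rewrite !mulrN; apply: g_spread; have := U1 x; nra.
rewrite [leLHS]addrC [leRHS]addrC.
have := @g_spread s (w * - U x) (w' * - U x); rewrite !mulrN !opprK; apply; have := U1 x; nra.
Qed.

End Swap.

(** * Tangent and parabola bounds for real powers *)

Section RealPowers.
Context {R : realType}.
Implicit Types (e c a x y q : R).

Lemma ln_le_subr1 y : 0 < y -> ln y <= y - 1.
Proof. by move=> y0; have := @le_ln1Dx R (y - 1); rewrite addrCA subrr addr0; apply; lra. Qed.

(** exp z >= 1 + z at z = q ln y, then ln y <= y - 1, which the sign of q reverses. *)
Lemma powR_ge_tangent_le0 y q : 0 < y -> q <= 0 -> 1 + q * (y - 1) <= y `^ q.
Proof.
move=> y0 q0; rewrite /powR gt_eqF//.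
apply: le_trans (expR_ge1Dx _); rewrite lerD2l ler_wnM2l//.
exact: ln_le_subr1.
Qed.

(** The identity y^q = y (1/y)^(1-q) reduces this to the nonpositive exponent 1 - q at 1/y. *)
Lemma powR_ge_tangent_ge1 y q : 0 < y -> 1 <= q -> 1 + q * (y - 1) <= y `^ q.
Proof.
move=> y0 q1.
have iy : 0 < y^-1 by rewrite invr_gt0.
have := powR_ge_tangent_le0 (q := - (q - 1)) iy.
rewrite oppr_le0 subr_ge0 => /(_ q1).
rewrite -(powR_inv1 (ltW y0)) -powRrM mulN1r opprK => h.
have -> : y `^ q = y * y `^ (q - 1).
  rewrite -[X in X * _](powRr1 (ltW y0)) -powRD ?(gt_eqF y0) ?implybT//.
  by rewrite addrCA subrr addr0.
apply: (le_trans _ (ler_wpM2l (ltW y0) h)).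
rewrite (powR_inv1 (ltW y0)) le_eqVlt; apply/orP; left; apply/eqP.
by field; rewrite gt_eqF.
Qed.

(** The parabola lies below min(1, x), touching 1 at x = 2, while min(1, y) <= y^q for every
    exponent in [0, 1]. Being quadratic, it can be averaged over U knowing only E U^2. *)
Lemma powR_ge_quadratic x y q : 0 <= x -> x <= y -> 0 < y -> 0 <= q <= 1 ->
  x - x ^+ 2 / 4 <= y `^ q.
Proof.
move=> x0 xy y0 /andP[q0 q1].
have x1 : x - x ^+ 2 / 4 <= 1 by have := sqr_ge0 (x - 2); lra.
have [y1|y1] := leP 1 y.
  by apply: le_trans x1 _; rewrite -(powRr0 y) ler_powR.
apply: (@le_trans _ _ y); first by have := sqr_ge0 x; lra.
rewrite /powR gt_eqF// -[leLHS]lnK// ler_expR.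
have : ln y <= 0 by rewrite ln_le0// ltW.
by nra.
Qed.

(** Carrying the coefficient [c] closes the family under differentiation. *)
Definition spow e c a x := c * (x + e) `^ a.

Lemma is_derive_spow e c a x : 0 < e -> 0 <= x ->
  is_derive x 1 (spow e c a) (spow e (c * a) (a - 1) x).
Proof.
move=> e0 x0; have xe : 0 < x + e by lra.
have h : is_derive x 1 (fun x : R => x + e) 1.
  by apply: is_derive_eq; rewrite /GRing.scale /=; ring.
have := is_deriveZx c (is_derive_compx (f := fun y => y `^ a) (g := fun x => x + e)
  (is_derive1_powR a xe) h).
by move=> /is_derive_eq; apply; rewrite /spow; ring.
Qed.

Lemma tame_spow e c a : 0 < e -> tame (spow e c a).
Proof.
move=> e0; split.
  apply: measurable_funM; first exact: measurable_cst.
  apply: (measurableT_comp (measurable_powR a)).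
  by apply: measurable_funD; [exact: measurable_id|exact: measurable_cst].
move=> N; have [N0|N0] := leP 0 N; last first.
  by exists 0 => x /andP[x0 xN]; move: (le_trans x0 xN); rewrite leNgt N0.
have c0 : {within `[0, N], continuous (spow e c a)}.
  apply: derivable_within_continuous => x; rewrite in_itv/= => /andP[x0 _].
  by have [] := is_derive_spow c a e0 x0.
have [z1 _ zmax] := EVT_max N0 c0; have [z2 _ zmin] := EVT_min N0 c0.
exists (`|spow e c a z1| + `|spow e c a z2|) => x xN.
have /zmax h1 : x \in `[0, N]%R by rewrite in_itv.
have /zmin h2 : x \in `[0, N]%R by rewrite in_itv.
have := ler_norm (spow e c a z1); have := ler_norm (- spow e c a z2).
rewrite normrN ler_norml.
have := normr_ge0 (spow e c a z1); have := normr_ge0 (spow e c a z2); lra.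
Qed.

Lemma spow_pred e c a x : 0 < x + e -> spow e c (a - 1) x = spow e c a x / (x + e).
Proof.
move=> xe; rewrite /spow powRD ?(gt_eqF xe) ?implybT//.
by rewrite powRN (powRr1 (ltW xe)) mulrA.
Qed.

End RealPowers.

(** * Moments of U and the gain of a polynomial *)

Section Gain.
Context {R : realType} {dT : measure_display} {T : measurableType dT}
  (mu : probability T R) (U : T -> R) (d : nat).
Hypothesis mU : measurable_fun setT U.
Hypothesis U1 : forall x, -1 <= U x <= 1.
Hypothesis d2 : (2 <= d)%N.
Hypothesis byparts : forall g g1 : R -> R, tame1 g -> tame1 g1 ->
  (forall u : R, -1 <= u <= 1 -> is_derive u 1 g (g1 u)) ->
  (d%:R - 1) * \int[mu]_x (U x * g (U x)) =
  \int[mu]_x ((1 - U x ^+ 2) * g1 (U x)).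
Hypothesis symU : forall g : R -> R, tame1 g ->
  \int[mu]_x g (U x) = \int[mu]_x g (- U x).

Let dR : (2 : R) <= d%:R. Proof. by rewrite (ler_nat _ 2 d). Qed.

Let bU := bmeasU mU U1.

Lemma Rint_odd n : odd n -> \int[mu]_x (U x ^+ n) = 0.
Proof.
move=> on; have t : tame1 (fun u : R => u ^+ n).
  split; first exact: exprn_measurable.
  by exists 1 => u u1; rewrite normrX exprn_ile1// ler_norml.
have := symU t.
have -> : \int[mu]_x ((- U x) ^+ n) = \int[mu]_x (- 1 * U x ^+ n).
  by apply: eq_Rintegral => x _; rewrite exprNn -signr_odd on expr1.
rewrite RintZ; last exact: bmeasX.
by move: (Rintegral _ _ _) => I; lra.
Qed.

(** [byparts] for the identity function says (d - 1) E U^2 = 1 - E U^2. *)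
Lemma Rint_sqr : \int[mu]_x (U x ^+ 2) = d%:R^-1.
Proof.
have h (u : R) : -1 <= u <= 1 -> is_derive u 1 (fun x : R => x) 1.
  by move=> _; exact: is_derive_idx.
have := byparts (@tame1_id R) (tame1_cst 1) h.
have -> : \int[mu]_x ((1 - U x ^+ 2) * 1) = \int[mu]_x 1 - \int[mu]_x (U x ^+ 2).
  rewrite -RintB; [|exact: bmeas_cst|exact: bmeasX].
  by apply: eq_Rintegral => x _; ring.
have -> : \int[mu]_x (U x * U x) = \int[mu]_x (U x ^+ 2).
  by apply: eq_Rintegral => x _; rewrite expr2.
have d0 : d%:R != 0 :> R by rewrite gt_eqF//; have := dR; lra.
rewrite Rint_cst; move: (Rintegral _ _ _) => I eI.
by apply: (mulfI d0); rewrite mulfV//; lra.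
Qed.

Lemma Rint_quartic_le : \int[mu]_x (U x ^+ 4) <= d%:R^-1.
Proof.
rewrite -Rint_sqr; apply: le_Rint => [||x]; [exact: bmeasX|exact: bmeasX|].
have -> : U x ^+ 4 = (U x ^+ 2) ^+ 2 by ring.
have : 0 <= U x ^+ 2 <= 1 by have := U1 x; have := sqr_ge0 (U x); nra.
by move: (U x ^+ 2) => z; nra.
Qed.

Lemma Rint_poly4 (a0 a1 a2 a3 a4 : R) :
  \int[mu]_x (a0 + a1 * U x + a2 * U x ^+ 2 + a3 * U x ^+ 3 + a4 * U x ^+ 4) =
  a0 + a2 / d%:R + a4 * \int[mu]_x (U x ^+ 4).
Proof.
have b n (a : R) : bmeas (fun x => a * U x ^+ n) by apply: bmeasZ; exact: bmeasX.
have b0 := bmeas_cst (T := T) a0.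
have b1 : bmeas (fun x => a1 * U x) by exact: bmeasZ.
rewrite (RintD mu (bmeasD (bmeasD (bmeasD b0 b1) (b 2 a2)) (b 3 a3)) (b 4 a4)).
rewrite (RintD mu (bmeasD (bmeasD b0 b1) (b 2 a2)) (b 3 a3)).
rewrite (RintD mu (bmeasD b0 b1) (b 2 a2)) (RintD mu b0 b1).
rewrite Rint_cst !RintZ; try exact: bmeasX; try exact: bU.
rewrite Rint_sqr Rint_odd// -[\int[mu]_x U x](_ : \int[mu]_x (U x ^+ 1) = _).
  by rewrite Rint_odd//; lra.
by apply: eq_Rintegral => x _; rewrite expr1.
Qed.

(** Let q'' = a + b x + g x^2. By symmetry E q(s + t U) = q(s) + q''(s) t^2 / (2 d) + g t^4 E U^4 /
    12. As g <= 0, the quartic term is bounded below through E U^4 <= 1/d and w'^4 - w^4 <= 2 s^2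
    (w'^2 - w^2); this turns g s^2 / 2 into 2 g s^2 / 3. *)
Lemma Rint_quartic_spread (a b g s w w' : R) : g <= 0 ->
  0 <= w -> w <= w' -> w' <= s ->
  ((a + b * s) / 2 + 2 * g * s ^+ 2 / 3) * ((w' ^+ 2 - w ^+ 2) / d%:R) <=
  \int[mu]_x (a * (s + w' * U x) ^+ 2 / 2 + b * (s + w' * U x) ^+ 3 / 6
    + g * (s + w' * U x) ^+ 4 / 12) -
  \int[mu]_x (a * (s + w * U x) ^+ 2 / 2 + b * (s + w * U x) ^+ 3 / 6
    + g * (s + w * U x) ^+ 4 / 12).
Proof.
move=> g0 w0 ww' w's.
have E t : \int[mu]_x (a * (s + t * U x) ^+ 2 / 2 + b * (s + t * U x) ^+ 3 / 6
    + g * (s + t * U x) ^+ 4 / 12) =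
   (a * s ^+ 2 / 2 + b * s ^+ 3 / 6 + g * s ^+ 4 / 12) +
   (a / 2 + b * s / 2 + g * s ^+ 2 / 2) * t ^+ 2 / d%:R +
   g / 12 * t ^+ 4 * \int[mu]_x (U x ^+ 4).
  rewrite -(Rint_poly4 _ (a * s * t + b * s ^+ 2 * t / 2 + g * s ^+ 3 * t / 3) _
    (b * t ^+ 3 / 6 + g * s * t ^+ 3 / 3)).
  by apply: eq_Rintegral => x _; field.
rewrite !E.
have m4 := Rint_quartic_le; set m := \int[mu]_x (U x ^+ 4) in m4 *.
set D := d%:R^-1 in m4 *.
have ww2 : w ^+ 2 <= w' ^+ 2 by rewrite lerXn2r// nnegrE; lra.
have ws2 : w' ^+ 2 <= s ^+ 2 by rewrite lerXn2r// nnegrE; lra.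
have w2 : 0 <= w ^+ 2 by exact: sqr_ge0.
rewrite -[w' ^+ 4](_ : (w' ^+ 2) ^+ 2 = _); last by ring.
rewrite -[w ^+ 4](_ : (w ^+ 2) ^+ 2 = _); last by ring.
have D0 : 0 <= D by rewrite invr_ge0 ler0n.
move: (w ^+ 2) (w' ^+ 2) (s ^+ 2) ww2 ws2 w2 => x x' s2 xx' xs2 x0.
have h1 : (x' ^+ 2 - x ^+ 2) * m <= (x' ^+ 2 - x ^+ 2) * D.
  by apply: ler_wpM2l => //; nra.
have h2 : (x' ^+ 2 - x ^+ 2) * D <= 2 * s2 * (x' - x) * D.
  by apply: ler_wpM2r => //; nra.
have h3 : (x' ^+ 2 - x ^+ 2) * m - 2 * s2 * (x' - x) * D <= 0 by lra.
have := mulr_le0 g0 h3; lra.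
Qed.

(* With [h r = E f (|sqrt r theta + B e|^2)], the hypothesis says that
   [h'' r >= c (a + b r + g r^2)]. *)
Lemma spread_gain (B : R) (f f1 f2 : R -> R) (c a b g s w w' : R) :
  tame f -> tame f1 -> tame f2 ->
  (forall x : R, 0 <= x -> is_derive x 1 f (f1 x)) ->
  (forall x : R, 0 <= x -> is_derive x 1 f1 (f2 x)) ->
  0 <= c -> g <= 0 ->
  (forall r : R, 0 < r -> 4 * r ^+ 3 * (c * (a + b * r ^+ 2 + g * r ^+ 4)) <=
     r * mean2 mu U B f1 f2 r - mean1 mu U B f1 r) ->
  0 <= w -> w <= w' -> w' <= s ->
  \int[mu]_x mean mu U B f (Num.sqrt (s + w * U x)) +
  c * ((a + b * s) / 2 + 2 * g * s ^+ 2 / 3) * ((w' ^+ 2 - w ^+ 2) / d%:R) <=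
  \int[mu]_x mean mu U B f (Num.sqrt (s + w' * U x)).
Proof.
move=> tf tf1 tf2 df df1 c0 g0 hess w0 ww' w's.
pose q x : R := c * (a * x ^+ 2 / 2 + b * x ^+ 3 / 6 + g * x ^+ 4 / 12).
pose q1 x : R := c * (a * x + b * x ^+ 2 / 2 + g * x ^+ 3 / 3).
pose q2 x : R := c * (a + b * x + g * x ^+ 2).
have dq (x : R) : is_derive x 1 q (q1 x).
  by rewrite /q; apply: is_derive_eq; rewrite /q1 /GRing.scale /=; field.
have dq1 (x : R) : is_derive x 1 q1 (q2 x).
  by rewrite /q1; apply: is_derive_eq; rewrite /q2 /GRing.scale /=; field.
have hess' (r : R) : 0 < r -> 4 * r ^+ 3 * q2 (r ^+ 2) <=
     r * mean2 mu U B f1 f2 r - mean1 mu U B f1 r.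
  by move=> r0; apply: le_trans (hess r r0); rewrite /q2; lra.
have bm t : 0 <= t <= s -> bmeas (fun x => mean mu U B f (Num.sqrt (s + t * U x))).
  move=> ts.
  have c1 : continuous (fun x => mean mu U B f (Num.sqrt x)).
    move=> x; apply: continuous_comp; first exact: sqrt_continuous.
    exact: is_derive_continuous (is_derive_mean mu mU U1 B tf tf1 df _).
  have [mg bg] := continuous_tame c1; split.
    apply: (measurableT_comp mg); apply: measurable_funD; first exact: measurable_cst.
    by apply: measurable_funM => //; exact: measurable_cst.
  have [C gC] := bg (2 * s); exists C => x; apply: gC; have := U1 x; nra.
have bq t : bmeas (fun x => a * (s + t * U x) ^+ 2 / 2 + b * (s + t * U x) ^+ 3 / 6
    + g * (s + t * U x) ^+ 4 / 12).
  have bl : bmeas (fun x => s + t * U x).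
    by apply: bmeasD; [exact: bmeas_cst|exact: bmeasZ].
  have bn n (k l : R) : bmeas (fun x => k * (s + t * U x) ^+ n / l).
    by apply: bmeasM; [apply: bmeasZ; exact: bmeasX|exact: bmeas_cst].
  exact: (bmeasD (bmeasD (bn 2%N a 2) (bn 3%N b 6)) (bn 4%N g 12)).
have ws : 0 <= w <= s by lra.
have w's' : 0 <= w' <= s by lra.
have lin (i i' y y' z : R) : z <= y' - y -> i - y <= i' - y' -> i + z <= i'.
  by move=> *; lra.
have := spread_le mU U1 symU tf tf1 tf2 df df1 dq dq1 hess' w0 ww' w's.
rewrite (RintB mu (bm _ ws) (bmeasZ c (bq w))) (RintB mu (bm _ w's') (bmeasZ c (bq w'))).
rewrite (RintZ mu _ (bq w)) (RintZ mu _ (bq w')).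
have := ler_wpM2l c0 (Rint_quartic_spread a b g0 w0 ww' w's).
by rewrite [c * (_ - _)]mulrBr [c * (_ * _)]mulrA => h1 h2; exact: (lin _ _ _ _ _ h1 h2).
Qed.

End Gain.

Lemma ler_of_eq (R : realType) (x y : R) : x = y -> x <= y.
Proof. by move->. Qed.

(** * Gains for power functions, by range of the exponent *)

Section PowerGain.
Context {R : realType} {dT : measure_display} {T : measurableType dT}
  (mu : probability T R) (U : T -> R) (d : nat).
Hypothesis mU : measurable_fun setT U.
Hypothesis U1 : forall x, -1 <= U x <= 1.
Hypothesis d2 : (2 <= d)%N.
Hypothesis byparts : forall g g1 : R -> R, tame1 g -> tame1 g1 ->
  (forall u : R, -1 <= u <= 1 -> is_derive u 1 g (g1 u)) ->
  (d%:R - 1) * \int[mu]_x (U x * g (U x)) =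
  \int[mu]_x ((1 - U x ^+ 2) * g1 (U x)).
Hypothesis symU : forall g : R -> R, tame1 g ->
  \int[mu]_x g (U x) = \int[mu]_x g (- U x).
Variables (e k : R).
Hypothesis e0 : 0 < e.

Let dR : (2 : R) <= d%:R. Proof. by rewrite (ler_nat _ 2 d). Qed.

Let bU := bmeasU mU U1.

Let f0 := spow e 1 k.
Let f1 := spow e (1 * k) (k - 1).
Let f2 := spow e (1 * k * (k - 1)) (k - 1 - 1).
Let f3 := spow e (1 * k * (k - 1) * (k - 1 - 1)) (k - 1 - 1 - 1).
Let f4 := spow e (1 * k * (k - 1) * (k - 1 - 1) * (k - 1 - 1 - 1)) (k - 1 - 1 - 1 - 1).

Let t0 : tame f0. Proof. exact: tame_spow. Qed.
Let t1 : tame f1. Proof. exact: tame_spow. Qed.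
Let t2 : tame f2. Proof. exact: tame_spow. Qed.
Let t3 : tame f3. Proof. exact: tame_spow. Qed.
Let t4 : tame f4. Proof. exact: tame_spow. Qed.
Let d0 (x : R) : 0 <= x -> is_derive x 1 f0 (f1 x). Proof. exact: is_derive_spow. Qed.
Let d1 (x : R) : 0 <= x -> is_derive x 1 f1 (f2 x). Proof. exact: is_derive_spow. Qed.
Let dd2 (x : R) : 0 <= x -> is_derive x 1 f2 (f3 x). Proof. exact: is_derive_spow. Qed.
Let d3 (x : R) : 0 <= x -> is_derive x 1 f3 (f4 x). Proof. exact: is_derive_spow. Qed.

Let xe (x : R) : 0 <= x -> 0 < x + e. Proof. by move=> x0; rewrite ltr_wpDl. Qed.

Let f3E (x : R) : 0 <= x -> f3 x = (k - 2) * f2 x / (x + e).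
Proof.
move=> x0; rewrite /f3 (spow_pred _ _ (xe x0)).
by rewrite /f2 /spow; congr (_ / _); ring.
Qed.

Let f4E (x : R) : 0 <= x -> f4 x = (k - 2) * (k - 3) * f2 x / (x + e) ^+ 2.
Proof.
move=> x0; rewrite /f4 2!(spow_pred _ _ (xe x0)).
by rewrite /f2 /spow; field; rewrite gt_eqF// xe.
Qed.

Let f2E (x : R) : f2 x = k * (k - 1) * (x + e) `^ (k - 2).
Proof. by rewrite /f2 /spow; congr (_ * _ `^ _); ring. Qed.

Let f2_ge0 (x : R) : 1 <= k -> 0 <= f2 x.
Proof. by move=> k1; rewrite f2E mulr_ge0 ?powR_ge0// mulr_ge0; lra. Qed.

(* Up to the shift by [e], the bilaplacian of [|x|^(2k)] is a multiple of
   [(|x|^2)^(k-2)], a convex function of [|x|^2], and is bounded below by its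
   tangent at [|x|^2 = 1]. *)
Lemma gain_le2 (B s w w' : R) : 1 <= k <= 2 -> 0 <= w -> w <= w' -> w' <= s ->
  \int[mu]_x mean mu U B (spow e 1 k) (Num.sqrt (s + w * U x)) +
  k * (k - 1) * ((2 * k + d%:R - 2) * (2 * k + d%:R - 4) / (d%:R * (d%:R + 2))) *
  ((1 + (k - 2) * (s + B ^+ 2 + e - 1)) / 2) * ((w' ^+ 2 - w ^+ 2) / d%:R) <=
  \int[mu]_x mean mu U B (spow e 1 k) (Num.sqrt (s + w' * U x)).
Proof.
move=> /andP[k1 k2] w0 ww' w's.
have dR' := dR; have e0' := e0.
set c := k * (k - 1) * _.
(* c4 |x|^(2k-4) is one sixteenth of the bilaplacian of |x|^(2k). After division by 4 r^3,
   [mean_bilaplace] contributes the further factor 4 / (d (d + 2)). *)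
set c4 := k * (k - 1) * ((2 * k + d%:R - 2) * (2 * k + d%:R - 4) / 4).
have c40 : 0 <= c4 by rewrite mulr_ge0 ?divr_ge0 ?mulr_ge0//; lra.
have cE : c = 4 / (d%:R * (d%:R + 2)) * c4.
  by rewrite /c /c4; field; apply/andP; split; rewrite gt_eqF//; lra.
have c0 : 0 <= c by rewrite cE mulr_ge0// divr_ge0// mulr_ge0; lra.
have H (r : R) : 0 < r -> c4 * (1 + (k - 2) * (B ^+ 2 + e - 1)) - c4 * (2 - k) * r ^+ 2 <=
    \int[mu]_x (lap d (fun x => x * f3 x + (1 + d%:R / 2) * f2 x)
      (fun x => x * f4 x + (2 + d%:R / 2) * f3 x) (sqn B r (U x))).
  move=> r0.
  have bl : bmeas (fun x => c4 * (1 + (k - 2) * (B ^+ 2 + r ^+ 2 + e - 1)) +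
      c4 * (k - 2) * (2 * (r * B)) * U x + 0 * U x ^+ 2 + 0 * U x ^+ 3 + 0 * U x ^+ 4).
    have bn n (a : R) : bmeas (fun x => a * U x ^+ n) by apply: bmeasZ; exact: bmeasX.
    apply: bmeasD (bn 4%N 0); apply: bmeasD (bn 3%N 0); apply: bmeasD (bn 2%N 0).
    by apply: bmeasD; [exact: bmeas_cst|exact: bmeasZ].
  have -> : c4 * (1 + (k - 2) * (B ^+ 2 + e - 1)) - c4 * (2 - k) * r ^+ 2 =
    \int[mu]_x (c4 * (1 + (k - 2) * (B ^+ 2 + r ^+ 2 + e - 1)) +
      c4 * (k - 2) * (2 * (r * B)) * U x + 0 * U x ^+ 2 + 0 * U x ^+ 3 + 0 * U x ^+ 4).
    by rewrite (Rint_poly4 mU U1 d2 byparts symU); ring.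
  apply: le_Rint => //.
    apply: (bmeas_sqn mU U1 B r (f := lap d _ _)).
    apply: tameD; apply: tameM; [exact: tame_id| |exact: tame_cst|].
      by apply: tameD; apply: tameM => //; [exact: tame_id|exact: tame_cst].
    by apply: tameD; apply: tameM => //; [exact: tame_id|exact: tame_cst].
  move=> x; have x0 := sqn_ge0 B r (U1 x).
  apply: (@le_trans _ _ (c4 * (1 + (k - 2) * (sqn B r (U x) + e - 1)))).
    by rewrite /sqn; lra.
  move: (sqn B r (U x)) x0 => {}x x0; rewrite /lap f3E// f4E//.
  have y0 : 0 < x + e by lra.
  have -> : x * (x * ((k - 2) * (k - 3) * f2 x / (x + e) ^+ 2) +
        (2 + d%:R / 2) * ((k - 2) * f2 x / (x + e))) +
     d%:R / 2 * (x * ((k - 2) * f2 x / (x + e)) + (1 + d%:R / 2) * f2 x) =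
    f2 x * ((k - 2) * (k - 3) * (x / (x + e)) ^+ 2 +
      (d%:R + 2) * (k - 2) * (x / (x + e)) + d%:R * (d%:R + 2) / 4).
    by field; rewrite gt_eqF.
  have z1 : 0 <= x / (x + e) <= 1.
    by rewrite divr_ge0 ?(ltW y0)//= ler_pdivrMr// mul1r; lra.
  move: (x / (x + e)) z1 => z z1.
  (* For z = x / (x + e) the bracket is a quadratic whose value at z = 1, the unshifted case, is (2k
     + d - 2)(2k + d - 4)/4. The factorisation below shows that this is its minimum on [0, 1]; it
     relies on d >= 2. *)
  apply: (@le_trans _ _ (f2 x * ((2 * k + d%:R - 2) * (2 * k + d%:R - 4) / 4))).
    rewrite f2E (_ : c4 * _ = k * (k - 1) * (1 + (k - 2) * (x + e - 1)) *
      ((2 * k + d%:R - 2) * (2 * k + d%:R - 4) / 4)); last by rewrite /c4; ring.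
    apply: ler_wpM2r; first by rewrite divr_ge0 ?mulr_ge0//; lra.
    apply: ler_wpM2l; first by rewrite mulr_ge0; lra.
    by apply: powR_ge_tangent_le0 => //; lra.
  apply: ler_wpM2l; first exact: f2_ge0.
  rewrite -subr_ge0.
  have : 0 <= (1 - z) * (2 - k) * ((k - 3) * (z + 1) + d%:R + 2).
    by rewrite mulr_ge0// ?mulr_ge0//; [lra|lra|nra].
  by congr (_ <= _); field.
have hess (r : R) : 0 < r ->
    4 * r ^+ 3 * (c * ((1 + (k - 2) * (B ^+ 2 + e - 1)) + (k - 2) * r ^+ 2 + 0 * r ^+ 4)) <=
    r * mean2 mu U B f1 f2 r - mean1 mu U B f1 r.
  move=> r0; have l10 : 0 <= c4 * (2 - k) by rewrite mulr_ge0//; lra.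
  apply: le_trans (mean_bilaplace mU U1 d2 byparts t1 t2 t3 t4 d1 dd2 d3 r0 l10 H).
  by rewrite cE; apply: ler_of_eq; field; apply/andP; split; rewrite gt_eqF//; lra.
have := spread_gain mU U1 d2 byparts symU t0 t1 t2 d0 d1 c0 (lexx 0) hess w0 ww' w's.
by apply: le_trans; rewrite lerD2l; apply: ler_of_eq; congr (_ * _ * _); field.
Qed.

(** For 2 < k < 3 the fourth derivative is negative, so the condition of [mean_hess] does not hold
    term by term. It equals (k - 2) f2 / (x + e) times 1 + (k - 3) t, where t = B^2 (1 - u^2) / ((x
    + e)(d + 1)) lies in [0, 1] by [sqn_ge], and k - 3 >= -1. *)
Let hess_ge2 (B r : R) : 2 <= k -> 0 < r ->
  4 * r ^+ 3 * \int[mu]_x f2 (sqn B r (U x)) <=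
  r * mean2 mu U B f1 f2 r - mean1 mu U B f1 r.
Proof.
move=> k2 r0; have dR' := dR; have e0' := e0.
apply: (mean_hess mU U1 d2 byparts t1 t2 t3 t4 d1 dd2 d3 r0) => u u1.
have x0 := sqn_ge0 B r u1; have := sqn_ge B r u1.
move: (sqn B r u) x0 => x x0 hx; rewrite f3E// f4E//.
have y0 : 0 < x + e by lra.
have p0 : 0 <= B ^+ 2 * (1 - u ^+ 2) by rewrite mulr_ge0 ?sqr_ge0//; nra.
have -> : (k - 2) * f2 x / (x + e) +
    B ^+ 2 * (1 - u ^+ 2) * ((k - 2) * (k - 3) * f2 x / (x + e) ^+ 2) / (d%:R + 1) =
  (k - 2) * f2 x / (x + e) *
    (1 + (k - 3) * (B ^+ 2 * (1 - u ^+ 2) / (x + e) / (d%:R + 1))).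
  by field; apply/andP; split; rewrite gt_eqF//; lra.
have q1 : 0 <= B ^+ 2 * (1 - u ^+ 2) / (x + e) / (d%:R + 1) <= 1.
  apply/andP; split.
    by apply: divr_ge0; [apply: divr_ge0 => //; exact: ltW|lra].
  have y1 : 0 < (x + e) * (d%:R + 1) by rewrite mulr_gt0//; lra.
  rewrite -mulrA -invfM ler_pdivrMr//.
  by rewrite mul1r; nra.
apply: mulr_ge0; last first.
  by move: (_ / (d%:R + 1)) q1 => z z1; nra.
by rewrite divr_ge0 ?(ltW y0)// mulr_ge0; [|lra|apply: f2_ge0; lra].
Qed.

Lemma gain_ge3 (B s w w' : R) : 3 <= k -> 0 <= w -> w <= w' -> w' <= s ->
  \int[mu]_x mean mu U B (spow e 1 k) (Num.sqrt (s + w * U x)) +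
  k * (k - 1) *
  ((1 + (k - 2) * (s + B ^+ 2 - 1)) / 2) * ((w' ^+ 2 - w ^+ 2) / d%:R) <=
  \int[mu]_x mean mu U B (spow e 1 k) (Num.sqrt (s + w' * U x)).
Proof.
move=> k3 w0 ww' w's; have dR' := dR; have e0' := e0.
have c0 : 0 <= k * (k - 1) by rewrite mulr_ge0; lra.
have hess (r : R) : 0 < r ->
    4 * r ^+ 3 * (k * (k - 1) * ((1 + (k - 2) * (B ^+ 2 - 1)) + (k - 2) * r ^+ 2 + 0 * r ^+ 4)) <=
    r * mean2 mu U B f1 f2 r - mean1 mu U B f1 r.
  move=> r0; apply: (le_trans _ (hess_ge2 _ _ r0)); last by lra.
  apply: ler_wpM2l; first by rewrite mulr_ge0// exprn_ge0// ltW.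
  have -> : k * (k - 1) * ((1 + (k - 2) * (B ^+ 2 - 1)) + (k - 2) * r ^+ 2 + 0 * r ^+ 4) =
    \int[mu]_x (k * (k - 1) * (1 + (k - 2) * (B ^+ 2 + r ^+ 2 - 1)) +
      k * (k - 1) * (k - 2) * (2 * (r * B)) * U x + 0 * U x ^+ 2 + 0 * U x ^+ 3 + 0 * U x ^+ 4).
    by rewrite (Rint_poly4 mU U1 d2 byparts symU); ring.
  have bn n (a : R) : bmeas (fun x => a * U x ^+ n) by apply: bmeasZ; exact: bmeasX.
  apply: le_Rint => [||x].
  - apply: bmeasD (bn 4%N 0); apply: bmeasD (bn 3%N 0); apply: bmeasD (bn 2%N 0).
    by apply: bmeasD; [exact: bmeas_cst|exact: bmeasZ].
  - exact: (bmeas_sqn mU U1).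
  have x0 := sqn_ge0 B r (U1 x); rewrite f2E.
  apply: (@le_trans _ _ (k * (k - 1) * (1 + (k - 2) * (sqn B r (U x) - 1)))).
    by rewrite /sqn; lra.
  apply: ler_wpM2l => //; move: (sqn B r (U x)) x0 => y y0.
  apply: (le_trans _ (powR_ge_tangent_ge1 _ _)); [|lra|lra].
  by nra.
have := spread_gain mU U1 d2 byparts symU t0 t1 t2 d0 d1 c0 (lexx 0) hess w0 ww' w's.
by apply: le_trans; rewrite lerD2l; apply: ler_of_eq; congr (_ * _ * _); field.
Qed.

(** The exponent k - 2 lies in [0, 1], so [powR_ge_quadratic] replaces the tangent. The term d^-1
    B^2 s comes from the square of 2 r B U in the parabola. *)
Lemma gain_23 (B s w w' : R) : 2 <= k <= 3 -> 0 <= w -> w <= w' -> w' <= s ->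
  \int[mu]_x mean mu U B (spow e 1 k) (Num.sqrt (s + w * U x)) +
  k * (k - 1) *
  ((s + B ^+ 2 - B ^+ 4 / 4 - (1 / 2 + d%:R^-1) * B ^+ 2 * s) / 2 - s ^+ 2 / 6) *
  ((w' ^+ 2 - w ^+ 2) / d%:R) <=
  \int[mu]_x mean mu U B (spow e 1 k) (Num.sqrt (s + w' * U x)).
Proof.
move=> /andP[k2 k3] w0 ww' w's; have dR' := dR; have e0' := e0.
have c0 : 0 <= k * (k - 1) by rewrite mulr_ge0; lra.
have hess (r : R) : 0 < r ->
    4 * r ^+ 3 * (k * (k - 1) * ((B ^+ 2 - B ^+ 4 / 4) +
      (1 - (1 / 2 + d%:R^-1) * B ^+ 2) * r ^+ 2 + (- 4^-1) * r ^+ 4)) <=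
    r * mean2 mu U B f1 f2 r - mean1 mu U B f1 r.
  move=> r0; apply: (le_trans _ (hess_ge2 _ _ r0)); last by lra.
  apply: ler_wpM2l; first by rewrite mulr_ge0// exprn_ge0// ltW.
  have -> : k * (k - 1) * ((B ^+ 2 - B ^+ 4 / 4) +
      (1 - (1 / 2 + d%:R^-1) * B ^+ 2) * r ^+ 2 + (- 4^-1) * r ^+ 4) =
    \int[mu]_x (k * (k - 1) * (B ^+ 2 + r ^+ 2 - (B ^+ 2 + r ^+ 2) ^+ 2 / 4) +
      k * (k - 1) * (2 * (r * B) - (B ^+ 2 + r ^+ 2) * (r * B)) * U x +
      - (k * (k - 1) * (r * B) ^+ 2) * U x ^+ 2 + 0 * U x ^+ 3 + 0 * U x ^+ 4).
    by rewrite (Rint_poly4 mU U1 d2 byparts symU); field; rewrite gt_eqF//; lra.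
  have bn n (a : R) : bmeas (fun x => a * U x ^+ n) by apply: bmeasZ; exact: bmeasX.
  apply: le_Rint => [||x].
  - apply: bmeasD (bn 4%N 0); apply: bmeasD (bn 3%N 0).
    apply: bmeasD (bn 2%N (- (k * (k - 1) * (r * B) ^+ 2))).
    by apply: bmeasD; [exact: bmeas_cst|exact: bmeasZ].
  - exact: (bmeas_sqn mU U1).
  have x0 := sqn_ge0 B r (U1 x); rewrite f2E.
  apply: (@le_trans _ _ (k * (k - 1) * (sqn B r (U x) - sqn B r (U x) ^+ 2 / 4))).
    by apply: ler_of_eq; rewrite /sqn; field.
  apply: ler_wpM2l => //; move: (sqn B r (U x)) x0 => y y0.
  by apply: powR_ge_quadratic; lra.
have g0 : (- 4^-1 : R) <= 0 by lra.
have := spread_gain mU U1 d2 byparts symU t0 t1 t2 d0 d1 c0 g0 hess w0 ww' w's.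
apply: le_trans; rewrite lerD2l; apply: ler_of_eq; congr (_ * _ * _); field.
by rewrite gt_eqF//; lra.
Qed.

End PowerGain.

(** * Rotation invariance of the uniform law *)

Section Dot.
Context {R : realType} {d : nat}.
Implicit Types x y z w : 'rV[R]_d.

Definition dot x y : R := \sum_(i < d) x ord0 i * y ord0 i.

Lemma dotC x y : dot x y = dot y x.
Proof. by apply: eq_bigr => i _; rewrite mulrC. Qed.

Lemma dotDl x y z : dot (x + y) z = dot x z + dot y z.
Proof. by rewrite -big_split; apply: eq_bigr => i _; rewrite mxE mulrDl. Qed.

Lemma dotZl a x y : dot (a *: x) y = a * dot x y.
Proof. by rewrite mulr_sumr; apply: eq_bigr => i _; rewrite mxE mulrA. Qed.

Lemma dotNl x y : dot (- x) y = - dot x y.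
Proof. by rewrite -scaleN1r dotZl mulN1r. Qed.

Lemma dotBl x y z : dot (x - y) z = dot x z - dot y z.
Proof. by rewrite dotDl dotNl. Qed.

Lemma dotDr x y z : dot z (x + y) = dot z x + dot z y.
Proof. by rewrite !(dotC z) dotDl. Qed.

Lemma dotBr x y z : dot z (x - y) = dot z x - dot z y.
Proof. by rewrite !(dotC z) dotBl. Qed.

Lemma dotZr a x y : dot x (a *: y) = a * dot x y.
Proof. by rewrite !(dotC x) dotZl. Qed.

Lemma dot_ge0 x : 0 <= dot x x.
Proof. by apply: sumr_ge0 => i _; rewrite -expr2 sqr_ge0. Qed.

Lemma dot_eq0 x : dot x x = 0 -> x = 0.
Proof.
move=> /eqP; rewrite psumr_eq0; last by move=> i _; rewrite -expr2 sqr_ge0.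
move=> /allP h; apply/rowP => i; rewrite mxE; apply/eqP.
by have := h i (mem_index_enum i); rewrite /= -expr2 sqrf_eq0.
Qed.

Lemma enormE x : enorm x = Num.sqrt (dot x x).
Proof. by rewrite /enorm; congr Num.sqrt; apply: eq_bigr => i _; rewrite expr2. Qed.

Lemma enorm_sqr x : enorm x ^+ 2 = dot x x.
Proof. by rewrite enormE sqr_sqrtr// dot_ge0. Qed.

Lemma usphereE x : (@usphere R d x) = (dot x x = 1).
Proof.
rewrite /usphere /=; apply/propext; split => [h|h].
  by rewrite -enorm_sqr h expr1n.
by rewrite enormE h sqrtr1.
Qed.

(* For [w = 0] the division by zero makes this the identity. *)
Definition refl w x := x - (2 * dot x w / dot w w) *: w.

Lemma reflB w x y : refl w x - refl w y = refl w (x - y).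
Proof. by apply/rowP => i; rewrite /refl dotBl !mxE; ring. Qed.

Lemma dot_refl w x y : dot (refl w x) (refl w y) = dot x y.
Proof.
rewrite /refl !(dotBl, dotBr, dotZl, dotZr) (dotC w y).
have [->|w0] := eqVneq (dot w w) 0; first by rewrite invr0; ring.
by field.
Qed.

Lemma dot_reflC w x y : dot (refl w x) y = dot x (refl w y).
Proof. by rewrite /refl !(dotBl, dotBr, dotZl, dotZr) (dotC w y); ring. Qed.

Lemma enorm_refl w x : enorm (refl w x) = enorm x.
Proof. by rewrite !enormE dot_refl. Qed.

Lemma reflK w x : refl w (refl w x) = x.
Proof.
have [/dot_eq0 w0|w0] := eqVneq (dot w w) 0.
  by rewrite /refl w0 !scaler0 !subr0.
by apply/rowP => i; rewrite /refl !(dotBl, dotZl) !mxE; field.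
Qed.

Lemma refl_swap x y : dot x x = dot y y -> refl (x - y) x = y.
Proof.
move=> xy; have [/dot_eq0 w0|w0] := eqVneq (dot (x - y) (x - y)) 0.
  by rewrite /refl w0 scaler0 subr0; apply/eqP; rewrite -subr_eq0 w0.
rewrite /refl (_ : _ / _ = 1); first by rewrite scale1r opprB addrC subrK.
apply: (mulIf w0); rewrite mul1r divfK//.
by rewrite !(dotBl, dotBr) -xy (dotC y x); ring.
Qed.

End Dot.

(** * Isometry invariance of Hausdorff measure *)

Section HausdorffInvariance.
Context {R : realType} {d : nat} (h : 'rV[R]_d -> 'rV[R]_d).
Hypothesis hK : involutive h.
Hypothesis h_iso : forall x y, enorm (h x - h y) = enorm (x - y).

Let ediam_le A : (ediam (h @^-1` A) <= ediam A)%E.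
Proof.
apply: ge_ereal_sup => _ [->|[z [/= z1 z2] <-]].
  by apply: ereal_sup_ubound; left.
apply: ereal_sup_ubound; right.
by exists (h z.1, h z.2) => //=; rewrite h_iso.
Qed.

Let preimageK A : h @^-1` (h @^-1` A) = A.
Proof. by apply/seteqP; split => x /=; rewrite hK. Qed.

Let ediamE A : ediam (h @^-1` A) = ediam A.
Proof. by apply/eqP; rewrite eq_le ediam_le -{1}(preimageK A) ediam_le. Qed.

Let premeasure_le s delta A :
  (hausdorff_premeasure s delta (h @^-1` A) <= hausdorff_premeasure s delta A)%E.
Proof.
apply: le_ereal_inf_tmp => _ [V [AV Vd] <-]; apply: ereal_inf_lbound.
exists (fun i => h @^-1` V i).
  split; last by move=> i; rewrite ediamE.
  by move=> x /AV [i _ Vi]; exists i.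
by congr (limn _); apply/funext => n; apply: eq_bigr => i _; rewrite ediamE.
Qed.

Let premeasureE s delta A :
  hausdorff_premeasure s delta (h @^-1` A) = hausdorff_premeasure s delta A.
Proof. by apply/eqP; rewrite eq_le premeasure_le -{1}(preimageK A) premeasure_le. Qed.

(** Pulling covers back along [h] preserves diameters, which gives one inequality between
    premeasures. Applied to the preimage it gives the other, [h] being its own inverse. *)
Lemma hausdorff_isometry s A : hausdorff s (h @^-1` A) = hausdorff s A.
Proof.
rewrite /hausdorff; congr ereal_sup; apply/seteqP.
by split => _ [delta d0 <-]; exists delta => //; rewrite premeasureE.
Qed.

Lemma uniform_sphere_measure_isometry A :
  (forall x, enorm (h x) = enorm x) ->
  uniform_sphere_measure (h @^-1` A) = uniform_sphere_measure A.
Proof.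
move=> hn; rewrite /uniform_sphere_measure; congr (_ / _)%E.
rewrite -[in RHS]hausdorff_isometry preimage_setI; congr hausdorff.
by congr (_ `&` _); apply/seteqP; split => x /=; rewrite /usphere /= hn.
Qed.

End HausdorffInvariance.

Section BorelRow.
Context {R : realType} {d : nat}.

Lemma continuous_measurable_rV (f : 'rV[R]_d -> R) :
  continuous f -> measurable_fun setT (f : borel_rV R d -> R).
Proof.
move=> /continuousP cf; apply: (measurability _ (RGenOpens.measurableE R)).
move=> _ [_ [a [b ->]] <-]; rewrite setTI.
by apply: sub_sigma_algebra; apply: cf; exact: interval_open.
Qed.

Lemma continuous_measurable_rV2 (f : 'rV[R]_d -> 'rV[R]_d) :
  continuous f -> measurable_fun setT (f : borel_rV R d -> borel_rV R d).
Proof.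
move=> /continuousP cf.
have E : @measurable _ (borel_rV R d) = <<s @open 'rV[R]_d >> by [].
apply: (measurability _ E).
move=> _ [A oA <-]; rewrite setTI.
by apply: sub_sigma_algebra; apply: cf.
Qed.

Lemma measurable_coord i : measurable_fun setT (fun x : borel_rV R d => (x : 'rV[R]_d) ord0 i).
Proof. by apply: continuous_measurable_rV => x; exact: coord_continuous. Qed.

Lemma dot_continuous (w : 'rV[R]_d) : continuous (dot ^~ w).
Proof.
apply: (@continuous_big R _ +%R).
  move=> x; exact: add_continuous.
move=> i _ x.
have h : {for x, continuous (fun y : 'rV[R]_d => y ord0 i)} by exact: coord_continuous.
exact: (cvgM h (cvg_cst (w ord0 i))).
Qed.

Lemma refl_continuous (w : 'rV[R]_d) : continuous (refl w).
Proof.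
move=> x.
have h : {for x, continuous (fun y : 'rV[R]_d => 2 * dot y w / dot w w)}.
  have h1 : {for x, continuous (fun y : 'rV[R]_d => dot y w)} by exact: dot_continuous.
  rewrite (_ : (fun _ => _) = (fun y => dot y w * (2 / dot w w))); last first.
    by apply/funext => y; rewrite mulrAC mulrC mulrA.
  exact: (cvgM h1 (cvg_cst (2 / dot w w))).
exact: (cvgB (@cvg_id _ _) (cvgZr_tmp h)).
Qed.

Lemma measurable_refl (w : 'rV[R]_d) :
  measurable_fun setT (refl w : borel_rV R d -> borel_rV R d).
Proof. by apply: continuous_measurable_rV2; exact: refl_continuous. Qed.

Lemma measurable_enorm : measurable_fun setT (fun x : borel_rV R d => enorm (x : 'rV[R]_d)).
Proof.
apply: (measurableT_comp (f := @Num.sqrt R)).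
  by apply: continuous_measurable_fun; exact: sqrt_continuous.
apply: measurable_sum => i; apply: measurable_funX; exact: measurable_coord.
Qed.

Lemma measurable_usphere : measurable (@usphere R d : set (borel_rV R d)).
Proof.
rewrite -[X in measurable X]setTI; exact: (measurable_enorm measurableT (measurable_set1 1)).
Qed.

End BorelRow.

(** * Coordinates of a uniform vector: symmetry and integration by parts *)

Section SphereLaw.
Context {R : realType} {d : nat} (nu : probability (borel_rV R d) R).
Hypothesis nuE : forall A : set (borel_rV R d), measurable A ->
  nu A = uniform_sphere_measure A.

Lemma nu_refl (w : 'rV[R]_d) (A : set (borel_rV R d)) : measurable A ->
  nu (refl w @^-1` A) = nu A.
Proof.
move=> mA; rewrite !nuE//.
  apply: uniform_sphere_measure_isometry; [exact: reflK| |exact: enorm_refl].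
  by move=> x y; rewrite reflB enorm_refl.
by rewrite -[X in measurable X]setTI; exact: measurable_refl.
Qed.

(* No computation of the Hausdorff measure of the sphere is needed: [nuE] at
   the whole space and at the sphere have the same right-hand side. *)
Lemma nu_usphere : nu (@usphere R d) = 1%E.
Proof.
rewrite nuE; last exact: measurable_usphere.
rewrite -(probability_setT nu) nuE; last exact: measurableT.
by rewrite /uniform_sphere_measure setIid setTI.
Qed.

Lemma nu_usphereC : nu (~` @usphere R d) = 0%E.
Proof.
rewrite probability_setC; last exact: measurable_usphere.
by rewrite nu_usphere subee.
Qed.

Lemma ge0_integral_refl (w : 'rV[R]_d) (f : borel_rV R d -> \bar R) :
  measurable_fun setT f -> (forall x, 0 <= f x)%E ->
  (\int[nu]_x f (refl w x) = \int[nu]_x f x)%E.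
Proof.
move=> mf f0.
have := ge0_integral_pushforward (measurable_refl w) nu measurableT mf (fun x _ => f0 x).
rewrite preimage_setT => h; apply: (etrans (esym h)).
apply: eq_measure_integral => [|mr A mA _]; first exact: measurable_refl.
exact: nu_refl.
Qed.

Lemma Rint_refl (w : 'rV[R]_d) (f : borel_rV R d -> R) : bmeas f ->
  \int[nu]_x f (refl w x) = \int[nu]_x f x.
Proof.
move=> bf; rewrite /Rintegral; congr fine.
have [mf [C fC]] := bf.
have bfr : bmeas (fun x : borel_rV R d => f (refl w x)).
  split; first exact: (measurableT_comp mf (measurable_refl w)).
  by exists C => x.
have := @integral_pushforward _ _ _ _ _ _ (measurable_refl w) nu _ (EFin \o f).
have mfE : measurable_fun setT (EFin \o f) by exact/measurable_EFinP.
move=> /(_ setT mfE); rewrite preimage_setT => /(_ (bmeas_integrable nu bfr) measurableT) h.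
apply: (etrans (esym h)).
apply: eq_measure_integral => [|mr A mA _]; first exact: measurable_refl.
exact: nu_refl.
Qed.

(** The cutoff off the sphere makes -1 <= U <= 1 hold everywhere instead of almost everywhere, as
    the abstract sections require. Reflections preserve the sphere and hence the cutoff. *)
Definition scoord (i : 'I_d) (x : borel_rV R d) : R :=
  (x : 'rV[R]_d) ord0 i * \1_(@usphere R d) x.

Lemma measurable_scoord i : measurable_fun setT (scoord i).
Proof.
have m1 : measurable_fun setT (\1_(@usphere R d) : borel_rV R d -> R).
  by apply/measurable_indicP; exact: measurable_usphere.
exact: (measurable_funM (measurable_coord i) m1).
Qed.

Lemma scoord_sum x : \sum_(i < d) scoord i x ^+ 2 = \1_(@usphere R d) x.
Proof.
case: (boolP (x \in @usphere R d)) => xS.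
  have h : dot (x : 'rV[R]_d) x = 1 by move: xS; rewrite inE usphereE.
  rewrite indicE xS -h; apply: eq_bigr => i _.
  by rewrite /scoord indicE xS mulr1 expr2.
rewrite indicE (negbTE xS); apply: big1 => i _.
by rewrite /scoord indicE (negbTE xS) mulr0 expr0n.
Qed.

Lemma scoord_sum2 i j x : i != j -> scoord i x ^+ 2 + scoord j x ^+ 2 <= 1.
Proof.
move=> ij; apply: (@le_trans _ _ (\1_(@usphere R d) x : R)); last first.
  by rewrite indicE; case: (_ \in _).
rewrite -scoord_sum (bigD1 i)//= (bigD1 j) 1?eq_sym//= addrA lerDl.
by apply: sumr_ge0 => k _; exact: sqr_ge0.
Qed.

Lemma scoord_itv i x : -1 <= scoord i x <= 1.
Proof.
have : scoord i x ^+ 2 <= 1.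
  apply: (@le_trans _ _ (\1_(@usphere R d) x : R)); last first.
    by rewrite indicE; case: (_ \in _).
  rewrite -scoord_sum (bigD1 i)//= lerDl.
  by apply: sumr_ge0 => k _; exact: sqr_ge0.
by move: (scoord i x) => u; nra.
Qed.

Lemma bmeas_scoord i : bmeas (scoord i).
Proof.
split; first exact: measurable_scoord.
by exists 1 => x; rewrite ler_norml scoord_itv.
Qed.

Lemma scoord_refl w i x : scoord i (refl w x) = refl w x ord0 i * \1_(@usphere R d) x.
Proof.
rewrite /scoord; congr (_ * _); rewrite !indicE; congr (nat_of_bool _)%:R.
by apply/idP/idP; rewrite !inE /usphere /= enorm_refl.
Qed.

Lemma Rint_usphere f : bmeas f ->
  \int[nu]_x (f x * \1_(@usphere R d) x) = \int[nu]_x f x.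
Proof.
move=> [mf _]; rewrite /Rintegral; congr fine.
apply: ae_eq_integral => //.
- have m1 : measurable_fun setT (\1_(@usphere R d) : borel_rV R d -> R).
    by apply/measurable_indicP; exact: measurable_usphere.
  by apply/measurable_EFinP; exact: (measurable_funM mf m1).
- exact/measurable_EFinP.
exists (~` @usphere R d); split.
- by apply: measurableC; exact: measurable_usphere.
- exact: nu_usphereC.
move=> x /= h xS; apply: h => _.
by rewrite indicE mem_set// mulr1.
Qed.

Definition evec (i : 'I_d) : 'rV[R]_d := delta_mx ord0 i.

Lemma evecE i k : evec i ord0 k = (k == i)%:R.
Proof. by rewrite mxE eqxx. Qed.

Lemma dot_evec x i : dot x (evec i) = x ord0 i.
Proof.
rewrite /dot (bigD1 i)//= evecE eqxx mulr1 big1 ?addr0// => k ki.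
by rewrite evecE (negbTE ki) mulr0.
Qed.

Lemma refl_evec x i k : refl (evec i) x ord0 k = if k == i then - x ord0 i else x ord0 k.
Proof.
rewrite /refl dot_evec dot_evec !mxE !eqxx/=.
by case: eqP => [->|_]; rewrite /=; field.
Qed.

Lemma Rint_flip (i : 'I_d) (g : R -> R) : tame1 g ->
  \int[nu]_x g (scoord i x) = \int[nu]_x g (- scoord i x).
Proof.
move=> [mg [C gC]].
have b : bmeas (fun x => g (scoord i x)).
  split; first exact: (measurableT_comp mg (measurable_scoord i)).
  by exists C => x; apply: gC; exact: scoord_itv.
rewrite -(Rint_refl (evec i) b); apply: eq_Rintegral => x _.
by rewrite scoord_refl refl_evec eqxx mulNr.
Qed.

Lemma Rint_flip_odd (i j : 'I_d) (g : R -> R) : i != j -> tame1 g ->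
  \int[nu]_x (scoord j x * g (scoord i x)) = 0.
Proof.
move=> ij [mg [C gC]].
have b : bmeas (fun x => scoord j x * g (scoord i x)).
  apply: bmeasM; first exact: bmeas_scoord.
  split; first exact: (measurableT_comp mg (measurable_scoord i)).
  by exists C => x; apply: gC; exact: scoord_itv.
have := Rint_refl (evec j) b.
have -> : \int[nu]_x (scoord j (refl (evec j) x) * g (scoord i (refl (evec j) x))) =
    \int[nu]_x ((- 1) * (scoord j x * g (scoord i x))).
  apply: eq_Rintegral => x _.
  by rewrite !scoord_refl !refl_evec eqxx (negbTE ij) /scoord; ring.
rewrite RintZ//; move: (Rintegral _ _ _) => I eI; lra.
Qed.

Section Rotation.
Variables (i j : 'I_d) (t : R).
Hypothesis ij : i != j.

(* [refl w] maps the plane of [i] and [j] to itself with the matrix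
   [[cos t, sin t], [sin t, - cos t]]. *)
Let w : 'rV[R]_d := cos (t / 2) *: evec j - sin (t / 2) *: evec i.

Let dotw : dot w w = 1.
Proof.
rewrite /w !(dotBr, dotZr) !dot_evec !mxE !eqxx/= (negbTE ij) eq_sym (negbTE ij)/=.
by rewrite !mulr0 !mulr1 subr0 sub0r mulrN opprK -!expr2 cos2Dsin2.
Qed.

Let cosE : cos t = 1 - 2 * sin (t / 2) ^+ 2.
Proof.
rewrite [in LHS](_ : t = t / 2 + t / 2); last by field.
by have := cos2Dsin2 (t / 2); rewrite cosD -!expr2; lra.
Qed.

Let sinE : sin t = 2 * sin (t / 2) * cos (t / 2).
Proof.
rewrite [in LHS](_ : t = t / 2 + t / 2); last by field.
by rewrite sinD; ring.
Qed.

Lemma refl_rot_fst x : refl w x ord0 i = cos t * x ord0 i + sin t * x ord0 j.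
Proof.
rewrite /refl dotw /w dotBr !dotZr !dot_evec invr1 mulr1 !mxE !eqxx (negbTE ij)/=.
by rewrite cosE sinE; ring.
Qed.

Lemma refl_rot_snd x : refl w x ord0 j = sin t * x ord0 i - cos t * x ord0 j.
Proof.
rewrite /refl dotw /w dotBr !dotZr !dot_evec invr1 mulr1 !mxE !eqxx eq_sym (negbTE ij)/=.
rewrite cosE sinE; have -> : sin (t / 2) ^+ 2 = 1 - cos (t / 2) ^+ 2.
  by have := cos2Dsin2 (t / 2); lra.
by ring.
Qed.

(** [Rint_flip_odd] transported by a reflection to the angle t: a quantity constant in t, ready to
    be differentiated. *)
Lemma Rint_rot (g : R -> R) : tame1 g ->
  \int[nu]_x ((sin t * scoord i x - cos t * scoord j x) *
              g (cos t * scoord i x + sin t * scoord j x)) = 0.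
Proof.
move=> tg; have [mg [C gC]] := tg.
have b : bmeas (fun x => scoord j x * g (scoord i x)).
  apply: bmeasM; first exact: bmeas_scoord.
  split; first exact: (measurableT_comp mg (measurable_scoord i)).
  by exists C => x; apply: gC; exact: scoord_itv.
rewrite -(Rint_flip_odd ij tg) -(Rint_refl w b); apply: eq_Rintegral => x _.
rewrite !scoord_refl refl_rot_fst refl_rot_snd /scoord.
by congr (_ * g _); ring.
Qed.

End Rotation.

Lemma rot_itv (i j : 'I_d) t x : i != j ->
  -1 <= cos t * scoord i x + sin t * scoord j x <= 1.
Proof.
move=> ij; have := scoord_sum2 x ij; have := cos2Dsin2 t.
move: (cos t) (sin t) (scoord i x) (scoord j x) => c s a b cs ab.
have : (c * a + s * b) ^+ 2 <= 1.
  have -> : (c * a + s * b) ^+ 2 =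
    (c ^+ 2 + s ^+ 2) * (a ^+ 2 + b ^+ 2) - (c * b - s * a) ^+ 2 by ring.
  by rewrite cs mul1r; have := sqr_ge0 (c * b - s * a); lra.
by move: (c * a + s * b) => u; nra.
Qed.

(** This is the derivative of [Rint_rot] at t = 0. By [rot_itv] the rotated coordinate stays in
    [-1, 1], where g is bounded and differentiable. *)
Lemma Rint_parts_coord (i j : 'I_d) (g g1 : R -> R) : i != j -> tame1 g -> tame1 g1 ->
  (forall u : R, -1 <= u <= 1 -> is_derive u 1 g (g1 u)) ->
  \int[nu]_x (scoord i x * g (scoord i x)) =
  \int[nu]_x (scoord j x ^+ 2 * g1 (scoord i x)).
Proof.
move=> ij tg tg1 dg; have [mg [C gC]] := tg; have [mg1 [D g1D]] := tg1.
have bc k := bmeas_scoord k.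
have bb (h : R -> R) t : tame1 h -> bmeas (fun x => h (cos t * scoord i x + sin t * scoord j x)).
  move=> [mh [E hE]]; split; last by exists E => x; apply: hE; exact: rot_itv.
  apply: (measurableT_comp mh).
  by have [] := bmeasD (bmeasZ (cos t) (bc i)) (bmeasZ (sin t) (bc j)).
pose F t x := (sin t * scoord i x - cos t * scoord j x) *
              g (cos t * scoord i x + sin t * scoord j x).
pose F1 t x := (cos t * scoord i x + sin t * scoord j x) *
                g (cos t * scoord i x + sin t * scoord j x) +
              (sin t * scoord i x - cos t * scoord j x) *
                (g1 (cos t * scoord i x + sin t * scoord j x) *
                 (- sin t * scoord i x + cos t * scoord j x)).
have bF t : bmeas (F t).
  apply: bmeasM (bb g t tg).
  exact: (bmeasB (bmeasZ (sin t) (bc i)) (bmeasZ (cos t) (bc j))).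
have dF (t : R) x : is_derive t 1 (F ^~ x) (F1 t x).
  have h1 : is_derive t 1 (fun t => sin t * scoord i x - cos t * scoord j x)
      (cos t * scoord i x + sin t * scoord j x).
    by apply: is_derive_eq; rewrite /GRing.scale /=; ring.
  have h2 : is_derive t 1 (fun t => cos t * scoord i x + sin t * scoord j x)
      (- sin t * scoord i x + cos t * scoord j x).
    by apply: is_derive_eq; rewrite /GRing.scale /=; ring.
  exact: (is_deriveMx h1 (is_derive_compx (f := g)
    (g := fun t => cos t * scoord i x + sin t * scoord j x) (x := t)
    (dg _ (rot_itv t x ij)) h2)).
have le2 (c k a b : R) : `|c| <= 1 -> `|k| <= 1 -> `|a| <= 1 -> `|b| <= 1 ->
    `|c * a + k * b| <= 2.
  move=> c1 k1 a1 b1; rewrite (le_trans (ler_normD _ _))// !normrM.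
  by apply: lerD; rewrite -[leRHS]mulr1 ler_pM.
have s1 k x : `|scoord k x| <= 1 by rewrite ler_norml scoord_itv.
have sn1 t : `|sin t| <= 1 by rewrite ler_norml sin_geN1 sin_le1.
have cs1 t : `|cos t| <= 1 by rewrite ler_norml cos_geN1 cos_le1.
have F1C t x : `|F1 t x| <= 2 * C + 2 * (D * 2).
  rewrite /F1 (le_trans (ler_normD _ _))// !normrM.
  apply: lerD; first by apply: ler_pM => //; [exact: le2|apply: gC; exact: rot_itv].
  apply: ler_pM => //; first by rewrite -mulNr; apply: le2 => //; rewrite normrN.
  apply: ler_pM => //; first by apply: g1D; exact: rot_itv.
  by apply: le2 => //; rewrite normrN.
have := @is_derive_Rint _ _ _ nu F F1 0 _ bF (fun t x _ => dF t x) (fun t x _ => F1C t x).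
rewrite (_ : (fun t => \int[nu]_x F t x) = cst 0); last first.
  by apply/funext => t; exact: Rint_rot.
move=> [_]; rewrite derive_cst => /esym.
have bg (h : R -> R) : tame1 h -> bmeas (fun x => h (scoord i x)).
  move=> [mh [E hE]]; split; last by exists E => x; apply: hE; exact: scoord_itv.
  exact: (measurableT_comp mh (measurable_scoord i)).
have bi : bmeas (fun x => scoord i x * g (scoord i x)) by apply: bmeasM => //; exact: bg.
have bj : bmeas (fun x => scoord j x ^+ 2 * g1 (scoord i x)).
  by apply: bmeasM; [exact: bmeasX|exact: bg].
have -> : \int[nu]_x F1 0 x = \int[nu]_x (scoord i x * g (scoord i x)) -
    \int[nu]_x (scoord j x ^+ 2 * g1 (scoord i x)).
  rewrite -RintB//; apply: eq_Rintegral => x _.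
  by rewrite /F1 cos0 sin0 !mul1r !mul0r addr0 oppr0 mul0r !add0r; ring.
by move=> /eqP; rewrite subr_eq0 => /eqP.
Qed.

(** Summing [Rint_parts_coord] over the d - 1 indices j <> i, since the squares of those coordinates
    add up to 1 - U^2 on the sphere. *)
Lemma Rint_parts (i : 'I_d) (g g1 : R -> R) : tame1 g -> tame1 g1 ->
  (forall u : R, -1 <= u <= 1 -> is_derive u 1 g (g1 u)) ->
  (d%:R - 1) * \int[nu]_x (scoord i x * g (scoord i x)) =
  \int[nu]_x ((1 - scoord i x ^+ 2) * g1 (scoord i x)).
Proof.
move=> tg tg1 dg.
have bg1 : bmeas (fun x => g1 (scoord i x)).
  have [mh [E hE]] := tg1; split; last by exists E => x; apply: hE; exact: scoord_itv.
  exact: (measurableT_comp mh (measurable_scoord i)).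
have bs : bmeas (fun x => 1 - scoord i x ^+ 2).
  by apply: bmeasB; [exact: bmeas_cst|apply: bmeasX; exact: bmeas_scoord].
have bj j : bmeas (fun x => scoord j x ^+ 2 * g1 (scoord i x)).
  by apply: bmeasM => //; apply: bmeasX; exact: bmeas_scoord.
(* Off the sphere the cut-off coordinates vanish while 1 - U^2 is 1; inserting the indicator makes
   the integrands agree everywhere. *)
rewrite -(Rint_usphere (bmeasM bs bg1)).
transitivity (\int[nu]_x (\sum_(j < d | j != i) (scoord j x ^+ 2 * g1 (scoord i x)))).
  rewrite Rint_sum//.
  transitivity (\sum_(j < d | j != i) \int[nu]_x (scoord i x * g (scoord i x))); last first.
    by apply: eq_bigr => j ji; apply: Rint_parts_coord => //; rewrite eq_sym.
  rewrite big_const iter_addr_0.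
  have -> : #|[pred j | j != i]| = d.-1 by rewrite cardC1 card_ord.
  have d0 : (0 < d)%N by exact: leq_ltn_trans (ltn_ord i).
  by rewrite -[RHS]mulr_natl -subn1 natrB.
apply: eq_Rintegral => x _; rewrite -mulr_suml.
have := scoord_sum x; rewrite (bigD1 i)//= => h.
have -> : \sum_(j < d | j != i) scoord j x ^+ 2 = \1_(@usphere R d) x - scoord i x ^+ 2.
  by rewrite -h [RHS]addrAC subrr add0r.
rewrite /scoord !indicE; case: (_ \in _) => /=; ring.
Qed.

End SphereLaw.

(** * Conditioning on the other summands *)

Section Resampling.
Context {R : realType} {disp disp' : measure_display}
  {Omega : measurableType disp} {T : measurableType disp'}
  {P : probability Omega R} (xi : nat -> {RV P >-> T}).
Hypothesis xi_indep : independent_RVs xi.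
Variable i : nat.

(** A pi-system on which independence from [xi i] is immediate; uniqueness of measures extends it to
    the generated sigma-algebra. *)
Definition cyl : set (set Omega) := [set E | exists (J : {fset nat}) (B : nat -> set T),
  [/\ forall j, measurable (B j), i \notin J &
      E = \bigcap_(j in [set` J]) (xi j @^-1` B j)]].

(* [Omega] with the sigma-algebra generated by the [xi j], [j <> i]. *)
Definition Omega_cyl : measurableType _ := g_sigma_algebraType cyl.

Let cyl_setI : setI_closed cyl.
Proof.
move=> _ _ [J1 [B1 [mB1 iJ1 ->]]] [J2 [B2 [mB2 iJ2 ->]]].
exists (J1 `|` J2)%fset, (fun j => (if j \in J1 then B1 j else setT) `&`
  (if j \in J2 then B2 j else setT)); split.
- by move=> j; apply: measurableI; case: ifP.
- by rewrite in_fsetU negb_or iJ1.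
apply/seteqP; split => w /=.
  move=> [h1 h2] j _; split; case: ifPn => // jJ; [exact: h1|exact: h2].
move=> h; split => j jJ.
  by have := h j; rewrite /= in_fsetU jJ /= => /(_ isT) [].
by have := h j; rewrite /= in_fsetU jJ orbT /= => /(_ isT) [].
Qed.

Let cylT : cyl setT.
Proof.
exists fset0, (fun=> setT); split => //.
by apply/seteqP; split => w //= _ j; rewrite in_fset0.
Qed.

Lemma measurable_cyl (E : set Omega) :
  measurable (E : set Omega_cyl) -> measurable E.
Proof.
apply: smallest_sub; first exact: sigma_algebra_measurable.
move=> _ [J [B [mB _ ->]]].
apply: fin_bigcap_measurable; first exact: finite_fset.
by move=> j _; rewrite -[X in measurable X]setTI; exact: (measurable_funP (xi j)).
Qed.

Lemma measurable_xi_cyl j : j != i ->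
  measurable_fun setT (fun w : Omega_cyl => xi j w).
Proof.
move=> ji _ B mB; rewrite setTI; apply: sub_sigma_algebra.
exists [fset j]%fset, (fun=> B); split => //.
  by rewrite in_fset1 eq_sym.
apply/seteqP; split => w /=; first by move=> wB k /=; rewrite in_fset1 => /eqP ->.
by move=> /(_ j); rewrite /= in_fset1 eqxx => /(_ isT).
Qed.

Lemma measurable_id_cyl : measurable_fun setT (fun w : Omega => w : Omega_cyl).
Proof. by move=> _ E mE; rewrite setTI; exact: measurable_cyl. Qed.

Let idc := isMeasurableFun.Build _ _ _ _ _ measurable_id_cyl.
Let id_cyl : {mfun Omega >-> Omega_cyl} := HB.pack (fun w : Omega => w : Omega_cyl) idc.

Let indep_cyl A E : measurable A -> cyl E ->
  P (xi i @^-1` A `&` E) = (P (xi i @^-1` A) * P E)%E.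
Proof.
move=> mA [J [B [mB iJ ->]]].
have h1 := xi_indep J mB.
pose B' j := if j == i then A else B j.
have mB' j : measurable (B' j) by rewrite /B'; case: ifP.
have h2 := xi_indep (i |` J)%fset mB'.
rewrite (big_fsetU1 _ _ iJ) in h2.
have -> : xi i @^-1` A `&` \bigcap_(j in [set` J]) (xi j @^-1` B j) =
    \bigcap_(j in [set` (i |` J)%fset]) (xi j @^-1` B' j).
  apply/seteqP; split => w /=.
    move=> [wA wB] j /=; rewrite in_fset1U /B' /preimage /=; case: eqP => [->//|_ /= jJ].
    exact: wB.
  move=> h; split.
    by have := h i; rewrite /= in_fset1U eqxx /B' /preimage /= eqxx; exact.
  move=> j /= jJ; have := h j; rewrite /= in_fset1U jJ orbT /B' /preimage /=.
  by case: eqP jJ => [->|_ _]; [rewrite (negbTE iJ)|exact].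
rewrite h2 h1 {1}/B' eqxx; congr (_ * _)%E.
apply: eq_big_seq => j jJ; rewrite /B'; case: eqP => // ji.
by rewrite ji (negbTE iJ) in jJ.
Qed.

Lemma indep_Omega_cyl A (E : set Omega_cyl) : measurable A -> measurable E ->
  P (xi i @^-1` A `&` E) = (P (xi i @^-1` A) * P E)%E.
Proof.
move=> mA mE.
have mXA : measurable (xi i @^-1` A).
  by rewrite -[X in measurable X]setTI; exact: (measurable_funP (xi i)).
have fXA : P (xi i @^-1` A) \is a fin_num by exact: fin_num_measure.
pose r := NngNum (fine_ge0 (measure_ge0 P (xi i @^-1` A))).
have rE : (r%:num%:E = P (xi i @^-1` A))%E by rewrite /= fineK.
pose m1 := pushforward (mrestr P mXA) id_cyl.
pose m2 := mscale r (distribution P id_cyl).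
have e : m1 E = m2 E.
  apply: (@measure_unique _ R Omega_cyl cyl (fun=> setT)) => //.
  - exact: bigcup_const.
  - move=> F cF; change (P (F `&` xi i @^-1` A) = r%:num%:E * P F)%E.
    by rewrite rE setIC indep_cyl.
  - move=> _; change (P (setT `&` xi i @^-1` A) < +oo)%E.
    by rewrite setTI ltey_eq fXA.
move: e; change (P (E `&` xi i @^-1` A) = r%:num%:E * P E ->
  P (xi i @^-1` A `&` E) = P (xi i @^-1` A) * P E)%E.
by rewrite rE setIC.
Qed.

(** The pair of [xi i] and the identity, valued in T times [Omega_cyl], has a product law, so
    Tonelli applies. The point w seen through the coarser sigma-algebra stands for all other [xi j]
    at once. *)
Lemma integral_resample (F : T * Omega_cyl -> \bar R) :
  measurable_fun setT F -> (forall z, 0 <= F z)%E ->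
  (\int[P]_w F (xi i w, w) = \int[P]_w \int[distribution P (xi i)]_x F (x, w))%E.
Proof.
move=> mF F0.
have mZ : measurable_fun setT (fun w : Omega => (xi i w, w : Omega_cyl)).
  by apply: measurable_fun_pair; [exact: measurable_funP|exact: measurable_id_cyl].
pose Zm := isMeasurableFun.Build _ _ _ _ _ mZ.
pose Z : {mfun Omega >-> (T * Omega_cyl)%type} :=
  HB.pack (fun w : Omega => (xi i w, w : Omega_cyl)) Zm.
have -> : (\int[P]_w F (xi i w, w) = \int[distribution P Z]_z F z)%E.
  by rewrite ge0_integral_distribution.
have -> : (\int[distribution P Z]_z F z =
    \int[distribution P (xi i) \x distribution P id_cyl]_z F z)%E.
  apply: eq_measure_integral => A mA _.
  apply/esym/product_measure_unique => // B E mB mE.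
  by rewrite /= /distribution /pushforward /= -indep_Omega_cyl.
rewrite (fubini_tonelli2 F mF F0) ge0_integral_distribution//.
  exact: measurable_fun_fubini_tonelli_G.
by move=> y; exact: integral_ge0.
Qed.

End Resampling.

Lemma measurable_dot (R : realType) (d : nat) (dS : measure_display)
    (S : measurableType dS) (X Y : S -> 'rV[R]_d) :
  (forall i, measurable_fun setT (fun s => X s ord0 i)) ->
  (forall i, measurable_fun setT (fun s => Y s ord0 i)) ->
  measurable_fun setT (fun s => dot (X s) (Y s)).
Proof.
move=> mX mY; apply: measurable_sum => i; exact: measurable_funM.
Qed.

(** * Integrating out one summand *)

Section SphereResampling.
Context {R : realType} {d : nat} {disp : measure_display}
  {Omega : measurableType disp} {P : probability Omega R}
  (xi : nat -> {RV P >-> borel_rV R d}) (i0 : 'I_d).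
Hypothesis d2 : (2 <= d)%N.
Hypothesis xi_indep : independent_RVs xi.
Hypothesis xi_unif : forall j : nat, uniform_on_sphere (xi j).

Let nu : probability (borel_rV R d) R := distribution P (xi 0%N).
Let nuE (A : set (borel_rV R d)) : measurable A -> nu A = uniform_sphere_measure A.
Proof. exact: xi_unif. Qed.

Let U := scoord i0 : borel_rV R d -> R.
Let mU : measurable_fun setT U. Proof. exact: measurable_scoord. Qed.

Let ge0_integral_sphere (f g : borel_rV R d -> \bar R) :
  measurable_fun setT f -> measurable_fun setT g ->
  (forall x, 0 <= f x)%E -> (forall x, 0 <= g x)%E ->
  (forall x, @usphere R d x -> f x = g x) ->
  (\int[nu]_x f x = \int[nu]_x g x)%E.
Proof.
move=> mf mg f0 g0 fg; apply: ge0_ae_eq_integral => //.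
exists (~` @usphere R d); split.
- by apply: measurableC; exact: measurable_usphere.
- exact: nu_usphereC.
by move=> x /= h xS; apply: h => _; exact: fg.
Qed.

(** On the sphere |b x + Y|^2 = b^2 + |Y|^2 + 2 (x, b Y). The reflection exchanging b Y with the
    vector of the same norm along coordinate [i0] replaces the inner product by |b| |Y| U. *)
Lemma integral_sphere_shift (b : R) (Y : 'rV[R]_d) (f : R -> \bar R) :
  measurable_fun setT f -> (forall x, 0 <= f x)%E ->
  (\int[nu]_x f (dot (b *: (x : 'rV[R]_d) + Y) (b *: (x : 'rV[R]_d) + Y)) =
   \int[nu]_x f (sqn (Num.sqrt (dot Y Y)) `|b| (U x)))%E.
Proof.
move=> mf f0.
pose v := b *: Y; pose v' : 'rV[R]_d := (`|b| * Num.sqrt (dot Y Y)) *: evec i0.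
have vv' : dot v v = dot v' v'.
  rewrite /v /v' !(dotZl, dotZr) dot_evec evecE eqxx mulr1 -!expr2.
  rewrite mulrA -expr2 exprMn real_normK ?num_real// sqr_sqrtr ?dot_ge0//.
pose g (x : borel_rV R d) := f (b ^+ 2 + dot Y Y + 2 * dot (x : 'rV[R]_d) v).
have mg : measurable_fun setT g.
  apply: (measurableT_comp mf); apply: measurable_funD; first exact: measurable_cst.
  apply: measurable_funM; first exact: measurable_cst.
  by apply: continuous_measurable_rV; exact: dot_continuous.
transitivity (\int[nu]_x g x)%E.
  apply: ge0_integral_sphere => //.
    apply: (measurableT_comp mf); apply: measurable_dot => i.
      under eq_fun do rewrite !mxE.
      apply: measurable_funD; last exact: measurable_cst.
      by apply: measurable_funM; [exact: measurable_cst|exact: measurable_coord].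
    under eq_fun do rewrite !mxE.
    apply: measurable_funD; last exact: measurable_cst.
    by apply: measurable_funM; [exact: measurable_cst|exact: measurable_coord].
    by move=> x; exact: f0.
  move=> x; rewrite usphereE => x1; rewrite /g; congr f.
  by rewrite /v !(dotDl, dotDr, dotZl, dotZr) x1 (dotC Y); ring.
rewrite -(ge0_integral_refl nuE (v - v') mg); last by move=> x; exact: f0.
apply: ge0_integral_sphere => //.
- exact: (measurableT_comp mg (measurable_refl _)).
- apply: (measurableT_comp mf); apply: measurable_funD; first exact: measurable_cst.
  by apply: measurable_funM; [exact: measurable_cst|exact: mU].
- by move=> x; exact: f0.
move=> x xS; rewrite /g; congr f.
rewrite dot_reflC refl_swap// /v' dotZr dot_evec /sqn /U /scoord.
rewrite indicE mem_set// mulr1 sqr_sqrtr ?dot_ge0// real_normK ?num_real//; ring.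
Qed.

(* [rkernel r f B] is the average of [f (|r theta + y|^2)] for [theta] uniform
   on the sphere and any [y] with [|y|^2 = B]. *)
Definition rkernel (r : R) (f : R -> \bar R) (B : R) : \bar R :=
  (\int[nu]_x f (sqn (Num.sqrt B) r (U x)))%E.

Lemma rkernel_ge0 r f B : (forall x, 0 <= f x)%E -> (0 <= rkernel r f B)%E.
Proof. by move=> f0; apply: integral_ge0. Qed.

Lemma measurable_rkernel r f : measurable_fun setT f -> (forall x, 0 <= f x)%E ->
  measurable_fun setT (rkernel r f).
Proof.
move=> mf f0.
pose F (z : borel_rV R d * R) := f (sqn (Num.sqrt z.2) r (U z.1)).
have mF : measurable_fun setT F.
  apply: (measurableT_comp mf).
  have ms : measurable_fun setT (fun z : borel_rV R d * R => Num.sqrt z.2).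
    apply: (measurableT_comp _ measurable_snd).
    by apply: continuous_measurable_fun; exact: sqrt_continuous.
  apply: measurable_funD.
    by apply: measurable_funD; [exact: measurable_funX|exact: measurable_cst].
  apply: measurable_funM; last exact: (measurableT_comp mU measurable_fst).
  apply: measurable_funM; first exact: measurable_cst.
  by apply: measurable_funM => //; exact: measurable_cst.
by have := measurable_fun_fubini_tonelli_G (m1 := nu) F mF (fun z => f0 _).
Qed.

Definition wsum (b : nat -> R) (L : seq nat) (w : Omega) : 'rV[R]_d :=
  \sum_(l <- L) b l *: (xi l w : 'rV[R]_d).

Lemma wsum_cons b l L w : wsum b (l :: L) w = b l *: (xi l w : 'rV[R]_d) + wsum b L w.
Proof. by rewrite /wsum big_cons. Qed.

Lemma wsumE b L w k : wsum b L w ord0 k = \sum_(l <- L) b l * (xi l w : 'rV[R]_d) ord0 k.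
Proof. by rewrite /wsum summxE; apply: eq_bigr => l _; rewrite mxE. Qed.

Lemma measurable_wsum b L k : measurable_fun setT (fun w => wsum b L w ord0 k).
Proof.
under eq_fun do rewrite wsumE.
apply: measurable_sum => l; apply: measurable_funM; first exact: measurable_cst.
exact: (measurableT_comp (measurable_coord k) (measurable_funP (xi l))).
Qed.

Lemma measurable_wsum_sqr b L : measurable_fun setT (fun w => dot (wsum b L w) (wsum b L w)).
Proof. by apply: measurable_dot => k; exact: measurable_wsum. Qed.

(** [integral_resample] freezes the sum over [L], and [integral_sphere_shift] keeps only its
    norm. *)
Lemma resample b i L f : i \notin L -> measurable_fun setT f -> (forall x, 0 <= f x)%E ->
  (\int[P]_w f (dot (wsum b (i :: L) w) (wsum b (i :: L) w)) =
   \int[P]_w rkernel `|b i| f (dot (wsum b L w) (wsum b L w)))%E.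
Proof.
move=> iL mf f0.
pose V (z : borel_rV R d * Omega_cyl xi i) : 'rV[R]_d :=
  b i *: (z.1 : 'rV[R]_d) + wsum b L z.2.
have mV k : measurable_fun setT (fun z => V z ord0 k).
  (* [xi i] need not be measurable on [Omega_cyl]. As i is not in [L], a term of index i may be set
     to 0 without changing the sum. *)
  rewrite (_ : (fun _ => _) = fun z => b i * (z.1 : 'rV[R]_d) ord0 k +
    \sum_(l <- L) (if l == i then 0 else b l * (xi l z.2 : 'rV[R]_d) ord0 k)); last first.
    apply/funext => z; rewrite /V !mxE wsumE; congr (_ + _).
    apply: eq_big_seq => l lL; case: eqP => // li.
    by rewrite li (negbTE iL) in lL.
  apply: measurable_funD.
    apply: measurable_funM; first exact: measurable_cst.
    exact: (measurableT_comp (measurable_coord k) measurable_fst).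
  apply: measurable_sum => l; case: (eqVneq l i) => [_|li]; first exact: measurable_cst.
  apply: measurable_funM; first exact: measurable_cst.
  apply: (measurableT_comp (measurable_coord k)).
  exact: (measurableT_comp (measurable_xi_cyl li) measurable_snd).
pose F z := f (dot (V z) (V z)).
have mF : measurable_fun setT F by apply: (measurableT_comp mf); exact: measurable_dot.
transitivity (\int[P]_w F (xi i w, w))%E.
  by apply: eq_integral => w _; rewrite /F /V wsum_cons.
rewrite (integral_resample xi_indep mF); last by move=> z; exact: f0.
apply: eq_integral => w _; rewrite /F /V /= /rkernel.
rewrite -(integral_sphere_shift (b i) (wsum b L w) mf f0).
apply: eq_measure_integral => A mA _.
exact: (etrans (xi_unif i mA) (esym (xi_unif 0 mA))).
Qed.

Lemma integral_wsum0 b f : (\int[P]_w f (dot (wsum b [::] w) (wsum b [::] w)) = f 0%R)%E.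
Proof.
rewrite (_ : (fun w => _) = cst (f 0)); last first.
  apply/funext => w; rewrite /wsum big_nil /dot big1// => i _.
  by rewrite mxE mul0r.
rewrite integral_cst//.
rewrite -[RHS]mule1; congr (_ * _)%E; exact: probability_setT.
Qed.

Lemma rkernel0 r f : rkernel r f 0 = f (r ^+ 2).
Proof.
rewrite /rkernel sqrtr0 (_ : (fun x => _) = cst (f (r ^+ 2))); last first.
  by apply/funext => x; rewrite /sqn; congr f; ring.
rewrite integral_cst//.
rewrite -[RHS]mule1; congr (_ * _)%E; exact: probability_setT.
Qed.

(* Integrating [f (|a theta_0 + b theta_1 + c theta_2|^2)] in two orders. *)
Lemma rkernel_assoc (a b c : R) f : measurable_fun setT f -> (forall x, 0 <= f x)%E ->
  rkernel `|b| (rkernel `|a| f) (c ^+ 2) =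
  (\int[nu]_x rkernel `|c| f (sqn `|b| `|a| (U x)))%E.
Proof.
move=> mf f0.
pose h (l : nat) := if l == 0%N then a else if l == 1%N then b else c.
have mk r := measurable_rkernel r mf f0; have k0 r B := rkernel_ge0 r B f0.
have E1 : (\int[P]_w f (dot (wsum h [:: 0; 1; 2]%N w) (wsum h [:: 0; 1; 2]%N w)) =
    rkernel `|b| (rkernel `|a| f) (c ^+ 2))%E.
  rewrite (@resample h 0 [:: 1; 2]%N f isT mf f0).
  rewrite (@resample h 1 [:: 2]%N _ isT (mk _) (k0 _)).
  have mkk := measurable_rkernel `|h 1%N| (mk `|h 0%N|) (k0 _).
  rewrite (@resample h 2 [::] _ isT mkk (fun B => rkernel_ge0 _ B (k0 _))).
  by rewrite integral_wsum0 rkernel0 real_normK ?num_real.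
have E2 : (\int[P]_w f (dot (wsum h [:: 2; 0; 1]%N w) (wsum h [:: 2; 0; 1]%N w)) =
    \int[nu]_x rkernel `|c| f (sqn `|b| `|a| (U x)))%E.
  rewrite (@resample h 2 [:: 0; 1]%N f isT mf f0).
  rewrite (@resample h 0 [:: 1]%N _ isT (mk _) (k0 _)).
  have mkk := measurable_rkernel `|h 0%N| (mk `|h 2%N|) (k0 _).
  rewrite (@resample h 1 [::] _ isT mkk (fun B => rkernel_ge0 _ B (k0 _))).
  rewrite integral_wsum0 [LHS]rkernel0; apply: eq_integral => x _.
  by rewrite (sqrtr_sqr `|h 1%N|) normr_id.
rewrite -E1 -E2; apply: eq_integral => w _; rewrite !wsum_cons /wsum big_nil !addr0.
have -> : h 2 *: (xi 2 w : 'rV[R]_d) + (h 0%N *: (xi 0 w : 'rV[R]_d) + h 1 *: (xi 1 w : 'rV[R]_d)) =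
  h 0%N *: (xi 0 w : 'rV[R]_d) + (h 1 *: (xi 1 w : 'rV[R]_d) + h 2 *: (xi 2 w : 'rV[R]_d)).
  by rewrite addrC -addrA.
by [].
Qed.

End SphereResampling.

Lemma lee_of_eq (R : realType) (x y : \bar R) : x = y -> (x <= y)%E.
Proof. by move->. Qed.

(** * Integrating out a pair of summands *)

Section TwoSummands.
Context {R : realType} {d : nat} {disp : measure_display}
  {Omega : measurableType disp} {P : probability Omega R}
  (xi : nat -> {RV P >-> borel_rV R d}) (i0 : 'I_d).
Hypothesis d2 : (2 <= d)%N.
Hypothesis xi_indep : independent_RVs xi.
Hypothesis xi_unif : forall j : nat, uniform_on_sphere (xi j).

Let nu : probability (borel_rV R d) R := distribution P (xi 0%N).
Let nuE (A : set (borel_rV R d)) : measurable A -> nu A = uniform_sphere_measure A.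
Proof. exact: xi_unif. Qed.
Let U := scoord i0 : borel_rV R d -> R.
Let mU : measurable_fun setT U. Proof. exact: measurable_scoord. Qed.
Let U1 x : -1 <= U x <= 1. Proof. exact: scoord_itv. Qed.
Let symU g : tame1 g -> \int[nu]_x g (U x) = \int[nu]_x g (- U x).
Proof. exact: (Rint_flip nuE). Qed.
Let partsU (g g1 : R -> R) : tame1 g -> tame1 g1 ->
  (forall u : R, -1 <= u <= 1 -> is_derive u 1 g (g1 u)) ->
  (d%:R - 1) * \int[nu]_x (U x * g (U x)) =
  \int[nu]_x ((1 - U x ^+ 2) * g1 (U x)).
Proof. exact: (Rint_parts nuE). Qed.

Local Notation rk := (rkernel xi i0).
Local Notation ws := (wsum xi).
Definition wnorm (b : nat -> R) (L : seq nat) (w : Omega) : R :=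
  dot (wsum xi b L w) (wsum xi b L w).

Lemma wnorm_ge0 b L w : 0 <= wnorm b L w. Proof. exact: dot_ge0. Qed.

Lemma measurable_wnorm b L : measurable_fun setT (wnorm b L).
Proof. exact: measurable_wsum_sqr. Qed.

Lemma measurable_wnorm_comp b L (f : R -> \bar R) : measurable_fun setT f ->
  measurable_fun setT (fun w => f (wnorm b L w)).
Proof. by move=> mf; apply: (measurableT_comp mf); exact: measurable_wnorm. Qed.

Lemma integral_prob_cst (c : R) : (\int[P]_w c%:E)%E = c%:E.
Proof.
have := integral_cst P (@measurableT _ Omega) c%:E; rewrite /cst => ->.
by rewrite -[RHS]mule1; congr (_ * _)%E; exact: probability_setT.
Qed.

Lemma EFin_Rint (f : borel_rV R d -> R) : bmeas f ->
  (\int[nu]_x (f x)%:E)%E = (\int[nu]_x f x)%:E.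
Proof.
move=> bf; rewrite /Rintegral fineK//.
exact: (integrable_fin_num measurableT (bmeas_integrable nu bf)).
Qed.

Lemma rkernel_EFin (g : R -> R) (r B : R) : tame g ->
  rk r (EFin \o g) B = (mean nu U (Num.sqrt B) g r)%:E.
Proof.
move=> tg; rewrite /rkernel /mean -EFin_Rint//.
exact: (bmeas_sqn mU U1).
Qed.

Lemma meanC (g : R -> R) (r B : R) : mean nu U B g r = mean nu U r g B.
Proof.
by rewrite /mean; apply: eq_Rintegral => x _; congr g; rewrite /sqn; ring.
Qed.

Definition pair_mean (f : R -> R) (s w A : R) : R :=
  \int[nu]_x mean nu U (Num.sqrt A) f (Num.sqrt (s + w * U x)).

(** [rkernel_assoc] merges the pair first, into a vector of squared norm s + w U. [meanC] then makes
    the norm of that vector the variable radius, with |Y| as the fixed parameter B. *)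
Lemma pair_rkernel (f f1 : R -> R) (a b A : R) :
  tame f -> tame f1 -> (forall x : R, 0 <= x -> is_derive x 1 f (f1 x)) ->
  (forall x, 0 <= f x) -> 0 <= A ->
  rk `|b| (rk `|a| (EFin \o f)) A =
  (pair_mean f (a ^+ 2 + b ^+ 2) (2 * `|a * b|) A)%:E.
Proof.
move=> tf tf1 df f0 A0.
have mf : measurable_fun setT (EFin \o f) by apply/measurable_EFinP; exact: tf.1.
have f0' x : (0 <= (EFin \o f) x)%E by rewrite /= lee_fin.
have := @rkernel_assoc _ _ _ _ _ xi i0 xi_indep xi_unif a b (Num.sqrt A) _ mf f0'.
rewrite (sqr_sqrtr A0) => ->.
set t := 2 * _; set s := _ + _.
have ts : 0 <= t <= s.
  rewrite /t /s mulr_ge0//= normrM -(real_normK (num_real a)) -(real_normK (num_real b)).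
  by have := sqr_ge0 (`|a| - `|b|); lra.
have c1 : continuous (fun x => mean nu U (Num.sqrt A) f (Num.sqrt x)).
  move=> x; apply: continuous_comp; first exact: sqrt_continuous.
  exact: is_derive_continuous (is_derive_mean nu mU U1 (Num.sqrt A) tf tf1 df _).
have [mg bg] := continuous_tame c1.
rewrite /pair_mean -EFin_Rint; last first.
  split.
    apply: (measurableT_comp mg); apply: measurable_funD; first exact: measurable_cst.
    by apply: measurable_funM => //; exact: measurable_cst.
  by have [C gC] := bg (2 * s); exists C => x; apply: gC; have := U1 x; nra.
apply: eq_integral => x _.
rewrite (ger0_norm (sqrtr_ge0 A)) rkernel_EFin// meanC.
congr (mean _ _ _ _ (Num.sqrt _))%:E.
rewrite /sqn !real_normK ?num_real// /s /t normrM /U; ring.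
Qed.

Lemma integral_pair (f : R -> \bar R) (b : nat -> R) i j L :
  measurable_fun setT f -> (forall x, 0 <= f x)%E -> uniq (i :: j :: L) ->
  (\int[P]_w f (wnorm b (i :: j :: L) w) =
   \int[P]_w rk `|b j| (rk `|b i| f) (wnorm b L w))%E.
Proof.
move=> mf f0 /= /and3P[ijL jL _].
have mk r := measurable_rkernel xi i0 r mf f0; have k0 r B := rkernel_ge0 xi i0 r B f0.
rewrite (@resample _ _ _ _ _ xi i0 xi_indep xi_unif b i (j :: L) _ ijL mf f0).
by rewrite (@resample _ _ _ _ _ xi i0 xi_indep xi_unif b j L _ jL (mk _) (k0 _)).
Qed.

Definition sqsum (b : nat -> R) (L : seq nat) : R := \sum_(l <- L) b l ^+ 2.

Lemma sqsum_ge0 b L : 0 <= sqsum b L.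
Proof. by apply: sumr_ge0 => l _; exact: sqr_ge0. Qed.

Lemma integral_wnorm b L : uniq L ->
  (\int[P]_w (wnorm b L w)%:E)%E = (sqsum b L)%:E.
Proof.
(* [resample] asks for an integrand nonnegative on the whole line, hence the absolute value of a
   quantity already nonnegative. *)
have mf : measurable_fun setT (fun x : R => `|x|%:E).
  by apply/measurable_EFinP; exact: normr_measurable.
have f0 (x : R) : (0 <= `|x|%:E)%E by rewrite lee_fin.
have normE L' : (\int[P]_w (wnorm b L' w)%:E = \int[P]_w `|wnorm b L' w|%:E)%E.
  by apply: eq_integral => w _; rewrite ger0_norm// wnorm_ge0.
elim: L => [_|i L IH /= /andP[iL uL]].
  rewrite normE /wnorm (integral_wsum0 xi b (fun x => `|x|%:E)) normr0.
  by rewrite /sqsum big_nil.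
rewrite normE /wnorm.
rewrite (@resample _ _ _ _ _ xi i0 xi_indep xi_unif b i L _ iL mf f0).
have -> : (\int[P]_w rk `|b i| (fun x => `|x|%:E) (dot (ws b L w) (ws b L w)) =
   \int[P]_w ((b i ^+ 2)%:E + (wnorm b L w)%:E))%E.
  apply: eq_integral => w _; rewrite -/(wnorm b L w).
  have A0 := wnorm_ge0 b L w; move: (wnorm b L w) A0 => A A0.
  have tn : tame (fun x : R => `|x|).
    split; first exact: normr_measurable.
    by move=> N; exists N => x /andP[x0 xN]; rewrite normr_id ger0_norm.
  rewrite (rkernel_EFin _ _ tn) -EFinD; congr _%:E.
  have -> : b i ^+ 2 + A = \int[nu]_x (b i ^+ 2 + A +
     2 * (`|b i| * Num.sqrt A) * U x + 0 * U x ^+ 2 + 0 * U x ^+ 3 + 0 * U x ^+ 4).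
    by rewrite (Rint_poly4 mU U1 d2 partsU symU); ring.
  apply: eq_Rintegral => x _; rewrite ger0_norm; last exact: sqn_ge0.
  by rewrite /sqn (sqr_sqrtr A0) real_normK ?num_real//; ring.
rewrite ge0_integralD//.
- by rewrite integral_prob_cst IH// -EFinD /sqsum big_cons.
- by move=> w _; rewrite lee_fin sqr_ge0.
- by move=> w _; rewrite lee_fin wnorm_ge0.
- by apply/measurable_EFinP; exact: measurable_wnorm.
Qed.

(** Adding a summand b turns A^2 into (A + b^2)^2 + 4 b^2 A / d on average, at most A^2 + 4 b^2 A +
    b^4 because d >= 2. With E A = m this preserves the bound 2 m^2. *)
Lemma integral_wnorm_sqr b L : uniq L ->
  (\int[P]_w (wnorm b L w ^+ 2)%:E <= (2 * sqsum b L ^+ 2)%:E)%E.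
Proof.
have mf : measurable_fun setT (fun x : R => (x ^+ 2)%:E).
  by apply/measurable_EFinP; exact: exprn_measurable.
have f0 (x : R) : (0 <= (x ^+ 2)%:E)%E by rewrite lee_fin sqr_ge0.
have dR : (2 : R) <= d%:R by rewrite (ler_nat _ 2 d).
elim: L => [_|i L IH /= /andP[iL uL]].
  rewrite /wnorm (integral_wsum0 xi b (fun x => (x ^+ 2)%:E)).
  by rewrite /sqsum big_nil lee_fin expr0n/= mulr0.
rewrite /wnorm (@resample _ _ _ _ _ xi i0 xi_indep xi_unif b i L _ iL mf f0).
have mA : measurable_fun setT (fun w => (wnorm b L w)%:E).
  by apply/measurable_EFinP; exact: measurable_wnorm.
have mA2 : measurable_fun setT (fun w => (wnorm b L w ^+ 2)%:E).
  by apply/measurable_EFinP; apply: measurable_funX; exact: measurable_wnorm.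
have mcA : measurable_fun setT (fun w => (4 * b i ^+ 2)%:E * (wnorm b L w)%:E)%E.
  exact: measurable_funeM.
have mcA1 : measurable_fun setT
    (fun w => (4 * b i ^+ 2)%:E * (wnorm b L w)%:E + ((b i ^+ 2) ^+ 2)%:E)%E.
  by apply: emeasurable_funD.
apply: (@le_trans _ _ (\int[P]_w ((wnorm b L w ^+ 2)%:E +
    ((4 * b i ^+ 2)%:E * (wnorm b L w)%:E + ((b i ^+ 2) ^+ 2)%:E)))%E).
  apply: ge0_le_integral => //.
  - by move=> w _; exact: rkernel_ge0.
  - exact: (measurable_wnorm_comp b L (measurable_rkernel xi i0 _ mf f0)).
  - exact: (emeasurable_funD mA2 mcA1).
  move=> w _; rewrite -/(wnorm b L w) -EFinM -!EFinD.
  have A0 := wnorm_ge0 b L w; move: (wnorm b L w) A0 => A A0.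
  have tn : tame (fun x : R => x ^+ 2).
    rewrite (_ : (fun _ => _) = fun x => x * x); last by apply/funext => x; rewrite expr2.
    by apply: tameM; exact: tame_id.
  rewrite (rkernel_EFin _ _ tn) lee_fin.
  have -> : mean nu U (Num.sqrt A) (fun x => x ^+ 2) `|b i| =
     \int[nu]_x ((A + b i ^+ 2) ^+ 2 +
       4 * (A + b i ^+ 2) * (`|b i| * Num.sqrt A) * U x +
       4 * (b i ^+ 2 * A) * U x ^+ 2 + 0 * U x ^+ 3 + 0 * U x ^+ 4).
    apply: eq_Rintegral => x _.
    have aA := sqr_sqrtr A0; have bb := real_normK (num_real (b i)).
    move: (Num.sqrt A) `|b i| aA bb => a' b' <- <-.
    by rewrite /sqn; ring.
  rewrite (Rint_poly4 mU U1 d2 partsU symU).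
  have : 4 * (b i ^+ 2 * A) / d%:R <= 4 * (b i ^+ 2 * A) / 2.
    apply: ler_wpM2l; first by apply: mulr_ge0 => //; exact: mulr_ge0 (sqr_ge0 _) A0.
    by rewrite lef_pV2 ?posrE//; apply: lt_le_trans dR.
  lra.
have nA w : (0 <= (wnorm b L w)%:E)%E by rewrite lee_fin wnorm_ge0.
have c0 : (0 <= (4 * b i ^+ 2)%:E)%E by rewrite lee_fin mulr_ge0 ?sqr_ge0.
have ncA w : (0 <= (4 * b i ^+ 2)%:E * (wnorm b L w)%:E)%E by exact: mule_ge0.
rewrite ge0_integralD//; last by move=> w _; rewrite adde_ge0// lee_fin sqr_ge0.
rewrite ge0_integralD//.
rewrite ge0_integralZl//.
rewrite integral_wnorm// integral_prob_cst -EFinM -EFinD.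
apply: le_trans (leeD2r _ (IH uL)) _.
rewrite -EFinD lee_fin /sqsum big_cons -/(sqsum b L).
have := sqsum_ge0 b L; have := sqr_ge0 (b i).
move: (sqsum b L) (b i ^+ 2) => m z z0 m0; nra.
Qed.

(** The gain conditional on A = |Y|^2 is integrated with E A known exactly. For E A^2 an upper bound
    is enough, because k2 <= 0. *)
Lemma integral_gain (f f1 : R -> R) (b b' : nat -> R) i j L (k0 k1 k2 : R) :
  tame f -> tame f1 -> (forall x : R, 0 <= x -> is_derive x 1 f (f1 x)) ->
  (forall x, 0 <= f x) -> uniq (i :: j :: L) ->
  (forall l, l \in L -> b' l = b l) ->
  b i ^+ 2 + b j ^+ 2 = b' i ^+ 2 + b' j ^+ 2 -> k2 <= 0 ->
  (forall A, 0 <= A ->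
    pair_mean f (b i ^+ 2 + b j ^+ 2) (2 * `|b i * b j|) A + (k0 + k1 * A + k2 * A ^+ 2) <=
    pair_mean f (b i ^+ 2 + b j ^+ 2) (2 * `|b' i * b' j|) A) ->
  (\int[P]_w (f (wnorm b (i :: j :: L) w))%:E +
    (k0 + k1 * sqsum b L + k2 * (2 * sqsum b L ^+ 2))%:E <=
   \int[P]_w (f (wnorm b' (i :: j :: L) w))%:E)%E.
Proof.
move=> tf tf1 df f0 uL bb' ss k20 H.
have uL' : uniq L by move: uL => /= /and3P[].
have mf : measurable_fun setT (EFin \o f) by apply/measurable_EFinP; exact: tf.1.
have f0' x : (0 <= (EFin \o f) x)%E by rewrite /= lee_fin.
have mk r := measurable_rkernel xi i0 r mf f0'; have kk0 r B := rkernel_ge0 xi i0 r B f0'.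
have mkk r r' := measurable_rkernel xi i0 r (mk r') (kk0 r').
have kkk0 r r' B := rkernel_ge0 xi i0 r B (kk0 r').
pose E := (\int[P]_w rk `|b j| (rk `|b i| (EFin \o f)) (wnorm b L w))%E.
pose E' := (\int[P]_w rk `|b' j| (rk `|b' i| (EFin \o f)) (wnorm b L w))%E.
have e1 : (\int[P]_w (f (wnorm b (i :: j :: L) w))%:E)%E = E.
  exact: (@integral_pair (EFin \o f) b i j L mf f0' uL).
have e2 : (\int[P]_w (f (wnorm b' (i :: j :: L) w))%:E)%E = E'.
  apply: (etrans (@integral_pair (EFin \o f) b' i j L mf f0' uL)).
  apply: eq_integral => w _.
  have e : wsum xi b' L w = wsum xi b L w.
    by apply: eq_big_seq => l lL; rewrite bb'.
  by rewrite [in LHS]/wnorm e.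
rewrite e1 e2.
(* Splitting k0 and k1 into positive parts, with the negative ones moved across, leaves only
   integrals of nonnegative functions, which add without any finiteness assumption. *)
pose pp (x : R) := Num.max x 0.
have pp0 x : 0 <= pp x by rewrite le_max lexx orbT.
have ppE x : x = pp x - pp (- x).
  rewrite /pp; have [x0|x0] := leP x 0; have [y0|y0] := leP (- x) 0; lra.
have mA : measurable_fun setT (fun w => (wnorm b L w)%:E).
  by apply/measurable_EFinP; exact: measurable_wnorm.
have mA2 : measurable_fun setT (fun w => (wnorm b L w ^+ 2)%:E).
  by apply/measurable_EFinP; apply: measurable_funX; exact: measurable_wnorm.
have nA w : (0 <= (wnorm b L w)%:E)%E by rewrite lee_fin wnorm_ge0.
have nA2 w : (0 <= (wnorm b L w ^+ 2)%:E)%E by rewrite lee_fin sqr_ge0.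
pose q (a0 a1 a2 : R) w := (a0%:E + (a1%:E * (wnorm b L w)%:E + a2%:E * (wnorm b L w ^+ 2)%:E))%E.
have mq a0 a1 a2 : measurable_fun setT (q a0 a1 a2).
  apply: emeasurable_funD => //.
  by apply: emeasurable_funD; exact: measurable_funeM.
have nq a0 a1 a2 w : 0 <= a0 -> 0 <= a1 -> 0 <= a2 -> (0 <= q a0 a1 a2 w)%E.
  move=> h0 h1 h2; apply: adde_ge0; first by rewrite lee_fin.
  by apply: adde_ge0; apply: mule_ge0 => //; rewrite lee_fin.
have Iq a0 a1 a2 : 0 <= a0 -> 0 <= a1 -> 0 <= a2 ->
    (\int[P]_w q a0 a1 a2 w = a0%:E + (a1%:E * (sqsum b L)%:E +
      a2%:E * \int[P]_w (wnorm b L w ^+ 2)%:E))%E.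
  move=> h0 h1 h2; rewrite /q.
  have n0 : (0 <= a0%:E :> \bar R)%E by rewrite lee_fin.
  have n1 : (0 <= a1%:E :> \bar R)%E by rewrite lee_fin.
  have n2 : (0 <= a2%:E :> \bar R)%E by rewrite lee_fin.
  have m1 : measurable_fun setT (fun w => a1%:E * (wnorm b L w)%:E)%E.
    exact: measurable_funeM.
  have m2 : measurable_fun setT (fun w => a2%:E * (wnorm b L w ^+ 2)%:E)%E.
    exact: measurable_funeM.
  have p1 w : (0 <= a1%:E * (wnorm b L w)%:E)%E by exact: mule_ge0.
  have p2 w : (0 <= a2%:E * (wnorm b L w ^+ 2)%:E)%E by exact: mule_ge0.
  rewrite (ge0_integralD P measurableT (fun w _ => n0) (@measurable_cst _ _ _ _ _ _)
    (fun w _ => adde_ge0 (p1 w) (p2 w)) (emeasurable_funD m1 m2)).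
  rewrite (ge0_integralD P measurableT (fun w _ => p1 w) m1 (fun w _ => p2 w) m2).
  rewrite integral_prob_cst (ge0_integralZl _ measurableT mA)// (ge0_integralZl _ measurableT mA2)//.
  by rewrite integral_wnorm.
have M := integral_wnorm_sqr b uL'.
have lin (x y A c0 c1 p0 p1 q0 q1 : R) : c0 = p0 - q0 -> c1 = p1 - q1 ->
    x + (c0 + c1 * A + k2 * A ^+ 2) <= y ->
    x + (p0 + p1 * A) <= y + (q0 + (q1 * A + - k2 * A ^+ 2)).
  by move=> -> ->; lra.
have aux (x y p0 p1 p2 q0 q1 q2 A A2 : R) :
    x + (p0 + (p1 * A + p2 * A2)) <= y + (q0 + (q1 * A + q2 * A2)) ->
    (x%:E + (p0%:E + (p1%:E * A%:E + p2%:E * A2%:E)) <=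
     y%:E + (q0%:E + (q1%:E * A%:E + q2%:E * A2%:E)))%E.
  by rewrite -!EFinM -!EFinD lee_fin.
have key : (E + \int[P]_w q (pp k0) (pp k1) 0%R w <=
    E' + \int[P]_w q (pp (- k0)%R) (pp (- k1)%R) (- k2)%R w)%E.
  have nq1 w : (0 <= q (pp k0) (pp k1) 0%R w)%E by exact: nq.
  have k2' : 0 <= - k2 by lra.
  have nq2 w : (0 <= q (pp (- k0)%R) (pp (- k1)%R) (- k2)%R w)%E by exact: nq.
  have mr r r' := measurable_wnorm_comp b L (mkk r r').
  have eL := ge0_integralD P measurableT (fun w _ => kkk0 `|b j| `|b i| (wnorm b L w))
    (mr _ _) (fun w _ => nq1 w) (mq _ _ _).
  have eR := ge0_integralD P measurableT (fun w _ => kkk0 `|b' j| `|b' i| (wnorm b L w))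
    (mr _ _) (fun w _ => nq2 w) (mq _ _ _).
  apply: (le_trans (le_trans (lee_of_eq (esym eL)) _) (lee_of_eq eR)).
  apply: ge0_le_integral; first exact: measurableT.
  - by move=> w _; apply: adde_ge0; [exact: kkk0|exact: nq1].
  - exact: (emeasurable_funD (mr _ _) (mq _ _ _)).
  - exact: (emeasurable_funD (mr _ _) (mq _ _ _)).
  move=> w _; have A0 := wnorm_ge0 b L w; rewrite /q.
  have r1 := pair_rkernel (b i) (b j) tf tf1 df f0 A0.
  have r2 := pair_rkernel (b' i) (b' j) tf tf1 df f0 A0.
  rewrite -ss in r2; have {A0}HA := H _ A0.
  rewrite r1 r2; apply: aux; rewrite mul0r addr0.
  exact: (lin _ _ _ _ _ _ _ _ _ (ppE k0) (ppE k1) HA).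
rewrite !Iq// in key; last by lra.
have key2 : (E + (pp k0 + pp k1 * sqsum b L)%:E <=
    E' + (pp (- k0)%R + pp (- k1)%R * sqsum b L + - k2 * (2 * sqsum b L ^+ 2))%:E)%E.
  move: key; rewrite mul0e adde0 -EFinM -EFinD => /le_trans; apply.
  apply: leeD2l; rewrite -[X in (_ + (X + _) <= _)%E]EFinM addeA -EFinD [leRHS]EFinD.
  by apply: leeD2l; rewrite EFinM; apply: lee_wpmul2l => //; rewrite lee_fin; lra.
have -> : k0 + k1 * sqsum b L + k2 * (2 * sqsum b L ^+ 2) =
   (pp k0 + pp k1 * sqsum b L) -
   (pp (- k0) + pp (- k1) * sqsum b L + - k2 * (2 * sqsum b L ^+ 2)).
  by rewrite {1}(ppE k0) {1}(ppE k1); ring.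
by rewrite EFinB addeA leeBlDr.
Qed.

(** The [xi l] have norm 1 only almost surely, so [wnorm] may leave the given range at some w.
    Integrating out one summand at a time carries the range along through [sqn_le], without null
    sets. *)
Lemma integral_wnorm_mono b L (f g : R -> \bar R) : uniq L ->
  measurable_fun setT f -> measurable_fun setT g ->
  (forall x, 0 <= f x)%E -> (forall x, 0 <= g x)%E ->
  (forall x : R, 0 <= x <= (\sum_(l <- L) `|b l|) ^+ 2 -> (f x <= g x)%E) ->
  (\int[P]_w f (wnorm b L w) <= \int[P]_w g (wnorm b L w))%E.
Proof.
elim: L f g => [|i L IH] f g.
  move=> _ _ _ _ _ fg; rewrite /wnorm !integral_wsum0; apply: fg.
  by rewrite big_nil expr0n lexx.
move=> /= /andP[iL uL] mf mg f0 g0 fg.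
rewrite /wnorm (@resample _ _ _ _ _ xi i0 xi_indep xi_unif b i L _ iL mf f0).
rewrite (@resample _ _ _ _ _ xi i0 xi_indep xi_unif b i L _ iL mg g0).
apply: IH => //.
- exact: measurable_rkernel.
- exact: measurable_rkernel.
- by move=> x; exact: rkernel_ge0.
- by move=> x; exact: rkernel_ge0.
move=> B /andP[B0 BL]; rewrite /rkernel.
have S0 : 0 <= \sum_(l <- L) `|b l| by exact: sumr_ge0.
have ms : measurable_fun setT (fun x => sqn (Num.sqrt B) `|b i| (scoord i0 x)).
  apply: measurable_funD; first exact: measurable_cst.
  by apply: measurable_funM; [exact: measurable_cst|exact: mU].
apply: ge0_le_integral => //.
- exact: (measurableT_comp mf ms).
- exact: (measurableT_comp mg ms).
move=> x _; apply: fg; rewrite big_cons (sqn_ge0 _ _ (U1 x)) /=.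
have := @sqn_le _ (Num.sqrt B) `|b i| (U x) `|b i| (U1 x); rewrite normr_id => /(_ (lexx _)).
move=> /le_trans; apply.
rewrite (ger0_norm (sqrtr_ge0 B)) lerXn2r ?nnegrE ?addr_ge0 ?sqrtr_ge0//.
rewrite addrC lerD2l -[leRHS](ger0_norm S0) -sqrtr_sqr.
by rewrite ler_sqrt// sqr_ge0.
Qed.

End TwoSummands.

(** * Comparison of moments *)

(** [powR_ge_tangent_ge1] at the ratio x / (x + e) is the tangent of the k-th power at x + e. At x =
    0 the ratio is not positive, and k >= 1 makes the tangent value nonpositive. *)
Lemma powR_shift_le (R : realType) (k e x N : R) : 1 <= k -> 0 < e <= 1 -> 0 <= x <= N ->
  (x + e) `^ k <= x `^ k + e * (k * (N + 1) `^ (k - 1)).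
Proof.
move=> k1 /andP[e0 e1] /andP[x0 xN].
have y0 : 0 < x + e by lra.
have yk : (x + e) `^ k = (x + e) * (x + e) `^ (k - 1).
  rewrite -[X in X * _](powRr1 (ltW y0)) -powRD ?(gt_eqF y0) ?implybT//.
  by rewrite addrCA subrr addr0.
have h1 : (x + e) `^ k * (1 + k * (x / (x + e) - 1)) <= x `^ k.
  have [->|xn0] := eqVneq x 0.
    rewrite mul0r sub0r; apply: (@le_trans _ _ 0); last exact: powR_ge0.
    by apply: mulr_ge0_le0; [exact: powR_ge0|lra].
  have xp : 0 < x by rewrite lt_neqAle eq_sym xn0.
  have h : 1 + k * (x / (x + e) - 1) <= (x / (x + e)) `^ k.
    by apply: powR_ge_tangent_ge1 => //; rewrite divr_gt0.
  apply: (le_trans (ler_wpM2l (powR_ge0 _ _) h)).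
  rewrite -powRM ?divr_ge0 ?(ltW y0)//.
  by rewrite mulrCA mulfV ?mulr1// gt_eqF.
have h2 : (x + e) `^ (k - 1) <= (N + 1) `^ (k - 1).
  by apply: ge0_ler_powR; rewrite ?nnegrE; lra.
have h3 : (x + e) `^ k * (1 + k * (x / (x + e) - 1)) =
    (x + e) `^ k - e * (k * (x + e) `^ (k - 1)).
  by rewrite yk; field; rewrite gt_eqF.
have h4 : e * (k * (x + e) `^ (k - 1)) <= e * (k * (N + 1) `^ (k - 1)).
  by apply: ler_wpM2l; [exact: ltW|apply: ler_wpM2l => //; lra].
rewrite h3 in h1; lra.
Qed.

Lemma lee_addr_fin (R : realType) (X Y : \bar R) (a c1 c2 e eta : R) :
  (X + (a - e * c2)%:E <= Y + (e * c1)%:E)%E -> e * (c1 + c2) <= eta ->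
  (X + a%:E <= Y + eta%:E)%E.
Proof.
move=> h le; have -> : (X + a%:E = X + (a - e * c2)%:E + (e * c2)%:E)%E.
  by rewrite -addeA -EFinD subrK.
apply: (le_trans (leeD2r _ h)); rewrite -addeA; apply: leeD2l.
by rewrite -EFinD lee_fin -mulrDr.
Qed.

Section PowerStep.
Context {R : realType} {d : nat} {disp : measure_display}
  {Omega : measurableType disp} {P : probability Omega R}
  (xi : nat -> {RV P >-> borel_rV R d}) (i0 : 'I_d).
Hypothesis d2 : (2 <= d)%N.
Hypothesis xi_indep : independent_RVs xi.
Hypothesis xi_unif : forall j : nat, uniform_on_sphere (xi j).

Let nu : probability (borel_rV R d) R := distribution P (xi 0%N).
Let nuE (A : set (borel_rV R d)) : measurable A -> nu A = uniform_sphere_measure A.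
Proof. exact: xi_unif. Qed.
Let U := scoord i0 : borel_rV R d -> R.
Let mU : measurable_fun setT U. Proof. exact: measurable_scoord. Qed.
Let U1 x : -1 <= U x <= 1. Proof. exact: scoord_itv. Qed.
Let symU g : tame1 g -> \int[nu]_x g (U x) = \int[nu]_x g (- U x).
Proof. exact: (Rint_flip nuE). Qed.
Let partsU (g g1 : R -> R) : tame1 g -> tame1 g1 ->
  (forall u : R, -1 <= u <= 1 -> is_derive u 1 g (g1 u)) ->
  (d%:R - 1) * \int[nu]_x (U x * g (U x)) =
  \int[nu]_x ((1 - U x ^+ 2) * g1 (U x)).
Proof. exact: (Rint_parts nuE). Qed.

Variables (k : R) (b b' : nat -> R) (i j : nat) (L : seq nat).
Hypothesis k1 : 1 <= k.
Hypothesis uL : uniq (i :: j :: L).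
Hypothesis bb' : forall l, l \in L -> b' l = b l.
Hypothesis ss : b i ^+ 2 + b j ^+ 2 = b' i ^+ 2 + b' j ^+ 2.
Hypothesis sum1 : sqsum b (i :: j :: L) = 1.
Hypothesis spread : (b i * b j) ^+ 2 <= (b' i * b' j) ^+ 2.

Let s := b i ^+ 2 + b j ^+ 2.
Let m := sqsum b L.
Let w := 2 * `|b i * b j|.
Let w' := 2 * `|b' i * b' j|.
Let delta := (w' ^+ 2 - w ^+ 2) / d%:R.
Let Delta := (b' i * b' j) ^+ 2 - (b i * b j) ^+ 2.

Let sm : s + m = 1.
Proof. by rewrite -sum1 /sqsum !big_cons addrA. Qed.

Let s0 : 0 <= s. Proof. by rewrite addr_ge0 ?sqr_ge0. Qed.
Let m0 : 0 <= m. Proof. exact: sqsum_ge0. Qed.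
Let w0 : 0 <= w. Proof. by rewrite mulr_ge0. Qed.
Let ww' : w <= w'.
Proof.
by rewrite ler_pM2l// -(@ler_pXn2r _ 2)// ?nnegrE// !real_normK ?num_real.
Qed.
Let w's : w' <= s.
Proof.
rewrite /w' /s ss normrM -(real_normK (num_real (b' i))) -(real_normK (num_real (b' j))).
by have := sqr_ge0 (`|b' i| - `|b' j|); lra.
Qed.
Let deltaE : delta = 4 * Delta / d%:R.
Proof.
have h x : (2 * `|x|) ^+ 2 = 4 * x ^+ 2 :> R.
  by rewrite -(real_normK (num_real x)); ring.
by rewrite /delta /Delta /w /w' !h -mulrBr.
Qed.
Let Delta0 : 0 <= Delta. Proof. by rewrite subr_ge0. Qed.
Let dR : (2 : R) <= d%:R. Proof. by rewrite (ler_nat _ 2 d). Qed.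
Let delta0 : 0 <= delta.
Proof. by rewrite deltaE divr_ge0// mulr_ge0. Qed.

Let cL := k * (k - 1) * ((2 * k + d%:R - 2) * (2 * k + d%:R - 4) / (d%:R * (d%:R + 2))).

Let ctE : ctilde (2 * k) d = if k <= 2 then cL / d%:R else k * (k - 1) / d%:R * (385 / 1000).
Proof.
have dR' := dR.
have d0 : d%:R != 0 :> R by rewrite gt_eqF//; lra.
have d20 : d%:R + 2 != 0 :> R by rewrite gt_eqF//; lra.
rewrite /ctilde (_ : (2 * k <= 4) = (k <= 2)); last by apply/idP/idP; lra.
by case: ifP => _; rewrite /cL; field; rewrite ?d0 ?d20.
Qed.

(** Averaged over A, the tangent bounds are evaluated at s + m = 1, the point of contact. Only for k
    <= 2 is the evaluation at 1 + e instead, and the term e |cL delta| pays for that. *)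
Lemma gain_shifted (e : R) : 0 < e <= 1 ->
  (\int[P]_w (spow e 1 k (wnorm xi b (i :: j :: L) w))%:E +
    (2 * ctilde (2 * k) d * Delta - e * `|cL * delta|)%:E <=
   \int[P]_w (spow e 1 k (wnorm xi b' (i :: j :: L) w))%:E)%E.
Proof.
move=> /andP[e0 e1]; have k1' := k1; have s0' := s0; have m0' := m0; have sm' := sm.
have dR' := dR; have D0 := delta0; have ed := deltaE; have De0 := Delta0.
have d0 : d%:R != 0 :> R by rewrite gt_eqF//; lra.
have f0 x : 0 <= spow e 1 k x by rewrite /spow mul1r powR_ge0.
have gain (q0 q1 q2 : R) : q2 <= 0 ->
    (forall A, 0 <= A -> pair_mean xi i0 (spow e 1 k) s w A + (q0 + q1 * A + q2 * A ^+ 2) <=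
      pair_mean xi i0 (spow e 1 k) s w' A) ->
    2 * ctilde (2 * k) d * Delta - e * `|cL * delta| <= q0 + q1 * m + q2 * (2 * m ^+ 2) ->
  (\int[P]_w (spow e 1 k (wnorm xi b (i :: j :: L) w))%:E +
    (2 * ctilde (2 * k) d * Delta - e * `|cL * delta|)%:E <=
   \int[P]_w (spow e 1 k (wnorm xi b' (i :: j :: L) w))%:E)%E.
  move=> q20 H le; apply: le_trans (integral_gain d2 xi_indep xi_unif (tame_spow 1 k e0)
    (tame_spow _ _ e0) (fun x x0 => is_derive_spow 1 k e0 x0) f0 uL bb' ss q20 H).
  by apply: leeD2l; rewrite lee_fin.
have [k2|k2] := leP k 2.
  have cL0 : 0 <= cL.
    by apply: mulr_ge0; [|apply: divr_ge0]; apply: mulr_ge0; lra.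
  apply: (gain (cL * ((1 + (k - 2) * (s + e - 1)) / 2) * delta) (cL * ((k - 2) / 2) * delta) 0 (lexx 0)).
    move=> A A0; have k12 : 1 <= k <= 2 by rewrite k1.
    have := gain_le2 mU U1 d2 partsU symU e0 (Num.sqrt A) k12 w0 ww' w's.
    rewrite (sqr_sqrtr A0) -/cL -/delta; apply: le_trans.
    by rewrite lerD2l; apply: ler_of_eq; field.
  rewrite ctE k2.
  have -> : 2 * (cL / d%:R) * Delta = cL * delta / 2 by rewrite ed; field.
  have -> : cL * ((1 + (k - 2) * (s + e - 1)) / 2) * delta + cL * ((k - 2) / 2) * delta * m +
     0 * (2 * m ^+ 2) = cL * delta / 2 * (1 + (k - 2) * (s + m + e - 1)) by field.
  rewrite sm' ger0_norm; last exact: mulr_ge0.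
  have := mulr_ge0 cL0 D0; move: (cL * delta) => z z0.
  have : 0 <= z * (e * k) by rewrite !mulr_ge0; lra.
  nra.
have ck0 : 0 <= k * (k - 1) * delta by rewrite mulr_ge0// mulr_ge0; lra.
have E0 : 0 <= e * `|cL * delta| by rewrite mulr_ge0// ltW.
have ctk : 2 * ctilde (2 * k) d * Delta = k * (k - 1) * delta * (385 / 2000).
  by rewrite ctE leNgt k2 /= ed; field.
have [k3|k3] := leP k 3; last first.
  apply: (gain (k * (k - 1) * ((1 + (k - 2) * (s - 1)) / 2) * delta)
    (k * (k - 1) * ((k - 2) / 2) * delta) 0 (lexx 0)).
    move=> A A0; have k3' : 3 <= k by lra.
    have := gain_ge3 mU U1 d2 partsU symU e0 (Num.sqrt A) k3' w0 ww' w's.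
    rewrite (sqr_sqrtr A0) -/delta; apply: le_trans.
    by rewrite lerD2l; apply: ler_of_eq; field.
  rewrite ctk.
  have -> : k * (k - 1) * ((1 + (k - 2) * (s - 1)) / 2) * delta +
     k * (k - 1) * ((k - 2) / 2) * delta * m + 0 * (2 * m ^+ 2) =
     k * (k - 1) * delta / 2 * (1 + (k - 2) * (s + m - 1)) by field.
  rewrite sm' subrr mulr0 addr0 mulr1; lra.
apply: (gain (k * (k - 1) * (s / 2 - s ^+ 2 / 6) * delta)
  (k * (k - 1) * ((1 - (1 / 2 + d%:R^-1) * s) / 2) * delta) (k * (k - 1) * delta * - (8^-1))).
- by apply: mulr_ge0_le0 => //; lra.
- move=> A A0; have k23 : 2 <= k <= 3 by lra.
  have := gain_23 mU U1 d2 partsU symU e0 (Num.sqrt A) k23 w0 ww' w's.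
  rewrite (_ : Num.sqrt A ^+ 4 = (Num.sqrt A ^+ 2) ^+ 2); last by ring.
  rewrite (sqr_sqrtr A0) -/delta; apply: le_trans.
  by rewrite lerD2l; apply: ler_of_eq; field.
rewrite ctk.
have -> : k * (k - 1) * (s / 2 - s ^+ 2 / 6) * delta +
  k * (k - 1) * ((1 - (1 / 2 + d%:R^-1) * s) / 2) * delta * m +
  k * (k - 1) * delta * - 8^-1 * (2 * m ^+ 2) =
  k * (k - 1) * delta * ((s + m - s ^+ 2 / 3 - (1 / 2 + d%:R^-1) * s * m - m ^+ 2 / 2) / 2) by field.
have di : d%:R^-1 <= 2^-1 :> R by rewrite lef_pV2 ?posrE//; lra.
(* With m = 1 - s and 1/d replaced by its bound 1/2, the right side is 1/4 + s^2 / 12. *)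
have h : 385 / 2000 <= (s + m - s ^+ 2 / 3 - (1 / 2 + d%:R^-1) * s * m - m ^+ 2 / 2) / 2.
  have p : d%:R^-1 * (s * m) <= 2^-1 * (s * m) by apply: ler_wpM2r => //; exact: mulr_ge0.
  have q : (s + m) ^+ 2 = 1 by rewrite sm' expr1n.
  have := sqr_ge0 s; move: p q; rewrite sm'; nra.
by have := ler_wpM2l ck0 h; lra.
Qed.

Definition moment (k : R) (b : nat -> R) (L : seq nat) : \bar R :=
  (\int[P]_w ((wnorm xi b L w) `^ k)%:E)%E.

Lemma moment_step :
  (moment k b (i :: j :: L) + (2 * ctilde (2 * k) d * Delta)%:E <=
   moment k b' (i :: j :: L))%E.
Proof.
have k1' := k1.
pose N := (\sum_(l <- i :: j :: L) `|b' l|) ^+ 2.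
pose C := k * (N + 1) `^ (k - 1) + `|cL * delta|.
have N0 : 0 <= N by exact: sqr_ge0.
have C0 : 0 <= C by rewrite addr_ge0// mulr_ge0 ?powR_ge0//; lra.
have mpow : measurable_fun setT (fun x : R => (x `^ k)%:E).
  by apply/measurable_EFinP; exact: measurable_powR.
have pow0 (x : R) : (0 <= (x `^ k)%:E)%E by rewrite lee_fin powR_ge0.
apply/lee_addgt0Pr => eta eta0.
(* C e dominates the shift error of [powR_shift_le] plus that of [gain_shifted]; C + 1 avoids a
   division by 0. *)
pose e := Num.min 1 (eta / (C + 1)).
have C1 : 0 < C + 1 by lra.
have e0 : 0 < e by rewrite lt_min ltr01 divr_gt0.
have e1 : e <= 1 by rewrite ge_min lexx.
have eC : e * C <= eta.
  have h : e <= eta / (C + 1) by rewrite ge_min lexx orbT.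
  apply: (le_trans (ler_wpM2r C0 h)).
  rewrite mulrAC ler_pdivrMr// ler_pM2l//; lra.
have e01 : 0 < e <= 1 by rewrite e0.
have mf : measurable_fun setT (fun x : R => (spow e 1 k x)%:E).
  by apply/measurable_EFinP; have [] := tame_spow 1 k e0.
have f0 (x : R) : (0 <= (spow e 1 k x)%:E)%E by rewrite lee_fin /spow mul1r powR_ge0.
pose g (x : R) := ((x `^ k)%:E + (e * (k * (N + 1) `^ (k - 1)))%:E)%E.
have c0 : (0 <= (e * (k * (N + 1) `^ (k - 1)))%:E :> \bar R)%E.
  by rewrite lee_fin !mulr_ge0 ?powR_ge0//; lra.
have mg : measurable_fun setT g by apply: emeasurable_funD.
have g0 x : (0 <= g x)%E by rewrite adde_ge0.
have h1 : (moment k b (i :: j :: L) <=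
    \int[P]_w (spow e 1 k (wnorm xi b (i :: j :: L) w))%:E)%E.
  have := integral_wnorm_mono i0 xi_indep xi_unif (b := b) uL mpow mf pow0 f0.
  apply=> x /andP[x0 _].
  rewrite lee_fin /spow mul1r; apply: ge0_ler_powR; rewrite ?nnegrE; lra.
have h2 : (\int[P]_w (spow e 1 k (wnorm xi b' (i :: j :: L) w))%:E <=
    moment k b' (i :: j :: L) + (e * (k * (N + 1) `^ (k - 1)))%:E)%E.
  have := integral_wnorm_mono i0 xi_indep xi_unif (b := b') uL mf mg f0 g0.
  have -> : (\int[P]_w g (wnorm xi b' (i :: j :: L) w) =
      moment k b' (i :: j :: L) + (e * (k * (N + 1) `^ (k - 1)))%:E)%E.
    rewrite /g (ge0_integralD P measurableT (fun w _ => pow0 _)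
      (measurable_wnorm_comp xi b' _ mpow) (fun w _ => c0) (@measurable_cst _ _ _ _ _ _)).
    by rewrite integral_prob_cst.
  apply=> x xN; rewrite /g -EFinD lee_fin /spow mul1r.
  exact: powR_shift_le.
have h3 := gain_shifted e01.
exact: (lee_addr_fin (le_trans (leeD2r _ h1) (le_trans h3 h2)) eC).
Qed.

End PowerStep.

Lemma lee_add_trans (R : realType) (X Y Z : \bar R) (C x y : R) :
  (X + (C * (x - y))%:E <= Y)%E -> (Y + (C * y)%:E <= Z)%E -> (X + (C * x)%:E <= Z)%E.
Proof.
move=> XY YZ; rewrite -(subrK y x) mulrDr EFinD addeA.
exact: le_trans (leeD2r _ XY) YZ.
Qed.

(** * Passing to equal coefficients *)

Section Equalize.
Context {R : realType} {d : nat} {disp : measure_display}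
  {Omega : measurableType disp} {P : probability Omega R}
  (xi : nat -> {RV P >-> borel_rV R d}) (i0 : 'I_d).
Hypothesis d2 : (2 <= d)%N.
Hypothesis xi_indep : independent_RVs xi.
Hypothesis xi_unif : forall j : nat, uniform_on_sphere (xi j).

Lemma eq_moment (k : R) b b' L : {in L, b =1 b'} -> moment xi k b L = moment xi k b' L.
Proof.
move=> e; apply: eq_integral => w _; congr (_ `^ _)%:E; rewrite /wnorm.
suff -> : wsum xi b L w = wsum xi b' L w by [].
by rewrite /wsum big_seq [RHS]big_seq; apply: eq_bigr => l lL; rewrite e.
Qed.

Lemma moment_perm (k : R) b L L' : perm_eq L L' -> moment xi k b L = moment xi k b L'.
Proof.
move=> e; apply: eq_integral => w _; congr (_ `^ _)%:E; rewrite /wnorm.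
suff -> : wsum xi b L w = wsum xi b L' w by [].
exact: perm_big.
Qed.

Lemma sum_seq_lt0 (L : seq nat) (F : nat -> R) l : \sum_(l <- L) F l = 0 ->
  l \in L -> F l != 0 -> exists2 i, i \in L & F i < 0.
Proof.
move=> S0 lL Fl; apply: contrapT => none.
have F0 i : i \in L -> 0 <= F i.
  by move=> iL; rewrite leNgt; apply/negP => Fi; apply: none; exists i.
have := psumr_eq0 L F0; rewrite -big_seq S0 eqxx => /esym/allP /(_ l lL).
by rewrite lL /= (negbTE Fl).
Qed.

Definition sqdev (q : R) (b : nat -> R) (L : seq nat) : R := \sum_(l <- L) (q - b l ^+ 2) ^+ 2.

Lemma moment_pair (k q : R) b b' L i j : 1 <= k -> uniq L -> i \in L -> j \in L -> i != j ->
  (forall l, l != i -> l != j -> b' l = b l) ->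
  b i ^+ 2 + b j ^+ 2 = b' i ^+ 2 + b' j ^+ 2 ->
  (b i * b j) ^+ 2 <= (b' i * b' j) ^+ 2 -> sqsum b L = 1 ->
  sqsum b' L = 1 /\
  (moment xi k b L + (ctilde (2 * k) d * (sqdev q b L - sqdev q b' L))%:E <=
   moment xi k b' L)%E.
Proof.
move=> k1 uL iL jL ij bb ss sp s1.
pose L' := rem j (rem i L).
have ji : j \in rem i L by rewrite mem_rem_uniq// inE eq_sym ij.
have pL : perm_eq L [:: i, j & L'].
  apply: (perm_trans (perm_to_rem iL)); rewrite perm_cons; exact: perm_to_rem.
have uL' : uniq [:: i, j & L'] by rewrite -(perm_uniq pL).
have bb' l : l \in L' -> b' l = b l.
  move=> lL; move: uL' => /= /and3P[]; rewrite inE negb_or => /andP[_ iL'] jL' _.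
  by apply: bb; [apply: contraNneq iL' => <-|apply: contraNneq jL' => <-].
have s1' : sqsum b [:: i, j & L'] = 1 by rewrite -s1 /sqsum; apply/esym/perm_big.
have eL' : sqsum b' L' = sqsum b L'.
  by rewrite /sqsum big_seq [RHS]big_seq; apply: eq_bigr => l lL; rewrite bb'.
have dL' : sqdev q b' L' = sqdev q b L'.
  by rewrite /sqdev big_seq [RHS]big_seq; apply: eq_bigr => l lL; rewrite bb'.
have eS (F : nat -> R) : \sum_(l <- L) F l = F i + (F j + \sum_(l <- L') F l).
  by rewrite (perm_big _ pL) /= !big_cons.
split.
  rewrite -s1 /sqsum !eS !addrA ss; congr (_ + _); exact: eL'.
(* With x + y fixed, (q - x)^2 + (q - y)^2 is a constant minus 2 x y, here for the squares x and y
   of the two coefficients. *)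
have -> : sqdev q b L - sqdev q b' L = 2 * ((b' i * b' j) ^+ 2 - (b i * b j) ^+ 2).
  rewrite /sqdev !eS; move: dL'; rewrite /sqdev => ->; move: (\sum_(_ <- _) _) => z.
  rewrite !exprMn; have -> : b' j ^+ 2 = b i ^+ 2 + b j ^+ 2 - b' i ^+ 2 by rewrite ss addrC addKr.
  ring.
rewrite mulrA (mulrC (ctilde _ _) 2) !(moment_perm _ _ pL).
exact: (moment_step i0 d2 xi_indep xi_unif k1 uL' bb' ss s1' sp).
Qed.

(** Coefficients must reach c itself and not only its square, so the induction is on the number of
    indices with b l != c; [lee_add_trans] telescopes the gains. *)
Lemma moment_le_equal (k : R) b L : 1 <= k -> uniq L -> (1 < size L)%N -> sqsum b L = 1 ->
  (moment xi k b L + (ctilde (2 * k) d * sqdev (size L)%:R^-1%R b L)%:E <=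
   moment xi k (fun=> (Num.sqrt (size L)%:R)^-1)%R L)%E.
Proof.
move=> k1 uL L2; set c := (Num.sqrt (size L)%:R)^-1; set q := (size L)%:R^-1.
have n0 : 0 < (size L)%:R :> R by rewrite ltr0n (ltn_trans _ L2).
have cq : c ^+ 2 = q by rewrite /c exprVn sqr_sqrtr// ltW.
have step (b1 b2 : nat -> R) i j : sqsum b1 L = 1 -> i \in L -> j \in L -> i != j ->
    (forall l, l != i -> l != j -> b2 l = b1 l) ->
    b1 i ^+ 2 + b1 j ^+ 2 = b2 i ^+ 2 + b2 j ^+ 2 ->
    (b1 i * b1 j) ^+ 2 <= (b2 i * b2 j) ^+ 2 ->
    (sqsum b2 L = 1%R -> moment xi k b2 L + (ctilde (2 * k) d * sqdev q b2 L)%:E <=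
      moment xi k (fun=> c) L)%E ->
    (moment xi k b1 L + (ctilde (2 * k) d * sqdev q b1 L)%:E <=
      moment xi k (fun=> c) L)%E.
  move=> s1 iL jL ij bb ss sp IH.
  have [s2 h] := moment_pair q k1 uL iL jL ij bb ss sp s1.
  exact: (lee_add_trans h (IH s2)).
have cnt (b1 b2 : nat -> R) i j : i \in L -> b1 i != c -> b2 i = c ->
    (forall l, l != i -> l != j -> b2 l = b1 l) -> (b1 j = c -> b2 j = c) ->
    (count (fun l => b2 l != c) L < count (fun l => b1 l != c) L)%N.
  move=> iL b1i b2i bb bj; rewrite !(permP (perm_to_rem iL)) /= b1i b2i eqxx ltnS.
  apply: sub_count => l /=; apply: contraNN => /eqP b1l.
  have [->|li] := eqVneq l i; first exact/eqP.
  have [e|lj] := eqVneq l j; first by rewrite e bj -?e.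
  by rewrite bb// b1l.
move: {2}(count _ _).+1 (ltnSn (count (fun l => b l != c) L)) => m.
elim: m b => // m IH b; rewrite ltnS => bm s1.
have [/allP bc|/allPn[l lL bl]] := boolP (all (fun l => b l == c) L).
  rewrite (eq_moment k (b' := fun=> c)); last by move=> l /bc /eqP.
  rewrite (_ : sqdev _ _ _ = 0) ?mulr0 ?adde0//.
  rewrite /sqdev big_seq; apply: big1 => l /bc /eqP ->.
  by rewrite cq subrr expr0n.
(* In the first case b l = -c. Flipping the sign is a step with zero gain and an arbitrary partner
   j, since all squares stay the same. *)
have [blq|blq] := eqVneq (b l ^+ 2) q.
  have [j jL jl] : exists2 j, j \in L & l != j.
    have : (0 < size (rem l L))%N by rewrite size_rem// -subn1 subn_gt0.
    case E : (rem l L) => [//|j r] _; exists j.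
      by have := mem_head j r; rewrite -E => /mem_rem.
    by have := mem_head j r; rewrite -E mem_rem_uniq// inE eq_sym => /andP[].
  pose b2 x := if x == l then c else b x.
  have b2l : b2 l = c by rewrite /b2 eqxx.
  have b2j : b2 j = b j by rewrite /b2 eq_sym (negbTE jl).
  have bb x : x != l -> x != j -> b2 x = b x by move=> xl _; rewrite /b2 (negbTE xl).
  apply: (step b b2 l j s1 lL jL jl bb); rewrite ?b2l ?b2j ?exprMn ?cq ?blq//.
  by apply: IH; apply: leq_trans bm; apply: (cnt _ _ l j) => //; rewrite b2j.
have sumq : \sum_(l <- L) (q - b l ^+ 2) = 0.
  rewrite big_split /= sumrN big_const_seq count_predT iter_addr_0 -mulr_natl.
  by rewrite mulfV ?gt_eqF//; move: s1; rewrite /sqsum => ->; rewrite subrr.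
have [i iL bi] : exists2 i, i \in L & q - b i ^+ 2 < 0.
  by apply: (sum_seq_lt0 sumq lL); rewrite subr_eq0 eq_sym.
have [j jL bj] : exists2 j, j \in L & - (q - b j ^+ 2) < 0.
  apply: (@sum_seq_lt0 L _ l); rewrite ?sumrN ?sumq ?oppr0//.
  by rewrite oppr_eq0 subr_eq0 eq_sym.
have ij : i != j.
  by apply/eqP => e; move: bj; rewrite -e; lra.
(* This keeps the sum of the two squares when the i-th becomes q; their product then grows by (b i^2
   - q)(q - b j^2). *)
pose r := Num.sqrt (b i ^+ 2 + b j ^+ 2 - q).
have r2 : r ^+ 2 = b i ^+ 2 + b j ^+ 2 - q.
  by rewrite sqr_sqrtr//; have := sqr_ge0 (b j); lra.
pose b2 x := if x == i then c else if x == j then r else b x.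
have b2i : b2 i = c by rewrite /b2 eqxx.
have b2j : b2 j = r by rewrite /b2 eq_sym (negbTE ij) eqxx.
have bb x : x != i -> x != j -> b2 x = b x.
  by move=> xi' xj; rewrite /b2 (negbTE xi') (negbTE xj).
have bjc : b j != c by apply: contraTneq bj => ->; rewrite cq subrr oppr0 ltxx.
apply: (step b b2 i j s1 iL jL ij bb).
- by rewrite b2i b2j cq r2; ring.
- rewrite b2i b2j !exprMn cq r2.
  have : 0 <= (b i ^+ 2 - q) * (q - b j ^+ 2) by rewrite mulr_ge0//; lra.
  nra.
- apply: IH; apply: leq_trans bm; apply: (cnt _ _ i j) => //.
  + by apply: contraTneq bi => ->; rewrite cq subrr ltxx.
  + by move=> e; rewrite e eqxx in bjc.
Qed.

End Equalize.

Theorem theorem2 (R : realType) (d : nat) (hd : (2 <= d)%N)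
    (disp : measure_display) (Omega : measurableType disp)
    (P : probability Omega R)
    (xi : nat -> {RV P >-> borel_rV R d})
    (xi_indep : independent_RVs xi)
    (xi_unif : forall j : nat, uniform_on_sphere (xi j))
    (p : R) (hp : 2 <= p)
    (n : nat) (hn : (2 <= n)%N)
    (a : 'I_n -> R) (ha : \sum_(j < n) a j ^+ 2 = 1) :
  ('E_P[fun w => (enorm (\sum_(j < n) a j *: (xi j w : 'rV[R]_d)) `^ p)%R]
   <= 'E_P[fun w => (enorm (\sum_(j < n)
             (Num.sqrt n%:R)^-1 *: (xi j w : 'rV[R]_d)) `^ p)%R]
      - (ctilde p d * \sum_(j < n) (n%:R^-1 - a j ^+ 2) ^+ 2)%:E)%E.
Proof.
have i0 : 'I_d := Ordinal (ltnW hd).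
(* The value 0 outside the index range is arbitrary: only l < n is ever summed. *)
pose b (l : nat) : R := if insub l is Some j then a j else 0.
have bE (j : 'I_n) : b j = a j by rewrite /b valK.
have pk : p = 2 * (p / 2) by field.
have momentE (c : nat -> R) :
    'E_P[fun w => (enorm (\sum_(j < n) c j *: (xi j w : 'rV[R]_d)) `^ p)%R]%E =
    moment xi (p / 2) c (index_iota 0 n).
  rewrite unlock; apply: eq_integral => w _ /=.
  rewrite -(big_mkord xpredT (fun j => c j *: (xi j w : 'rV[R]_d))).
  by rewrite enormE -powR12_sqrt ?dot_ge0// -powRrM mulrC.
have -> : (fun w => (enorm (\sum_(j < n) a j *: (xi j w : 'rV[R]_d)) `^ p)%R) =
    (fun w => (enorm (\sum_(j < n) b j *: (xi j w : 'rV[R]_d)) `^ p)%R).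
  by apply: funext => w; under [in RHS]eq_bigr do rewrite bE.
rewrite leeBrDr// momentE (momentE (fun=> (Num.sqrt n%:R)^-1)).
have sb : sqsum b (index_iota 0 n) = 1.
  by rewrite /sqsum big_mkord -ha; apply: eq_bigr => j _; rewrite bE.
have k1 : 1 <= p / 2 by lra.
have sn : size (index_iota 0 n) = n by rewrite size_iota subn0.
have := moment_le_equal i0 hd xi_indep xi_unif k1 (iota_uniq _ _) (b := b) (L := index_iota 0 n).
rewrite sn -pk => /(_ hn sb).
rewrite (_ : sqdev _ _ _ = \sum_(j < n) (n%:R^-1 - a j ^+ 2) ^+ 2)//.
by rewrite /sqdev big_mkord; apply: eq_bigr => j _; rewrite bE.
Qed.
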